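(* Let $\mathcal D$ be a distribution on $\mathcal X\times\{0,1\}$, where $\mathcal X=\{x\in\mathbb R^d:\|x\|_2\le1,\ x_1=\frac12\}$. Let $p\sim\pi$ be the randomized predictor learned by the online-to-batch reduction described in the context: the Blum–Mansour/Online-Newton-Step forecaster $\mathcal A$ with discretization parameter $N=(T/d)^{1/3}$ is run on $T$ i.i.d. samples from $\mathcal D$. With probability at least $1-\delta$, this randomized predictor satisfies $$\mathsf{DSOmni}_{\mathcal L^{\mathrm{cvx}},\mathcal F^{\mathrm{aff}}_{\mathrm{res}}}=\tilde{\mathcal O}\left(\left(\frac dT\right)^{\frac13}+\left(\frac dT\right)^{\frac13}\sqrt{\log\frac1\delta}\right).$$ Consequently, $\tilde\Omega(d\,\varepsilon^{-3})$ samples are sufficient for $p$ to achieve a swap omniprediction error at most $\varepsilon$. Here $\tilde{\mathcal O},\tilde\Omega$ hide lower-order logarithmic terms.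
   Context: Forecaster $\mathcal A$ (with parameter $N$, rounded to a positive integer). Let $z_i=i/N$ and $\mathcal Z=\{z_0,\dots,z_N\}$. For each $i\in\{0,\dots,N\}$ maintain a vector $\theta_{t,i}$ in the ball $4\mathbb B=\{\theta\in\mathbb R^d:\|\theta\|_2\le4\}$, with $\theta_{1,i}$ arbitrary. In round $t$, given the context $x_t\in\mathcal X$: (1) set $w_{t,i}=\mathrm{Proj}_{[0,1]}(\langle\theta_{t,i},x_t\rangle)$; (2) let $\boldsymbol q_{t,i}$ be the distribution on $\mathcal Z$ supported on the two neighbouring grid points $z_j\le w_{t,i}<z_{j+1}$, with masses $N(z_{j+1}-w_{t,i})$ and $N(w_{t,i}-z_j)$ respectively (all mass on $1$ if $w_{t,i}=1$); (3) let $Q_t$ be the matrix with columns $\boldsymbol q_{t,0},\dots,\boldsymbol q_{t,N}$ and compute a probability vector $\boldsymbol p_t=(p_{t,0},\dots,p_{t,N})$ with $Q_t\boldsymbol p_t=\boldsymbol p_t$; (4) predict by sampling from $\mathcal P_t$, where $\mathcal P_t(z_i)=p_{t,i}$, then observe $y_t\in\{0,1\}$; (5) for each $i$, perform an Online Newton Step for the loss $\phi_{t,i}(\theta)=p_{t,i}(\langle\theta,x_t\rangle-y_t)^2$: with $\beta=\frac1{640}$, $\omega=\frac1{4\beta^2}$, $\nabla_{\tau,i}=\nabla\phi_{\tau,i}(\theta_{\tau,i})$ and $A_{t,i}=\sum_{\tau\le t}\nabla_{\tau,i}\nabla_{\tau,i}^\top+\omega I_d$, let $\theta_{t+1,i}$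 be the minimizer over $\theta\in4\mathbb B$ of $(u-\theta)^\top A_{t,i}(u-\theta)$, where $u=\theta_{t,i}-\frac1\beta A_{t,i}^{-1}\nabla_{t,i}$. Online-to-batch reduction. Draw $(x_1,y_1),\dots,(x_T,y_T)$ i.i.d. from $\mathcal D$ and feed them in order to $\mathcal A$. The state of $\mathcal A$ before round $t$, together with fresh internal randomness independent of the samples, defines a predictor $p_t:\mathcal X\to\mathcal Z$: for each $x$, $p_t(x)$ is distributed as the prediction $\mathcal A$ would make in round $t$ on context $x$; the actual prediction in round $t$ is $p_t(x_t)$. Let $\pi$ be the uniform distribution over $p_1,\dots,p_T$; the randomized predictor is $p\sim\pi$. The probability in the claim is over the samples and the internal randomness producing $p_1,\dots,p_T$. Losses. $\mathcal L^{\mathrm{cvx}}$ is the class of $\ell:[0,1]\times\{0,1\}\to[-1,1]$ such that for each $y$ the map $p\mapsto\ell(p,y)$ is convex and $1$-Lipschitz. For a loss $\ell$, $k_\ell(q)=\arg\min_{p\in[0,1]}\mathbb E_{y\sim\mathrm{Ber}(q)}[\ell(p,y)]$ for $q\in[0,1]$. Hypotheses. $\mathcal F^{\mathrm{aff}}_{\mathrm{res}}=\{x\mapsto\frac{1+\langle\theta,x\rangle}{2}:\theta\in\mathbb R^d,\ \|\theta\|_2\le1\}$. Distributional swap omniprediction error of the randomized predictor: $$\mathsf{DSOmni}_{\mathcal L,\mathcal F}=\sup_{\{\ell_v\in\mathcal L,\,f_v\in\mathcal F\}_{v\in\mathcal Z}}\mathbb E_{(x,y)\sim\mathcal D,\ p\sim\pi}\Big[\ell_{p(x)}\big(k_{\ell_{p(x)}}(p(x)),y\big)-\ell_{p(x)}\big(f_{p(x)}(x),y\big)\Big],$$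 with $(x,y)$ a fresh draw, independent of $p_1,\dots,p_T$ and of the choice $p\sim\pi$. *)

(* Defs.v *)
From HB Require Import structures.
From mathcomp Require Import all_boot all_order all_algebra.
From mathcomp Require Import all_classical all_reals all_analysis.

Set Implicit Arguments.
Unset Strict Implicit.
Unset Printing Implicit Defensive.

Import Order.TTheory GRing.Theory Num.Theory.
Import numFieldNormedType.Exports.

Local Open Scope classical_set_scope.
Local Open Scope ring_scope.

(* Points of R^d are carried by [d.-tuple R] wherever a sigma-algebra is
   needed: its library structure is the product (hence Borel) one, whereas
   ['cV[R]_d] has no measurable structure. [vec] and [mxt] move to matrices. *)
Notation ctx R d := (d.-tuple R) (only parsing).

Definition vec (R : realType) (n : nat) (x : n.-tuple R) : 'cV[R]_n :=
  \col_i tnth x i.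

Definition mxt (R : realType) (n : nat) (M : n.-tuple (n.-tuple R)) :
    'M[R]_n := \matrix_(i, j) tnth (tnth M i) j.

Section euclidean.
Context {R : realType} {d : nat}.
Implicit Types (u v theta : 'cV[R]_d) (A : 'M[R]_d).

Definition dotp u v : R := (u^T *m v) 0 0.

(* The norm [`|v|] provided by the library on matrices is the sup norm. *)
Definition norm2 v : R := Num.sqrt (dotp v v).

Definition quad A v : R := (v^T *m A *m v) 0 0.

Definition grad (phi : 'cV[R]_d -> R) theta : 'cV[R]_d :=
  \col_k ('D_(delta_mx k 0) (phi : 'cV[R]_d -> R^o) theta).

Definition contexts : set (ctx R d) :=
  [set x | norm2 (vec x) <= 1 /\
           forall i : 'I_d, i = 0%N :> nat -> tnth x i = 2^-1].

End euclidean.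

Section forecaster.
Context {R : realType} {d N : nat}.
Implicit Types (x : ctx R d) (y : bool) (theta : 'cV[R]_d).

Definition grid_pt (j : nat) : R := j%:R / N%:R.

Definition prob_vec (p : 'cV[R]_N.+1) : Prop :=
  (forall i, 0 <= p i 0) /\ \sum_i p i 0 = 1.

Definition col_stochastic (Q : 'M[R]_N.+1) : Prop :=
  forall j, prob_vec (col j Q).

Definition proj01 (w : R) : R := Num.max 0 (Num.min 1 w).

(* The distribution q on the grid obtained by rounding w in [0, 1]: grid point
   j receives the first mass when it is the left neighbour of w and the second
   one when it is the right neighbour. *)
Definition round_dist (w : R) : 'cV[R]_N.+1 :=
  \col_j
    if w == 1 then (j == N :> nat)%:R
    else if grid_pt j <= w < grid_pt j.+1 then N%:R * (grid_pt j.+1 - w)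
    else if (0 < j)%N && (grid_pt j.-1 <= w < grid_pt j)
         then N%:R * (w - grid_pt j.-1)
    else 0.

(* [gram st i] is A_{t-1,i} = sum_{tau < t} nabla nabla^T + omega I. *)
Record state := State {
  theta_of : 'I_N.+1 -> 'cV[R]_d;
  gram : 'I_N.+1 -> 'M[R]_d
}.

Definition beta : R := 640^-1.
Definition omega : R := (4 * beta ^+ 2)^-1.
Definition ball4 : set 'cV[R]_d := [set theta | norm2 theta <= 4].

Definition init_state (theta1 : 'I_N.+1 -> 'cV[R]_d) : state :=
  State theta1 (fun _ => omega%:M).

Definition transition (st : state) x : 'M[R]_N.+1 :=
  \matrix_(j, i) round_dist (proj01 (dotp (theta_of st i) (vec x))) j 0.

(* The subroutine that computes a fixed point p = Q p is left arbitrary among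
   the measurable ones. *)
Definition stationary_rule (stat : 'M[R]_N.+1 -> 'cV[R]_N.+1) : Prop :=
  (forall Q, col_stochastic Q ->
     prob_vec (stat Q) /\ Q *m stat Q = stat Q) /\
  (forall j, measurable_fun [set: N.+1.-tuple (N.+1.-tuple R)]
     (fun M => stat (mxt M) j 0)).

Definition forecast stat (st : state) x : 'cV[R]_N.+1 :=
  stat (transition st x).

Definition round_loss (pi : R) x y theta : R :=
  pi * (dotp theta (vec x) - y%:R) ^+ 2.

(* Minimizer over the ball 4B of the A-distance to u; it is unique since
   A >= omega I, so the default value of [xget] is never used. *)
Definition gen_proj (A : 'M[R]_d) (u : 'cV[R]_d) : 'cV[R]_d :=
  xget 0 [set theta | ball4 theta /\
    forall theta', ball4 theta' -> quad A (u - theta) <= quad A (u - theta')].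

Definition step stat (st : state) (z : ctx R d * bool) : state :=
  let p := forecast stat st z.1 in
  let nabla i := grad (round_loss (p i 0) z.1 z.2) (theta_of st i) in
  let A i := gram st i + nabla i *m (nabla i)^T in
  State (fun i => gen_proj (A i)
                    (theta_of st i - beta^-1 *: (invmx (A i) *m nabla i)))
        A.

(* The state before round t, rounds being numbered from 0. It does not involve
   the sampled predictions: the update uses the vector p_t only. *)
Definition state_before stat (theta1 : 'I_N.+1 -> 'cV[R]_d)
    (zs : seq (ctx R d * bool)) (t : nat) : state :=
  foldl (step stat) (init_state theta1) (take t zs).

(* [draw s x p] is the grid index predicted with seed [s] on context [x] when
   the forecast is [p]. The joint law over several contexts for a common seed
   is unconstrained. *)
Definition sampling_rule dS (S : measurableType dS) (mu : probability S R)
    (draw : S -> ctx R d -> 'cV[R]_N.+1 -> 'I_N.+1) : Prop :=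
  (forall x p, prob_vec p ->
     forall i, mu [set s | draw s x p = i] = (p i 0)%:E) /\
  (forall i, measurable
     [set a : S * ctx R d * N.+1.-tuple R | draw a.1.1 a.1.2 (vec a.2) = i]).

Definition predictor (S : Type) stat
    (draw : S -> ctx R d -> 'cV[R]_N.+1 -> 'I_N.+1) (st : state) (s : S) :
    ctx R d -> 'I_N.+1 :=
  fun x => draw s x (forecast stat st x).

(* The predictors p_1, ..., p_T learned from the samples [Z] and seeds [U]. *)
Definition learned (T : nat) (Omega S : Type) stat
    (draw : S -> ctx R d -> 'cV[R]_N.+1 -> 'I_N.+1)
    (theta1 : 'I_N.+1 -> 'cV[R]_d)
    (Z : 'I_T -> Omega -> ctx R d * bool) (U : 'I_T -> Omega -> S)
    (w : Omega) : 'I_T -> ctx R d -> 'I_N.+1 :=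
  fun t => predictor stat draw
    (state_before stat theta1 [seq Z i w | i <- enum 'I_T] t) (U t w).

End forecaster.
Arguments state : clear implicits.
Arguments grid_pt {R} N j.

Section omniprediction.
Context {R : realType} {d : nat}.

Definition I01 : set R := `[0, 1]%classic.

(* Losses and post-processings are total functions on R, constrained (and only
   ever evaluated) on [0, 1]. *)
Definition L_cvx : set (R -> bool -> R) :=
  [set l | forall y : bool,
     [/\ forall p, I01 p -> -1 <= l p y <= 1,
         convex_function I01 (fun p => l p y) &
         1.-lipschitz_I01 ((fun p => l p y) : R -> R)]].

(* [k l q] is some minimizer: ties in the argmin are broken arbitrarily. *)
Definition best_response (L : set (R -> bool -> R))
    (k : (R -> bool -> R) -> R -> R) : Prop :=
  forall l q, L l -> I01 q ->
    I01 (k l q) /\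
    forall p, I01 p ->
      ('E_(bernoulli_prob q)[l (k l q)] <= 'E_(bernoulli_prob q)[l p])%E.

Definition F_aff_res : set (ctx R d -> R) :=
  [set f | exists2 theta : 'cV[R]_d, norm2 theta <= 1 &
     f = fun x => (1 + dotp theta (vec x)) / 2].

(* Error of the randomized predictor uniform over p_1, ..., p_T; the grid point
   v = i / N is represented by its index i. *)
Definition DSOmni (T N : nat) (L : set (R -> bool -> R))
    (F : set (ctx R d -> R)) (k : (R -> bool -> R) -> R -> R)
    (D : probability (ctx R d * bool)%type R)
    (p : 'I_T -> ctx R d -> 'I_N.+1) : \bar R :=
  ereal_sup [set e | exists (l : 'I_N.+1 -> R -> bool -> R)
                            (f : 'I_N.+1 -> ctx R d -> R),
    [/\ forall v, L (l v), forall v, F (f v) &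
     e = ((T%:R^-1)%:E * \sum_(t < T)
           \int[D]_(z in contexts `*` [set: bool])
             let v := p t z.1 in
             (l v (k (l v) (grid_pt N v)) z.2 - l v (f v z.1) z.2)%:E)%E]].

End omniprediction.

Section randomness.
Context {R : realType} {dO : measure_display} {Omega : measurableType dO}.
Variable P : probability Omega R.

Definition iid dX (X : measurableType dX) (T : nat)
    (W : 'I_T -> Omega -> X) (law : set X -> \bar R) : Prop :=
  [/\ forall i, measurable_fun setT (W i),
      forall i A, measurable A -> P (W i @^-1` A) = law A &
      forall (J : {set 'I_T}) (A : 'I_T -> set X),
        (forall i, measurable (A i)) ->
        P (\bigcap_(i in [set` J]) (W i @^-1` A i)) =
        (\prod_(i in J) P (W i @^-1` A i))%E].

(* "E holds with probability at least 1 - delta", for an event E that need not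
   be known to be measurable. *)
Definition whp (delta : R) (E : set Omega) : Prop :=
  exists2 E0 : set Omega, measurable E0 /\ E0 `<=` E &
    ((1 - delta)%:E <= P E0)%E.

End randomness.

(* Main.v *)
(** The regret of the Online Newton Step bounds, for each [i], the cumulated
    [p_(t,i)]-weighted excess square loss of [w_(t,i)] over any fixed linear
    predictor.  Since [Q_t p_t = p_t], rounding turns the mixture of the [w_(t,i)]
    into the forecast itself at a cost [T / (4 N ^ 2)], so the forecast has small
    swap regret for the square loss.  Against the comparator obtained by moving
    the constant [z_j] along [V_j = sum_t p_(t,j) (y_t - z_j) x_t], this regret is
    at least [sum_j |V_j| ^ 2 / n_j], where [n_j = sum_t p_(t,j)]; Cauchy-Schwarz
    then bounds [sum_j |V_j|].

    The deviation of the [V_j] from their population counterparts [M_j] is a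
    martingale with values in a Euclidean space.  A supermartingale
    [expR (l_t * |S_t| ^ 2)] with slowly decreasing [l_t] controls it without any
    dependence on the dimension.

    Finally, linearizing the convex loss at the mean of the competitor on a level
    set bounds the omniprediction gap of that level set by [15 |M_j|]. *)

Require Import Defs.
From HB Require Import structures.
From mathcomp Require Import all_boot all_order all_algebra.
From mathcomp Require Import all_classical all_reals all_analysis.
From mathcomp Require Import measurable_realfun ring lra.

Set Implicit Arguments.
Unset Strict Implicit.
Unset Printing Implicit Defensive.

Import Order.TTheory GRing.Theory Num.Theory.
Import numFieldNormedType.Exports.

Local Open Scope classical_set_scope.
Local Open Scope ring_scope.

(** * Positive definite quadratic forms and determinants *)

Section euclidean_theory.
Context {R : realType} {d : nat}.
Implicit Types (u v w : 'cV[R]_d) (A : 'M[R]_d).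

(** The obstacle is that the loss and the competitor may both be chosen for each grid point after
    the predictors are known, from infinite classes. No covering argument is made: all such choices
    are controlled by the same d-dimensional vectors [M_j], so a single concentration event serves
    for the whole supremum.

    The normalization x_1 = 1/2 is used twice. It makes constant predictions linear, so that the
    comparator 2 z_j e_1 + V_j / n_j has norm at most 3 and lies in the ball of the Newton step; and
    it makes the mean residual on a level set twice a coordinate of [M_j].

    The N + 1 learners have total regret of order N d log (e + T / d), while rounding costs T / N ^
    2; up to the logarithm the two balance at N = (T / d) ^ (1 / 3). The deviation term, of order
    sqrt (N T) up to its confidence factor, does not exceed the resulting rate.

    Much of the length is measurability: the martingale argument needs the state to be a measurable
    function of the past samples, although it is produced by an argmin and an arbitrary fixed-point
    rule. *)

Lemma dotpE u v : dotp u v = \sum_i u i 0 * v i 0.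
Proof. by rewrite /dotp mxE; apply: eq_bigr => i _; rewrite mxE. Qed.

Lemma dotpC u v : dotp u v = dotp v u.
Proof. by rewrite !dotpE; apply: eq_bigr => i _; rewrite mulrC. Qed.

Lemma dotpDl u v w : dotp (u + v) w = dotp u w + dotp v w.
Proof. by rewrite /dotp linearD mulmxDl mxE. Qed.

Lemma dotpDr u v w : dotp w (u + v) = dotp w u + dotp w v.
Proof. by rewrite /dotp mulmxDr mxE. Qed.

Lemma dotpZl a u w : dotp (a *: u) w = a * dotp u w.
Proof. by rewrite /dotp linearZ -scalemxAl mxE. Qed.

Lemma dotpZr a u w : dotp w (a *: u) = a * dotp w u.
Proof. by rewrite dotpC dotpZl dotpC. Qed.

Lemma dotpNl u w : dotp (- u) w = - dotp u w.
Proof. by rewrite -scaleN1r dotpZl mulN1r. Qed.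

Lemma dotpNr u w : dotp w (- u) = - dotp w u.
Proof. by rewrite dotpC dotpNl dotpC. Qed.

Lemma dotp0l w : dotp 0 w = 0.
Proof. by rewrite -(scale0r 0) dotpZl mul0r. Qed.

Lemma dotp_suml I (r : seq I) (P : pred I) (F : I -> 'cV[R]_d) w :
  dotp (\sum_(i <- r | P i) F i) w = \sum_(i <- r | P i) dotp (F i) w.
Proof. exact: (big_morph (dotp^~ w) (fun x y => dotpDl x y w) (dotp0l w)). Qed.

Definition dotp_linear :=
  (dotpDl, dotpDr, dotpNl, dotpNr, dotpZl, dotpZr).

Lemma dotp_ge0 v : 0 <= dotp v v.
Proof. by rewrite dotpE sumr_ge0// => i _; rewrite -expr2 sqr_ge0. Qed.

Lemma dotp_eq0 v : dotp v v = 0 -> v = 0.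
Proof.
rewrite dotpE => /eqP; rewrite psumr_eq0 => [/allP v0|i _]; last first.
  by rewrite -expr2 sqr_ge0.
apply/matrixP => i j; rewrite ord1 mxE; apply/eqP.
by have := v0 i; rewrite mem_index_enum mulf_eq0 orbb => /(_ isT).
Qed.

Lemma norm2_ge0 v : 0 <= norm2 v.
Proof. exact: sqrtr_ge0. Qed.

Lemma sqr_norm2 v : norm2 v ^+ 2 = dotp v v.
Proof. by rewrite sqr_sqrtr ?dotp_ge0. Qed.

Lemma cauchy_schwarz u v : dotp u v ^+ 2 <= dotp u u * dotp v v.
Proof.
have [v0|v0] := eqVneq (dotp v v) 0.
  by rewrite (dotp_eq0 v0) dotpC !dotp0l expr0n mulr0.
have vp : 0 < dotp v v by rewrite lt_def v0 dotp_ge0.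
have := dotp_ge0 (dotp v v *: u - dotp u v *: v).
rewrite !dotp_linear (dotpC v u) => H.
have: 0 <= dotp v v * (dotp u u * dotp v v - dotp u v ^+ 2).
  by apply: le_trans H _; rewrite le_eqVlt; apply/orP; left; apply/eqP; ring.
by rewrite pmulr_rge0// subr_ge0.
Qed.

Lemma ler_dotp u v : `|dotp u v| <= norm2 u * norm2 v.
Proof.
rewrite -(@ler_pXn2r _ 2)// ?nnegrE ?mulr_ge0 ?norm2_ge0//.
by rewrite exprMn !sqr_norm2 real_normK ?num_real// cauchy_schwarz.
Qed.

Lemma norm2D u v : norm2 (u + v) <= norm2 u + norm2 v.
Proof.
rewrite -(@ler_pXn2r _ 2)// ?nnegrE ?addr_ge0 ?norm2_ge0//.
rewrite sqrrD !sqr_norm2 !dotp_linear (dotpC v u).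
have := le_trans (ler_norm _) (ler_dotp u v).
by lra.
Qed.

Lemma norm2Z a v : norm2 (a *: v) = `|a| * norm2 v.
Proof.
by rewrite /norm2 dotpZl dotpZr mulrA -expr2 sqrtrM ?sqr_ge0// sqrtr_sqr.
Qed.

Lemma norm20 : norm2 (0 : 'cV[R]_d) = 0.
Proof. by rewrite /norm2 dotp0l sqrtr0. Qed.

Lemma norm2_sum I (r : seq I) (P : pred I) (F : I -> 'cV[R]_d) :
  norm2 (\sum_(i <- r | P i) F i) <= \sum_(i <- r | P i) norm2 (F i).
Proof.
elim/big_ind2: _ => //; first by rewrite norm20.
by move=> x a y b xa yb; apply: (le_trans (norm2D _ _)); apply: lerD.
Qed.

Lemma norm2_le v c : 0 <= c -> (norm2 v <= c) = (dotp v v <= c ^+ 2).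
Proof. by move=> c0; rewrite -sqr_norm2 ler_pXn2r// nnegrE ?norm2_ge0. Qed.

Lemma quadE A v : quad A v = dotp v (A *m v).
Proof. by rewrite /quad /dotp mulmxA. Qed.

Lemma quadDl A (B : 'M[R]_d) v : quad (A + B) v = quad A v + quad B v.
Proof. by rewrite /quad mulmxDr mulmxDl mxE. Qed.

Lemma quad_scalar c v : quad c%:M v = c * dotp v v.
Proof. by rewrite quadE mul_scalar_mx dotpZr. Qed.

Lemma quad_rank1 u v : quad (u *m u^T) v = dotp u v ^+ 2.
Proof.
rewrite /quad mulmxA -mulmxA mxE big_ord1 expr2; congr (_ * _).
by rewrite -/(dotp v u) dotpC.
Qed.

Lemma dotp_mulmx_sym A u v : A^T = A -> dotp u (A *m v) = dotp v (A *m u).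
Proof.
by move=> sA; rewrite dotpC /dotp trmx_mul sA -mulmxA.
Qed.

End euclidean_theory.

(** * Coercive symmetric matrices under rank-one updates *)

Section definite.
Context {R : realType} {d : nat}.
Implicit Types (u v w : 'cV[R]_d) (A : 'M[R]_d) (c : R).

Definition coercive c A := A^T = A /\ forall v, c * dotp v v <= quad A v.

Lemma coercive_scalar c : coercive c c%:M.
Proof. by split=> [|v]; rewrite ?tr_scalar_mx// quad_scalar. Qed.

Lemma coercive_rank1 c A u : coercive c A -> coercive c (A + u *m u^T).
Proof.
move=> [sA cA]; split=> [|v]; first by rewrite linearD /= trmx_mul trmxK sA.
by rewrite quadDl quad_rank1; apply: (le_trans (cA v)); rewrite lerDl sqr_ge0.
Qed.

Lemma coercive_unit c A : 0 < c -> coercive c A -> A \in unitmx.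
Proof.
move=> c0 [sA cA]; rewrite -row_free_unit; apply/inj_row_free => v vA0.
have Av0 : A *m v^T = 0 by rewrite -sA -trmx_mul vA0 trmx0.
have := cA v^T; rewrite quadE Av0 dotpC dotp0l => H.
have: dotp v^T v^T <= 0 by rewrite -(pmulr_rle0 _ c0).
move=> H2; have /dotp_eq0 : dotp v^T v^T = 0.
  by apply/eqP; rewrite eq_le H2 dotp_ge0.
by move/(congr1 trmx); rewrite trmxK trmx0.
Qed.

Lemma quad_invmx_ge0 c A u : 0 < c -> coercive c A -> 0 <= dotp u (invmx A *m u).
Proof.
move=> c0 cA; have uA := coercive_unit c0 cA.
rewrite -[X in dotp X _](mulKVmx uA) dotpC -quadE.
by apply: le_trans (cA.2 _); rewrite mulr_ge0 ?dotp_ge0// ltW.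
Qed.

(** Matrix determinant lemma: the block matrix with rows (A, u) and (- v^T, 1) is factored into
    triangular blocks in two ways, by eliminating either diagonal block. *)
Lemma det_rank1 A u v : A \in unitmx ->
  \det (A + u *m v^T) = \det A * (1 + dotp v (invmx A *m u)).
Proof.
move=> uA; set k := dotp _ _.
have E1 : block_mx A u (- v^T) (1%:M : 'M[R]_1) =
    block_mx (A + u *m v^T) u 0 1%:M *m block_mx 1%:M 0 (- v^T) 1%:M.
  by rewrite mulmx_block !mulmx1 !mulmx0 mulmxN ?mul1mx ?mul0mx ?add0r addrK.
have E2 : block_mx A u (- v^T) (1%:M : 'M[R]_1) =
    block_mx A 0 (- v^T) 1%:M *m block_mx 1%:M (invmx A *m u) 0 (1 + k)%:M.
  rewrite mulmx_block !mulmx1 !mulmx0 !mul0mx !addr0 mulKVmx// mulNmx.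
  congr block_mx; rewrite mul1mx; apply/matrixP => i j.
  by rewrite !ord1 mulmxA !mxE /= /k /dotp mulmxA !mxE; ring.
have : \det (block_mx A u (- v^T) (1%:M : 'M[R]_1)) = \det (A + u *m v^T).
  by rewrite E1 det_mulmx det_ublock det_lblock !det1 !mulr1.
move=> <-; rewrite E2 det_mulmx det_ublock det_lblock !det1 det_scalar1.
by rewrite mulr1 mul1r.
Qed.

(** Sherman-Morrison, tested against u only. The vector w = (A + u u^T)^-1 u solves A w + <u, w> u =
    u, hence is a multiple of A^-1 u, and pairing with u gives a scalar equation for <u, w>. *)
Lemma dotp_invmx_rank1 c A u : 0 < c -> coercive c A ->
  let a := dotp u (invmx A *m u) in
  dotp u (invmx (A + u *m u^T) *m u) = a / (1 + a).
Proof.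
move=> c0 cA a; have uA := coercive_unit c0 cA.
have uB := coercive_unit c0 (coercive_rank1 u cA).
have a0 : 0 <= a := quad_invmx_ge0 u c0 cA.
have a1 : 1 + a != 0 by rewrite gt_eqF// ltr_pwDl.
suff -> : invmx (A + u *m u^T) *m u = (1 + a)^-1 *: (invmx A *m u).
  by rewrite dotpZr mulrC.
apply: (canRL (scalerK a1)).
set w := invmx _ *m u.
have Bw : A *m w + dotp u w *: u = u.
  rewrite -[RHS](mulKVmx uB u) -/w mulmxDl -mulmxA; congr (_ + _).
  by apply/matrixP => i j; rewrite ord1 !mxE big_ord1 mulrC.
have Ew : w = (1 - dotp u w) *: (invmx A *m u).
  have: A *m w = (1 - dotp u w) *: u.
    by rewrite scalerBl scale1r -[X in X - _]Bw addrK.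
  by move/(congr1 (mulmx (invmx A))); rewrite mulKmx// -scalemxAr.
have Eb : dotp u w = (1 - dotp u w) * a by rewrite {1}Ew dotpZr.
rewrite Ew scalerA; have -> : (1 + a) * (1 - dotp u w) = 1.
  by nra.
by rewrite scale1r.
Qed.

Lemma det_coercive_rank1 c A u : 0 < c -> coercive c A -> 0 < \det A ->
  0 < \det (A + u *m u^T) /\ \det A <= \det (A + u *m u^T).
Proof.
move=> c0 cA dA; rewrite det_rank1 ?(coercive_unit c0)//.
have a0 := quad_invmx_ge0 u c0 cA.
split; first by rewrite mulr_gt0// ltr_pwDl.
by rewrite ler_pMr// lerDl.
Qed.

(** The elliptical potential bound: the left side is a / (1 + a), the right side is ln (1 + a). The
    log-determinants telescope along the rounds. *)
Lemma dotp_invmx_le_lndet c A u : 0 < c -> coercive c A -> 0 < \det A ->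
  dotp u (invmx (A + u *m u^T) *m u) <= ln (\det (A + u *m u^T)) - ln (\det A).
Proof.
move=> c0 cA dA; rewrite (dotp_invmx_rank1 u c0 cA).
rewrite det_rank1 ?(coercive_unit c0)//.
have a0 := quad_invmx_ge0 u c0 cA; set a := dotp _ _ in a0 *.
have a1 : 0 < 1 + a by rewrite ltr_pwDl.
rewrite lnM ?posrE// addrAC subrr add0r.
have := @le_ln1Dx R (- (a / (1 + a))).
rewrite (_ : 1 - a / (1 + a) = (1 + a)^-1); last by field; rewrite gt_eqF.
rewrite lnV ?posrE// lerN2; apply.
by rewrite ltrN2 ltr_pdivrMr// mul1r ltrDr.
Qed.

Lemma det_sum_rank1 (I : Type) (r : seq I) (F : I -> 'cV[R]_d) c A :
  0 < c -> coercive c A -> 0 < \det A ->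
  coercive c (A + \sum_(i <- r) F i *m (F i)^T) /\
  \det A <= \det (A + \sum_(i <- r) F i *m (F i)^T).
Proof.
move=> c0; elim: r A => [|i r IH] A cA dA; first by rewrite big_nil addr0.
rewrite big_cons addrA.
have [d1 d2] := det_coercive_rank1 (F i) c0 cA dA.
have [H1 H2] := IH _ (coercive_rank1 (F i) cA) d1.
by split=> //; apply: le_trans d2 H2.
Qed.

(** With w = A^-1 u, coercivity gives c |w|^2 <= <u, w>; inserting this into |u - c w|^2 >= 0 yields
    the claim. *)
Lemma dotp_invmx_le c A u : 0 < c -> coercive c A ->
  dotp u (invmx A *m u) <= dotp u u / c.
Proof.
move=> c0 cA; have uA := coercive_unit c0 cA.
set w := invmx A *m u.
have H1 : c * dotp w w <= dotp u w.
  by apply: (le_trans (cA.2 w)); rewrite quadE /w mulKVmx// dotpC.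
have H2 : 0 <= dotp (u - c *: w) (u - c *: w) := dotp_ge0 _.
rewrite ler_pdivlMr//; move: H2; rewrite !dotp_linear (dotpC w u).
by nra.
Qed.

(** Each update multiplies the determinant by 1 + a with ln (1 + a) <= a <= |F i|^2 / c. This crude
    estimate is logarithmic only when c is of the order of the mean squared gradient, so it is
    applied with a c much larger than [omega]. *)
Lemma ln_det_sum_rank1 (I : Type) (r : seq I) (F : I -> 'cV[R]_d) c : 0 < c ->
  ln (\det (c%:M + \sum_(i <- r) F i *m (F i)^T)) <=
  d%:R * ln c + (\sum_(i <- r) dotp (F i) (F i)) / c.
Proof.
move=> c0.
suff H A : coercive c A -> 0 < \det A ->
  ln (\det (A + \sum_(i <- r) F i *m (F i)^T)) <=
  ln (\det A) + (\sum_(i <- r) dotp (F i) (F i)) / c.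
  have := H _ (coercive_scalar c); rewrite det_scalar exprn_gt0//.
  by rewrite lnXn// mulr_natl; apply.
elim: r A => [|i r IH] A cA dA; first by rewrite !big_nil addr0 mul0r addr0.
rewrite !big_cons addrA.
have [d1 d2] := det_coercive_rank1 (F i) c0 cA dA.
apply: le_trans (IH _ (coercive_rank1 (F i) cA) d1) _.
rewrite mulrDl addrA lerD2r det_rank1 ?(coercive_unit c0)//.
have a0 := quad_invmx_ge0 (F i) c0 cA.
rewrite lnM ?posrE//; last by rewrite ltr_pwDl.
rewrite lerD2l; apply: le_trans (le_ln1Dx _) _; last exact: dotp_invmx_le.
by apply: lt_le_trans a0; rewrite ltrN10.
Qed.

(** Allows the regularizer to be enlarged in the analysis: (c' - c) I is itself a sum of rank-one
    terms, built on the basis vectors, and such terms only increase the determinant. *)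
Lemma det_scalar_mono (I : Type) (r : seq I) (F : I -> 'cV[R]_d) c c' :
  0 < c <= c' ->
  \det (c%:M + \sum_(i <- r) F i *m (F i)^T) <=
  \det (c'%:M + \sum_(i <- r) F i *m (F i)^T).
Proof.
case/andP => c0 cc'.
have dc : 0 < \det (c%:M : 'M[R]_d) by rewrite det_scalar exprn_gt0.
have [H1 H2] := det_sum_rank1 r F c0 (coercive_scalar c) dc.
set A := c%:M + _ in H1 H2 *.
have dA : 0 < \det A by apply: lt_le_trans H2.
pose G (k : 'I_d) : 'cV[R]_d := Num.sqrt (c' - c) *: delta_mx k 0.
have [_] := det_sum_rank1 (index_enum 'I_d) G c0 H1 dA.
suff -> : \sum_k G k *m (G k)^T = (c' - c)%:M.
  rewrite [X in _ <= \det X](_ : _ = c'%:M + \sum_(i <- r) F i *m (F i)^T)//.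
  have -> : (c'%:M : 'M[R]_d) = c%:M + (c' - c)%:M.
    by rewrite -raddfD /=; congr (_%:M); lra.
  by rewrite /A addrAC.
transitivity ((c' - c) *: \sum_k (delta_mx k k : 'M[R]_d)).
  rewrite scaler_sumr; apply: eq_bigr => k _.
  rewrite /G linearZ /= -scalemxAl -scalemxAr scalerA -expr2.
  by rewrite sqr_sqrtr ?subr_ge0// trmx_delta mul_delta_mx.
by rewrite -mx1_sum_delta scalemx1.
Qed.

End definite.

(** * Online Newton Step *)

Section projection.
Context {R : realType} {d : nat}.
Implicit Types (u v w theta : 'cV[R]_d) (A : 'M[R]_d) (c : R).

Lemma ball4_segment v w (t : R) : ball4 v -> ball4 w -> 0 <= t <= 1 ->
  ball4 (v + t *: (w - v)).
Proof.
rewrite /ball4 /= => bv bw /andP[t0 t1].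
have -> : v + t *: (w - v) = (1 - t) *: v + t *: w.
  by rewrite scalerBl scale1r scalerBr addrA addrAC.
apply: (le_trans (norm2D _ _)); rewrite !norm2Z !ger0_norm ?subr_ge0//.
have := norm2_ge0 v; have := norm2_ge0 w; nra.
Qed.

Lemma continuous_dotp (T : topologicalType) (f g : T -> 'cV[R]_d) :
  (forall i, continuous (fun x => f x i 0)) ->
  (forall i, continuous (fun x => g x i 0)) ->
  continuous (fun x => dotp (f x) (g x)).
Proof.
move=> cf cg x.
rewrite (_ : (fun x => _) = (\sum_i (fun x => f x i 0 * g x i 0))); last first.
  by apply/funext => y; rewrite dotpE fct_sumE.
elim/big_ind: _ => [|a b ca cb|i _]; first exact: cst_continuous.
- exact: continuousD.
- by apply: continuousM; [exact: cf|exact: cg].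
Qed.

Lemma continuous_mulmx_coord (T : topologicalType) A (f : T -> 'cV[R]_d) i :
  (forall i, continuous (fun x => f x i 0)) ->
  continuous (fun x => (A *m f x) i 0).
Proof.
move=> cf.
rewrite (_ : (fun x => _) = (fun x => dotp (row i A)^T (f x))).
  by apply: continuous_dotp => // j; exact: cst_continuous.
apply/funext => x; rewrite dotpE mxE; apply: eq_bigr => j _.
by rewrite !mxE.
Qed.

Lemma continuous_quad (T : topologicalType) A (f : T -> 'cV[R]_d) :
  (forall i, continuous (fun x => f x i 0)) -> continuous (fun x => quad A (f x)).
Proof.
move=> cf; rewrite (_ : (fun x => _) = (fun x => dotp (f x) (A *m f x))).
  by apply: continuous_dotp => // i; exact: continuous_mulmx_coord.
by apply/funext => x; rewrite quadE.
Qed.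

(** Stated on row vectors, where [bounded_closed_compact] applies. Coordinates are bounded by the
    Euclidean norm, and the ball is a closed sublevel set of a continuous form. *)
Lemma compact_ball4_tr : compact [set r : 'rV[R]_d | ball4 r^T].
Proof.
apply: bounded_closed_compact.
  exists 4; split; first exact: num_real.
  move=> M M4 r /= br; rewrite /Num.norm /= mx_normrE; apply/bigmax_leP.
  split=> [|[i j] _ /=]; first by apply: ltW; apply: lt_trans M4.
  apply: le_trans (ltW M4).
  rewrite -(@ler_pXn2r _ 2)// ?nnegrE// real_normK ?num_real//.
  apply: le_trans (_ : dotp r^T r^T <= _); last by rewrite -norm2_le.
  rewrite dotpE (bigD1 j)//= !mxE (ord1 i) -expr2 lerDl.
  by apply: sumr_ge0 => k _; rewrite mxE -expr2 sqr_ge0.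
rewrite (_ : [set r | _] = (fun r : 'rV[R]_d => dotp r^T r^T) @^-1` [set x | x <= 4 ^+ 2]).
  apply: preimage_closed => [x _|]; last exact: closed_le.
  move: x; apply: continuous_dotp => i;
    by under eq_fun do rewrite mxE; exact: coord_continuous.
by apply/seteqP; split=> r /=; rewrite /ball4 /= norm2_le.
Qed.

Lemma gen_proj_exists A u : exists theta, ball4 theta /\
  forall theta', ball4 theta' -> quad A (u - theta) <= quad A (u - theta').
Proof.
have ne : [set r : 'rV[R]_d | ball4 r^T] !=set0.
  by exists 0; rewrite /= /ball4 /= trmx0 norm20.
have [|r] := @compact_EVT_min _ R (fun r => quad A (u - r^T)) _ ne compact_ball4_tr.
  apply: continuous_subspaceT; apply: continuous_quad => i.
  under eq_fun do rewrite !mxE.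
  move=> x; apply: continuousB; first exact: cst_continuous.
  exact: coord_continuous.
rewrite inE /= => br minr; exists r^T; split=> // theta bt.
by have := minr theta^T; rewrite trmxK; apply; rewrite inE /= trmxK.
Qed.

Lemma gen_projP A u : ball4 (gen_proj A u) /\
  forall theta', ball4 theta' -> quad A (u - gen_proj A u) <= quad A (u - theta').
Proof.
rewrite /gen_proj; case: xgetP => [theta _ //|H].
by have [theta Ht] := gen_proj_exists A u; case: (H theta).
Qed.

Lemma quadD A v w : A^T = A ->
  quad A (v + w) = quad A v + 2 * dotp v (A *m w) + quad A w.
Proof.
move=> sA; rewrite !quadE mulmxDr !dotp_linear (dotp_mulmx_sym w v sA).
ring.
Qed.

Lemma quadZ A t v : quad A (t *: v) = t ^+ 2 * quad A v.
Proof. by rewrite !quadE -scalemxAr dotpZl dotpZr mulrA expr2. Qed.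

Lemma quadN A v : quad A (- v) = quad A v.
Proof. by rewrite -scaleN1r quadZ sqrrN expr1n mul1r. Qed.

(* First-order optimality on the segment from the projection to theta. *)
Lemma gen_proj_pythagoras A u theta : A^T = A -> ball4 theta ->
  quad A (gen_proj A u - theta) + quad A (u - gen_proj A u) <=
  quad A (u - theta).
Proof.
move=> sA bt; have [bp minp] := gen_projP A u; set p := gen_proj A u in bp minp *.
set b := dotp (u - p) (A *m (p - theta)).
set q := quad A (p - theta).
have key (t : R) : 0 < t <= 1 -> - 2 * b <= t * q.
  case/andP=> t0 t1.
  have : quad A (u - p) <= quad A (u - p + t *: (p - theta)).
    rewrite (_ : u - p + _ = u - (p + t *: (theta - p))).
      by apply: minp; apply: ball4_segment => //; rewrite ltW.
    by rewrite opprD addrA -scalerN opprB.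
  rewrite (quadD (u - p) (t *: (p - theta)) sA) quadZ -scalemxAr dotpZr -/b -/q.
  rewrite -addrA lerDl => H.
  by rewrite -(ler_pM2l t0); lra.
have b0 : 0 <= b.
  rewrite leNgt; apply/negP => bneg.
  have q0 : 0 < q by have := key 1; rewrite ltr01 lexx => /(_ isT); lra.
  (* If b were negative, a step this short would give - 2 b <= t q <= - b, which is impossible. *)
  have := key (Num.min 1 (- b / q)).
  rewrite lt_min ltr01 ge_min lexx /= divr_gt0 ?oppr_gt0// => /(_ isT).
  have : Num.min 1 (- b / q) * q <= - b / q * q.
    by rewrite ler_pM2r// ge_min lexx orbT.
  rewrite divfK ?gt_eqF//; lra.
rewrite (_ : u - theta = (u - p) + (p - theta)); last by rewrite addrA subrK.
rewrite [in leRHS]quadD// -/b -/q; lra.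
Qed.

End projection.

Section online_newton.
Context {R : realType} {d : nat}.
Implicit Types (g theta : 'cV[R]_d) (A : 'M[R]_d).

(** Expand the squared A'-distance from u to theta' and use that the projection does not increase
    it. The cross term is the linear loss 2 <g, theta - theta'>, and the rank-one part of A' is the
    quadratic correction. The last difference telescopes over the rounds. *)
Lemma newton_step (b c : R) A g theta theta' :
  0 < b -> 0 < c -> coercive c A -> ball4 theta' ->
  let A' := A + g *m g^T in
  let theta1 := gen_proj A' (theta - b^-1 *: (invmx A' *m g)) in
  2 * dotp g (theta - theta') - b * dotp g (theta - theta') ^+ 2 <=
  b^-1 * dotp g (invmx A' *m g) +
  b * (quad A (theta - theta') - quad A' (theta1 - theta')).
Proof.
move=> b0 c0 cA bt /=; set A' := A + _; set u := theta - b^-1 *: _.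
set theta1 := gen_proj A' u.
have cA' : coercive c A' := coercive_rank1 g cA.
have uA' := coercive_unit c0 cA'.
have H := gen_proj_pythagoras u cA'.1 bt; rewrite -/theta1 in H.
have q0 : 0 <= quad A' (u - theta1).
  by apply: le_trans (cA'.2 _); rewrite mulr_ge0 ?dotp_ge0// ltW.
have Eu : quad A' (u - theta') = quad A' (theta - theta') -
    2 * b^-1 * dotp g (theta - theta') + b^-1 ^+ 2 * dotp g (invmx A' *m g).
  rewrite (_ : u - theta' = (theta - theta') + - (b^-1 *: (invmx A' *m g))).
    rewrite quadD ?cA'.1// quadN quadZ mulmxN -scalemxAr mulKVmx//.
    rewrite dotpNr dotpZr (dotpC _ g) (quadE A' (invmx A' *m g)) mulKVmx// (dotpC _ g); ring.
  by rewrite /u addrAC.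
have EA : quad A' (theta - theta') = quad A (theta - theta') + dotp g (theta - theta') ^+ 2.
  by rewrite quadDl quad_rank1.
have {H q0} : b * quad A' (theta1 - theta') <= b * quad A' (u - theta').
  by rewrite ler_pM2l//; apply: le_trans H; rewrite lerDl.
rewrite Eu EA => H; set x := dotp g _ in H *; set y := dotp g _ in H *.
set z := quad A' _ in H *; set z' := quad A _ in H *.
suff -> : b^-1 * y + b * (z' - z) =
  b * (z' + x ^+ 2 - 2 * b^-1 * x + b^-1 ^+ 2 * y) + (2 * x - b * x ^+ 2) - b * z.
  by move: H; lra.
by field; rewrite gt_eqF.
Qed.

Lemma grad_round_loss (p : R) (x : d.-tuple R) y theta :
  grad (round_loss p x y) theta = (2 * p * (dotp theta (vec x) - y%:R)) *: vec x.
Proof.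
apply/matrixP => k j; rewrite (ord1 j) !mxE.
set a := dotp theta (vec x) - y%:R; set xk := tnth x k.
apply: cvg_lim => //=.
have E (h : R) : h != 0 -> h^-1 *: ((round_loss p x y (h *: delta_mx k 0 + theta) : R^o) -
    round_loss p x y theta) = 2 * p * a * xk + h * (p * xk ^+ 2).
  move=> h0; rewrite /round_loss dotpDl dotpZl.
  have -> : dotp (delta_mx k 0) (vec x) = xk.
    rewrite dotpE (bigD1 k)//= big1 => [|i ik]; last by rewrite !mxE (negbTE ik) mul0r.
    by rewrite !mxE !eqxx mul1r addr0.
  rewrite -addrA (addrC (h * xk)) -/a /GRing.scale /=; by field.
apply: cvg_trans (_ : (fun h => 2 * p * a * xk + h * (p * xk ^+ 2)) @ 0^' --> _).
  apply: near_eq_cvg; near=> h; rewrite [RHS]E//.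
  by near: h; exact: nbhs_dnbhs_neq.
rewrite -[X in _ --> X]addr0 -[X in _ + X](mul0r (p * xk ^+ 2)).
apply: cvgD; first exact: cvg_cst.
by apply: cvgMl; apply: cvg_within.
Unshelve. all: by end_near. Qed.

End online_newton.

(** * Swap multicalibration of the forecaster *)

Section rounding.
Context {R : realType} {N : nat}.
Hypothesis N0 : (0 < N)%N.

Let Np : 0 < N%:R :> R. Proof. by rewrite ltr0n. Qed.

Lemma round_dist_sum (w : R) : 0 <= w <= 1 ->
  exists k, [/\ (k < N)%N, grid_pt N k <= w <= grid_pt N k.+1 &
    forall f : nat -> R, \sum_j @round_dist R N w j 0 * f j =
      N%:R * (grid_pt N k.+1 - w) * f k + N%:R * (w - grid_pt N k) * f k.+1 :> R].
Proof.
case/andP=> w0 w1.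
have [->|wn1] := eqVneq w 1.
  (* The point w = 1 is seen as the right end of the last cell, so that both cases obey the same
     formula. *)
  exists N.-1; rewrite prednK//; split => //.
    rewrite /grid_pt divff ?gt_eqF// lexx andbT ler_pdivrMr// mul1r ler_nat.
    exact: leq_pred.
  move=> f; rewrite /grid_pt divff ?gt_eqF// subrr mulr0 mul0r add0r.
  rewrite (bigD1 (ord_max : 'I_N.+1))//= big1 => [|j jN].
    rewrite !mxE !eqxx addr0; congr (_ * _).
    rewrite mulrBr mulr1 mulrCA divff ?gt_eqF// mulr1 -natrB ?leq_pred//.
    by rewrite -subn1 subKn.
  rewrite mxE eqxx; case: eqP => [jE|_]; last by rewrite mul0r.
  by move: jN; rewrite -val_eqE /= jE eqxx.
have wlt1 : w < 1 by rewrite lt_neqAle wn1.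
have Nw0 : 0 <= N%:R * w by rewrite mulr_ge0.
set k := Num.truncn (N%:R * w).
have /andP[k1 k2] : k%:R <= N%:R * w < k.+1%:R by exact: truncn_itv.
have kN : (k < N)%N by rewrite -(ltr_nat R) (le_lt_trans k1)// gtr_pMr.
have gE j : (grid_pt N j <= w < grid_pt N j.+1) = (j == k).
  rewrite /grid_pt ler_pdivrMr// ltr_pdivlMr// (mulrC w).
  apply/andP/eqP => [[h1 h2]|->]; last by split.
  have jk : (j < k.+1)%N by rewrite -(ltr_nat R) (le_lt_trans h1).
  have kj : (k < j.+1)%N by rewrite -(ltr_nat R) (le_lt_trans k1).
  by apply/eqP; rewrite eqn_leq -ltnS jk -ltnS kj.
exists k; split=> //.
  by have := gE k; rewrite eqxx => /andP[-> /ltW].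
move=> f.
rewrite (bigD1 (Ordinal (ltnW kN : k < N.+1)%N))//= mxE (negbTE wn1) gE eqxx.
congr (_ + _).
rewrite (bigD1 (Ordinal (kN : k.+1 < N.+1)%N))/=; last first.
  by rewrite -val_eqE /= gtn_eqF.
rewrite mxE (negbTE wn1) gE gtn_eqF//= gE eqxx big1 ?addr0// => j /andP[jk jk1].
rewrite mxE (negbTE wn1) gE.
move: jk jk1; rewrite -!val_eqE /= => /negbTE -> jk1.
case: (posnP j) => [->|j0]; first by rewrite mul0r.
have := gE j.-1; rewrite prednK// => ->.
case: eqP => [jE|]; last by rewrite mul0r.
by move: jk1; rewrite -jE prednK// eqxx.
Qed.

Lemma round_dist_prob (w : R) : 0 <= w <= 1 ->
  prob_vec (round_dist w : 'cV[R]_N.+1).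
Proof.
move=> w01; split=> [j|].
  rewrite mxE; case: ifP => // _; case: ifP => [/andP[_ h]|_].
    by rewrite mulr_ge0// subr_ge0 ltW.
  by case: ifP => // /and3P[_ h _]; rewrite mulr_ge0// subr_ge0.
have [k [kN /andP[k1 k2] H]] := round_dist_sum w01.
have := H (fun=> 1); under eq_bigr do rewrite mulr1.
move=> ->; rewrite /grid_pt -natr1; field; by rewrite gt_eqF.
Qed.

(** Rounding preserves the mean, so only its variance s (h - s) is added, where h = 1 / N and s is
    the offset of w in its cell; the slack is (s - h / 2)^2. *)
Lemma round_dist_sqr (w a : R) : 0 <= w <= 1 ->
  \sum_j @round_dist R N w j 0 * (grid_pt N j - a) ^+ 2 <=
  (w - a) ^+ 2 + (4 * N%:R ^+ 2)^-1 :> R.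
Proof.
move=> w01; have [k [kN /andP[k1 k2] H]] := round_dist_sum w01.
rewrite (H (fun j => (grid_pt N j - a) ^+ 2)).
set z := grid_pt N k in k1 H *; set h := N%:R^-1 : R.
have hE : grid_pt N k.+1 = z + h.
  by rewrite /z /h /grid_pt -natr1 mulrDl mul1r.
rewrite hE in k2 *.
have Nh : N%:R * h = 1 by rewrite /h divff// gt_eqF.
have -> : (4 * N%:R ^+ 2)^-1 = h ^+ 2 / 4 by rewrite /h; field; rewrite gt_eqF.
set s := w - z; have wE : w = z + s by rewrite /s; lra.
have -> : N%:R * (z + h - w) * (z - a) ^+ 2 + N%:R * s * (z + h - a) ^+ 2
   = (N%:R * h) * (z - a) ^+ 2 + (N%:R * h) * s * (2 * (z - a) + h).
  by rewrite wE; ring.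
rewrite Nh wE -subr_ge0.
have -> : (z + s - a) ^+ 2 + h ^+ 2 / 4 -
   (1 * (z - a) ^+ 2 + 1 * s * (2 * (z - a) + h)) = (s - h / 2) ^+ 2 by field.
exact: sqr_ge0.
Qed.

Lemma grid_pt_itv (j : 'I_N.+1) : 0 <= (grid_pt N j : R) <= 1.
Proof.
rewrite divr_ge0 ?ler0n//= ler_pdivrMr// mul1r ler_nat.
by rewrite -ltnS.
Qed.

End rounding.

Lemma proj01_itv (R : realType) (w : R) : 0 <= proj01 w <= 1.
Proof.
rewrite /proj01 le_max lexx /= ge_max ler01 /=.
by rewrite ge_min lexx.
Qed.

Lemma proj01_sqr (R : realType) (w : R) (y : bool) :
  (proj01 w - y%:R) ^+ 2 <= (w - y%:R) ^+ 2.
Proof.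
have y01 : 0 <= (y%:R : R) <= 1 by case: y; rewrite /= ?lexx ?ler01.
rewrite /proj01; have [w1|w1] := leP 1 w; first by rewrite max_r; [nra|lra].
by have [w0|w0] := leP 0 w; nra.
Qed.

(** * Regret along a trajectory of the forecaster *)

Section trajectory.
Context {R : realType} {d N : nat}.
Variables (stat : 'M[R]_N.+1 -> 'cV[R]_N.+1) (theta1 : 'I_N.+1 -> 'cV[R]_d).
Hypotheses (d0 : (0 < d)%N) (N0 : (0 < N)%N).
Hypotheses (theta1B : forall i, ball4 (theta1 i)) (statP : stationary_rule stat).
Implicit Types (st : state R d N) (x : d.-tuple R).

Let dp : 0 < d%:R :> R. Proof. by rewrite ltr0n. Qed.

Lemma transition_stochastic st x : col_stochastic (transition st x).
Proof.
move=> i; have [h1 h2] := round_dist_prob N0 (proj01_itv (dotp (theta_of st i) (vec x))).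
by split=> [j|]; [|rewrite -[RHS]h2; apply: eq_bigr => j _]; rewrite !mxE in h1 *;
  [have := h1 j; rewrite mxE|].
Qed.

Lemma forecast_prob st x : prob_vec (forecast stat st x).
Proof. exact: (statP.1 _ (transition_stochastic st x)).1. Qed.

Lemma forecast_ge0 st x i : 0 <= forecast stat st x i 0.
Proof. by case: (forecast_prob st x). Qed.

Lemma forecast_le1 st x i : forecast stat st x i 0 <= 1.
Proof.
have [h1 <-] := forecast_prob st x; rewrite (bigD1 i)//= lerDl.
by apply: sumr_ge0.
Qed.

Lemma forecast_sqr_loss st x (y : bool) :
  \sum_j forecast stat st x j 0 * (grid_pt N j - y%:R) ^+ 2 <=
  \sum_i forecast stat st x i 0 * (dotp (theta_of st i) (vec x) - y%:R) ^+ 2 +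
  (4 * N%:R ^+ 2)^-1.
Proof.
have [p0 p1] := forecast_prob st x.
have fix_p := (statP.1 _ (transition_stochastic st x)).2.
rewrite -/(forecast stat st x) in fix_p.
set p := forecast stat st x in p0 p1 fix_p *.
have -> : \sum_j p j 0 * (grid_pt N j - y%:R) ^+ 2 =
    \sum_i p i 0 * \sum_j @round_dist R N (proj01 (dotp (theta_of st i) (vec x))) j 0 *
      (grid_pt N j - y%:R) ^+ 2.
  under eq_bigr => j _ do rewrite -{1}fix_p mxE mulr_suml.
  rewrite exchange_big /=; apply: eq_bigr => i _; rewrite mulr_sumr.
  by apply: eq_bigr => j _; rewrite !mxE; ring.
have -> : (4 * N%:R ^+ 2)^-1 = \sum_i p i 0 * (4 * N%:R ^+ 2)^-1 :> R.
  by rewrite -mulr_suml p1 mul1r.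
rewrite -big_split /=.
apply: ler_sum => i _; rewrite -mulrDr ler_wpM2l//.
apply: (le_trans (round_dist_sqr N0 _ (proj01_itv _))).
by rewrite lerD2r proj01_sqr.
Qed.

(** The invariant of the run. Coercivity makes the Gram matrices invertible, and the determinant is
    kept positive because its logarithm is the potential. *)
Definition good_state st := forall i,
  [/\ ball4 (theta_of st i), coercive omega (gram st i) & 0 < \det (gram st i)].

(** The same run driven by an infinite sequence of samples: induction on t is then direct, with no
    list to split. *)
Fixpoint traj (z : nat -> d.-tuple R * bool) t : state R d N :=
  if t is t'.+1 then step stat (traj z t') (z t') else init_state theta1.

Lemma state_before_traj z0 zs t : (t <= size zs)%N ->
  state_before stat theta1 zs t = traj (nth z0 zs) t.
Proof.
elim: t => [|t IH] tz; first by rewrite /state_before take0.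
by rewrite /state_before (take_nth z0)// foldl_rcons /= -/(state_before _ _ _ _) IH// ltnW.
Qed.

Lemma omega_gt0 : 0 < omega :> R.
Proof. by rewrite /omega /beta; lra. Qed.

Lemma good_state_step st z : good_state st -> good_state (step stat st z).
Proof.
move=> gst i; have [h1 h2 h3] := gst i; split => /=.
- exact: (gen_projP _ _).1.
- exact: coercive_rank1.
- exact: (det_coercive_rank1 _ omega_gt0 h2 h3).1.
Qed.

Lemma good_state_init : good_state (init_state theta1).
Proof.
move=> i; split => //=; first exact: coercive_scalar.
by rewrite det_scalar exprn_gt0// omega_gt0.
Qed.

Lemma good_state_traj z t : good_state (traj z t).
Proof.
elim: t => [|t IH]; first exact: good_state_init.
exact: good_state_step.
Qed.

Section regret.
Variable z : nat -> d.-tuple R * bool.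
Hypothesis zC : forall s, contexts (z s).1.

Let p s := forecast stat (traj z s) (z s).1.
Let phi s i theta := round_loss (p s i 0) (z s).1 (z s).2 theta.
Let nabla s i := grad (phi s i) (theta_of (traj z s) i).

Let gram_traj t i :
  gram (traj z t) i = omega%:M + \sum_(s <- iota 0 t) nabla s i *m (nabla s i)^T.
Proof.
elim: t => [|t IH]; first by rewrite big_nil addr0.
by rewrite -addn1 iotaD big_cat big_seq1 addrA -IH addn1.
Qed.

Let ler_residual s theta : ball4 theta ->
  `|dotp theta (vec (z s).1) - (z s).2%:R| <= 5.
Proof.
move=> bt; have h := ler_dotp theta (vec (z s).1).
have [h1 _] := zC s; have h2 := norm2_ge0 (vec (z s).1).
have h3 := norm2_ge0 theta; rewrite /ball4 /= in bt.
have : `|dotp theta (vec (z s).1)| <= 4.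
  by apply: (le_trans h); nra.
rewrite !ler_norml; case: (z s).2 => /=; lra.
Qed.

(** The gradient is 2 p a x with p <= 1, |a| <= 5 and |x| <= 1, whence 100 = (2 * 5)^2. *)
Let nabla_sqr s i : dotp (nabla s i) (nabla s i) <= 100.
Proof.
rewrite /nabla /phi grad_round_loss dotpZl dotpZr.
have [bt _ _] := good_state_traj z s i.
have := ler_residual s bt; set a := dotp _ _ - _ => ha.
have p0 := forecast_ge0 (traj z s) (z s).1 i.
have p1 := forecast_le1 (traj z s) (z s).1 i.
rewrite -/(p s) in p0 p1.
have [h1 _] := zC s; rewrite norm2_le// expr1n in h1.
have x0 := dotp_ge0 (vec (z s).1); set X := dotp _ _ in h1 x0 *.
have a2 : a ^+ 2 <= 25.
  rewrite -real_normK ?num_real//; have := normr_ge0 a; nra.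
have pa : (p s i 0 * a) ^+ 2 <= 25.
  rewrite exprMn; have := sqr_ge0 a; have : p s i 0 ^+ 2 <= 1 by nra.
  have := sqr_ge0 (p s i 0); nra.
have -> : 2 * p s i 0 * a * (2 * p s i 0 * a * X) = 4 * (p s i 0 * a) ^+ 2 * X by ring.
have := sqr_ge0 (p s i 0 * a); nra.
Qed.

(** Curvature of the square loss pays for the quadratic term: with q the weight, a the residual and
    e the change of prediction, the two sides differ by 2 q e^2 (1 - 2 beta q a^2), and q <= 1, a^2
    <= 25, beta = 1/640 keep this nonnegative. *)
Let loss_gap s i theta : ball4 theta ->
  let g := nabla s i in let e := theta_of (traj z s) i - theta in
  2 * (phi s i (theta_of (traj z s) i) - phi s i theta) <=
  2 * dotp g e - beta * dotp g e ^+ 2.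
Proof.
move=> bt /=; rewrite /nabla /phi grad_round_loss dotpZl.
have [bt' _ _] := good_state_traj z s i.
have := ler_residual s bt'; set a := _ - _ => ha.
rewrite (dotpC (vec (z s).1)) dotpDl dotpNl.
set e := dotp _ _ - dotp _ _; rewrite /round_loss -/a.
have -> : dotp theta (vec (z s).1) - (z s).2%:R = a - e by rewrite /a /e; ring.
have p0 := forecast_ge0 (traj z s) (z s).1 i.
have p1 := forecast_le1 (traj z s) (z s).1 i.
rewrite -/(p s) in p0 p1; set q := p s i 0 in p0 p1 *.
have a2 : a ^+ 2 <= 25.
  rewrite -real_normK ?num_real//; have := normr_ge0 a; nra.
rewrite -subr_ge0.
have -> : 2 * (2 * q * a * e) - beta * (2 * q * a * e) ^+ 2 -
  2 * (q * a ^+ 2 - q * (a - e) ^+ 2) = 2 * q * e ^+ 2 * (1 - 2 * beta * q * a ^+ 2) by ring.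
apply: mulr_ge0; first by apply: mulr_ge0; [exact: mulr_ge0|exact: sqr_ge0].
rewrite subr_ge0 /beta; have := sqr_ge0 a; nra.
Qed.

(** Sum of the Newton steps, kept as an invariant of the rounds. The initial term 64 omega is omega
    times the squared diameter of the ball of radius 4. *)
Let regret_potential t i theta : ball4 theta ->
  2 * \sum_(0 <= s < t) (phi s i (theta_of (traj z s) i) - phi s i theta) <=
  beta^-1 * (ln (\det (gram (traj z t) i)) - ln (\det (omega%:M : 'M[R]_d))) +
  beta * (64 * omega - quad (gram (traj z t) i) (theta_of (traj z t) i - theta)).
Proof.
move=> bt; have b0 : 0 < beta :> R by rewrite /beta; lra.
elim: t => [|t IH].
  rewrite big_nil mulr0 /= subrr mulr0 add0r; apply: mulr_ge0; first exact: ltW.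
  rewrite subr_ge0 quad_scalar.
  rewrite mulrC; apply: ler_wpM2r; first exact/ltW/omega_gt0.
  rewrite (_ : 64 = 8 ^+ 2); last by lra.
  rewrite -norm2_le// (le_trans (norm2D _ _))//.
  rewrite -scaleN1r norm2Z normrN1 mul1r.
  have := theta1B i; rewrite /ball4 /= in bt *; lra.
rewrite big_nat_recr//= mulrDr.
have [_ cA dA] := good_state_traj z t i.
have H1 := loss_gap t i bt.
have H2 := newton_step (nabla t i) (theta_of (traj z t) i) b0 omega_gt0 cA bt.
have H3 := dotp_invmx_le_lndet (nabla t i) omega_gt0 cA dA.
have {}H3 : beta^-1 * dotp (nabla t i)
    (invmx (gram (traj z t) i + nabla t i *m (nabla t i)^T) *m nabla t i) <=
  beta^-1 * (ln (\det (gram (traj z t) i + nabla t i *m (nabla t i)^T)) -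
             ln (\det (gram (traj z t) i))).
  by rewrite ler_wpM2l// invr_ge0 ltW.
rewrite /= in H1 H2 H3 IH.
rewrite -/(p t) -/(nabla t i).
rewrite !(mulrBr beta) !(mulrBr beta^-1) in H2 H3 IH *.
lra.
Qed.

Lemma regret_ons t i theta : (0 < t)%N -> ball4 theta ->
  \sum_(0 <= s < t) (phi s i (theta_of (traj z s) i) - phi s i theta) <=
  5760 * d%:R * ln (expR 1 + t%:R / d%:R).
Proof.
move=> t0 bt; have H := regret_potential t i bt.
have [_ cA dA] := good_state_traj z t i.
have q0 : 0 <= quad (gram (traj z t) i) (theta_of (traj z t) i - theta).
  by apply: le_trans (cA.2 _); rewrite mulr_ge0 ?dotp_ge0// ltW ?omega_gt0.
have tp : 0 < t%:R :> R by rewrite ltr0n.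
have td : 0 < t%:R / d%:R :> R by rewrite divr_gt0.
have om0 := omega_gt0.
(* The enlarged regularizer: since omega = 102400 exceeds 100, the squared gradients sum to at most
   100 t <= d c, so the log-determinant is at most d ln c + d. *)
pose c : R := omega * (1 + t%:R / d%:R).
have c0 : 0 < c by rewrite mulr_gt0// addr_gt0.
have oc : 0 < (omega : R) <= c.
  apply/andP; split; first exact: omega_gt0.
  by rewrite /c ler_peMr ?lerDl ?(ltW td)// ltW// omega_gt0.
have D1 : ln (\det (gram (traj z t) i)) <= d%:R * ln c + d%:R.
  have := det_scalar_mono (iota 0 t) (nabla^~ i) oc.
  rewrite -gram_traj => D.
  apply: (@le_trans _ _ (ln (\det (c%:M + \sum_(s <- iota 0 t) nabla s i *m (nabla s i)^T)))).
    by rewrite ler_ln ?posrE// (lt_le_trans dA).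
  apply: (le_trans (ln_det_sum_rank1 _ _ c0)); rewrite lerD2l ler_pdivrMr//.
  apply: (@le_trans _ _ (\sum_(s <- iota 0 t) 100)).
    by apply: ler_sum => s _; exact: nabla_sqr.
  rewrite big_const_seq count_predT size_iota iter_addr_0 -[100 *+ t]mulr_natr /c.
  have -> : d%:R * (omega * (1 + t%:R / d%:R)) = omega * (d%:R + t%:R) :> R.
    by field; rewrite gt_eqF.
  have o100 : 100 <= omega :> R by rewrite /omega /beta; lra.
  rewrite mulrDr -[leLHS]add0r lerD//; first by rewrite mulr_ge0// ltW.
  by rewrite ler_wpM2r// ltW.
have D2 : ln (\det (omega%:M : 'M[R]_d)) = d%:R * ln omega.
  by rewrite det_scalar lnXn// mulr_natl.
have E1 : ln c = ln omega + ln (1 + t%:R / d%:R).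
  by rewrite lnM ?posrE// addr_gt0.
set L := ln (expR 1 + _).
have e1 : 1 <= expR 1 :> R by rewrite -expR0 ler_expR.
have E2 : ln (1 + t%:R / d%:R) <= L.
  by rewrite ler_ln ?posrE ?addr_gt0 ?expR_gt0// lerD2r.
have L1 : 1 <= L.
  by rewrite -[leLHS]expRK ler_ln ?posrE ?addr_gt0 ?expR_gt0// lerDl ltW.
have d1 : 1 <= d%:R :> R by rewrite ler1n.
have D3 : ln (\det (gram (traj z t) i)) - ln (\det (omega%:M : 'M[R]_d)) <= 2 * (d%:R * L).
  by rewrite D2; rewrite E1 in D1; nra.
have D4 : beta^-1 * (ln (\det (gram (traj z t) i)) - ln (\det (omega%:M : 'M[R]_d)))
  <= 640 * (2 * (d%:R * L)).
  by rewrite /beta invrK; move: D3; lra.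
have D5 : beta * (64 * omega - quad (gram (traj z t) i) (theta_of (traj z t) i - theta)) <= 10240.
  apply: (@le_trans _ _ (beta * (64 * omega))).
    by rewrite ler_wpM2l ?gerBl// /beta; lra.
  by rewrite /omega /beta; lra.
(* Half of 640 * 2 d L + 10240 is 640 d L + 5120, and 5120 <= 5120 d L gives the constant 5760. *)
have : 1 <= d%:R * L by rewrite mulr_ege1.
by move: H D4 D5; lra.
Qed.

Lemma swap_multicalibration T : (0 < T)%N ->
  \sum_j norm2 (\sum_(0 <= s < T)
    (p s j 0 * ((z s).2%:R - grid_pt N j)) *: vec (z s).1) <=
  Num.sqrt (T%:R * ((N%:R + 1) * (5760 * d%:R * ln (expR 1 + T%:R / d%:R)) +
                    T%:R / (4 * N%:R ^+ 2))).
Proof.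
move=> T0; set B := _ + T%:R / _.
pose V j := \sum_(0 <= s < T) (p s j 0 * ((z s).2%:R - grid_pt N j)) *: vec (z s).1.
apply: (@le_trans _ _ (\sum_j norm2 (V j))); first by [].
have Tp : 0 < T%:R :> R by rewrite ltr0n.
have Np : 0 < N%:R :> R by rewrite ltr0n.
pose n j := \sum_(0 <= s < T) p s j 0.
have n0 j : 0 <= n j by apply: sumr_ge0 => s _; exact: forecast_ge0.
have nT : \sum_j n j = T%:R.
  rewrite exchange_big /= (eq_bigr (fun=> 1)) => [|s _].
    by rewrite sumr_const_nat subn0.
  by case: (forecast_prob (traj z s) (z s).1).
have Vn j : norm2 (V j) <= n j.
  apply: (le_trans (norm2_sum _ _ _)); apply: ler_sum => s _.
  rewrite norm2Z normrM ger0_norm ?forecast_ge0// -mulrA ler_piMr ?forecast_ge0//.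
  have [h1 _] := zC s; have h2 := norm2_ge0 (vec (z s).1).
  have h3 : `|(z s).2%:R - grid_pt N j| <= 1 :> R.
    have := @grid_pt_itv R _ N0 j; rewrite ler_norml; case: (z s).2 => /=; lra.
  by rewrite mulr_ile1 ?normr_ge0.
pose e1 : 'cV[R]_d := delta_mx (Ordinal d0) 0.
have e1E s : dotp e1 (vec (z s).1) = 2^-1.
  rewrite dotpE (bigD1 (Ordinal d0))//= big1 => [|k kd]; last first.
    by rewrite !mxE (negbTE kd) mul0r.
  by rewrite !mxE !eqxx mul1r addr0; case: (zC s) => _; apply.
have e1n : norm2 e1 <= 1.
  rewrite norm2_le// expr1n dotpE (bigD1 (Ordinal d0))//= big1 => [|k kd]; last first.
    by rewrite !mxE (negbTE kd) mul0r.
  by rewrite !mxE !eqxx mul1r addr0.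
(* The first summand predicts the constant z_j, because x_1 = 1/2; the second is the step along
   [V j], of norm at most 1 since |V j| <= n j. *)
pose th (j : 'I_N.+1) : 'cV[R]_d := (2 * grid_pt N j) *: e1 + (n j)^-1 *: V j.
have thB j : ball4 (th j).
  rewrite /ball4 /= (le_trans (norm2D _ _))// !norm2Z.
  have /andP[g0 g1] := @grid_pt_itv R _ N0 j.
  rewrite ger0_norm ?mulr_ge0// ger0_norm ?invr_ge0//.
  have : (n j)^-1 * norm2 (V j) <= 1.
    have [nj0|nj0] := eqVneq (n j) 0; first by rewrite nj0 invr0 mul0r.
    by rewrite mulrC ler_pdivrMr ?mul1r// lt_def nj0 n0.
  by have := norm2_ge0 e1; nra.
have gap j : dotp (V j) (V j) / n j <= \sum_(0 <= s < T) p s j 0 *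
    ((grid_pt N j - (z s).2%:R) ^+ 2 - (dotp (th j) (vec (z s).1) - (z s).2%:R) ^+ 2).
  have vE : dotp (V j) (V j) = \sum_(0 <= s < T)
      p s j 0 * ((z s).2%:R - grid_pt N j) * dotp (vec (z s).1) (V j).
    by rewrite {1}/V dotp_suml; apply: eq_bigr => s _; rewrite dotpZl.
  have CS s : dotp (vec (z s).1) (V j) ^+ 2 <= dotp (V j) (V j).
    apply: (le_trans (cauchy_schwarz _ _)).
    have [h1 _] := zC s; rewrite norm2_le// expr1n in h1.
    by rewrite ler_piMl// dotp_ge0.
  set v := dotp (V j) (V j) in vE CS *.
  (* A step m along [V j] gains at least 2 m v - m^2 n_j v; this is maximal at m = 1 / n_j. If n_j =
     0, both sides vanish because the inverse of 0 is 0. *)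
  have -> : v / n j = 2 * (n j)^-1 * v - n j * (n j)^-1 ^+ 2 * v.
    have [->|nj0] := eqVneq (n j) 0; first by rewrite invr0; ring.
    by field.
  rewrite [X in _ * X - _]vE mulr_sumr /n !mulr_suml -sumrB -/(n j).
  apply: ler_sum => s _; rewrite /th dotpDl !dotpZl e1E (dotpC (V j)).
  set q := p s j 0; have q0 : 0 <= q by exact: forecast_ge0.
  have HX := CS s; set X := dotp (vec _) (V j) in HX *.
  set m := (n j)^-1; set y := (z s).2%:R; set g := grid_pt N j.
  rewrite -subr_ge0.
  have -> : q * ((g - y) ^+ 2 - (2 * g / 2 + m * X - y) ^+ 2) -
    (2 * m * (q * (y - g) * X) - q * m ^+ 2 * v) = q * m ^+ 2 * (v - X ^+ 2) by field.
  by rewrite mulr_ge0 ?subr_ge0// mulr_ge0// sqr_ge0.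
have total : \sum_j dotp (V j) (V j) / n j <= B.
  apply: (le_trans (ler_sum _ (fun j _ => gap j))).
  apply: (@le_trans _ _ (\sum_j \sum_(0 <= s < T)
     (phi s j (theta_of (traj z s) j) - phi s j (th j)) +
     \sum_(0 <= s < T) (4 * N%:R ^+ 2)^-1)).
    rewrite exchange_big [X in _ <= X + _]exchange_big -big_split /=.
    apply: ler_sum => s _; rewrite sumrB.
    have := forecast_sqr_loss (traj z s) (z s).1 (z s).2; rewrite -/(p s).
    under [X in X <= _ -> _]eq_bigr do [].
    under [X in _ -> X <= _]eq_bigr do rewrite mulrBr.
    rewrite sumrB /phi /round_loss; lra.
  apply: lerD; last by rewrite sumr_const_nat subn0 -[leLHS]mulr_natl.
  apply: le_trans (ler_sum _ (fun j _ => regret_ons j T0 (thB j))) _.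
  by rewrite sumr_const card_ord -[leLHS]mulr_natl natr1.
have L0 : 0 <= ln (expR 1 + T%:R / d%:R : R).
  rewrite ln_ge0// -[leLHS]addr0 lerD ?divr_ge0//.
  by rewrite -expR0 ler_expR.
have B0 : 0 < B.
  apply: ltr_wpDl; last by rewrite divr_gt0// mulr_gt0// exprn_gt0.
  apply: mulr_ge0; first by rewrite addr_ge0.
  apply: mulr_ge0; last exact: L0.
  by apply: mulr_ge0; exact: ler0n.
(* Cauchy-Schwarz in the form of a weighted arithmetic-geometric inequality: tau B / 2 + T / (2 tau)
   is minimal at this tau, with value sqrt (T B). *)
pose tau := Num.sqrt (T%:R / B).
have tau0 : 0 < tau by rewrite sqrtr_gt0 divr_gt0.
have amgm j : norm2 (V j) <= tau / 2 * (dotp (V j) (V j) / n j) + n j / (2 * tau).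
  have [nj0|nj0] := eqVneq (n j) 0.
    by have := Vn j; rewrite nj0 invr0 !mulr0 mul0r addr0.
  have njp : 0 < n j by rewrite lt_def nj0 n0.
  rewrite -sqr_norm2 -subr_ge0.
  have -> : tau / 2 * (norm2 (V j) ^+ 2 / n j) + n j / (2 * tau) - norm2 (V j) =
    (tau * norm2 (V j) - n j) ^+ 2 / (2 * tau * n j) by field; rewrite !gt_eqF.
  by rewrite divr_ge0 ?sqr_ge0// !mulr_ge0// ltW.
apply: (le_trans (ler_sum _ (fun j _ => amgm j))).
rewrite big_split /= -mulr_sumr -mulr_suml nT.
apply: (@le_trans _ _ (tau / 2 * B + T%:R / (2 * tau))).
  by rewrite lerD2r ler_wpM2l// divr_ge0// ltW.
have tau2 : tau ^+ 2 = T%:R / B by rewrite sqr_sqrtr// divr_ge0// ltW.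
have -> : T%:R * B = (tau * B) ^+ 2.
  by rewrite exprMn tau2; field; rewrite gt_eqF.
rewrite sqrtr_sqr gtr0_norm ?mulr_gt0//.
have -> : T%:R = tau ^+ 2 * B by rewrite tau2 divfK// gt_eqF.
by rewrite le_eqVlt; apply/orP; left; apply/eqP; field; rewrite gt_eqF.
Qed.

End regret.
End trajectory.

(** * Measurability of the forecaster *)

Section rational_ball.
Context {R : realType} {d : nat}.
Implicit Types (u p v : 'cV[R]_d) (A : 'M[R]_d).

(** A countable dense subset of the ball, indexed by all naturals: codes that decode to nothing or
    to a point outside the ball are sent to 0. *)
Definition rational_pt (n : nat) : 'cV[R]_d :=
  if unpickle n is Some q then
    let v := map_mx ratr (q : 'cV[rat]_d) in if norm2 v <= 4 then v else 0
  else 0.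

Lemma rational_pt_ball4 n : ball4 (rational_pt n).
Proof.
rewrite /rational_pt /ball4 /=; case: unpickle => [q|]; last by rewrite norm20.
by case: ifP => //; rewrite norm20.
Qed.

(** A rational approximation of a boundary point could leave the ball. Hence (1 - s) p is
    approximated instead, with an error of norm at most 4 s, which keeps the norm below 4. *)
Lemma rational_pt_near p (e : R) : ball4 p -> 0 < e ->
  exists n, forall i, `|p i 0 - rational_pt n i 0| < e.
Proof.
move=> bp e0; rewrite /ball4 /= in bp.
pose s := Num.min 2^-1 (e / 16).
have s0 : 0 < s by rewrite lt_min !divr_gt0// invr_gt0 ltr0n.
have s1 : s <= 2^-1 by rewrite ge_min lexx.
have se : s <= e / 16 by rewrite ge_min lexx orbT.
pose h := Num.min (4 * s / (d.+1)%:R) (e / 2).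
have h0 : 0 < h by rewrite lt_min !divr_gt0 ?mulr_gt0 ?ltr0n.
have he : h <= e / 2 by rewrite ge_min lexx orbT.
have hs : h <= 4 * s / (d.+1)%:R by rewrite ge_min lexx.
have ex i : {q : rat | `|ratr q - (1 - s) * p i 0| < h}.
  apply: cid.
  have : (1 - s) * p i 0 - h < (1 - s) * p i 0 + h by lra.
  move=> /rat_in_itvoo[q]; rewrite in_itv /= => /andP[q1 q2].
  by exists q; rewrite ltr_norml; lra.
pose q : 'cV[rat]_d := \col_i sval (ex i).
have qE i : `|(map_mx ratr q : 'cV[R]_d) i 0 - (1 - s) * p i 0| < h.
  by rewrite !mxE; case: (ex i).
exists (pickle q) => i; rewrite /rational_pt pickleK.
have -> : norm2 (map_mx ratr q : 'cV[R]_d) <= 4.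
  set w := map_mx ratr q - (1 - s) *: p.
  have wn : norm2 w <= 4 * s.
    rewrite norm2_le; last by rewrite mulr_ge0// ltW.
    rewrite dotpE.
    apply: (@le_trans _ _ (\sum_(i < d) h ^+ 2)).
      apply: ler_sum => k _; rewrite -expr2 -[leLHS]real_normK ?num_real//.
      have wk : `|w k 0| <= h by apply/ltW; have := qE k; rewrite !mxE.
      by rewrite ler_pXn2r// nnegrE ltW.
    rewrite sumr_const card_ord -[leLHS]mulr_natr.
    apply: (@le_trans _ _ ((h * (d.+1)%:R) ^+ 2)); last first.
      rewrite ler_pXn2r ?nnegrE ?mulr_ge0 ?(ltW h0) ?(ltW s0)//.
      by rewrite -ler_pdivlMr ?ltr0n.
    rewrite exprMn ler_wpM2l ?sqr_ge0// expr2 -natrM ler_nat.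
    by rewrite (leq_trans (leqnSn d))// leq_pmulr.
  have -> : map_mx ratr q = w + (1 - s) *: p by rewrite /w subrK.
  apply: (le_trans (norm2D _ _)); rewrite norm2Z ger0_norm; last lra.
  have := norm2_ge0 p; nra.
have := qE i; set x := (map_mx _ _) i 0.
have pi4 : `|p i 0| <= 4.
  rewrite -(@ler_pXn2r _ 2)// ?nnegrE// real_normK ?num_real//.
  apply: le_trans (_ : dotp p p <= _); last by rewrite -norm2_le.
  rewrite dotpE (bigD1 i)//= -expr2 lerDl.
  by apply: sumr_ge0 => k _; rewrite -expr2 sqr_ge0.
move: pi4; rewrite !ltr_norml ler_norml => /andP[p1 p2] /andP[x1 x2].
by apply/andP; split; nra.
Qed.

Lemma rational_pt_quad A u p (e : R) i : ball4 p -> 0 < e ->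
  exists n, `|p i 0 - rational_pt n i 0| < e /\
    quad A (u - rational_pt n) < quad A (u - p) + e.
Proof.
move=> bp e0.
have cq : {for p, continuous (fun v => quad A (u - v))}.
  apply: continuous_quad => k; under eq_fun do rewrite !mxE.
  by move=> x; apply: continuousB; [exact: cst_continuous|exact: coord_continuous].
have : \forall v \near p, quad A (u - v) < quad A (u - p) + e.
  by apply: (cvgr_lt _ cq); rewrite ltrDl.
move=> /nbhs_ballP[r /= r0 pr].
have m0 : 0 < Num.min r e by rewrite lt_min r0.
have [n Hn] := rational_pt_near bp m0.
exists n; split; first by have := Hn i; rewrite lt_min => /andP[].
apply: pr; split => // k j; rewrite (ord1 j).
by have := Hn k; rewrite lt_min => /andP[].
Qed.

End rational_ball.

Section measurability.
Context {R : realType} {dY : measure_display} {Y : measurableType dY}.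

Definition measurable_mx m n (A : Y -> 'M[R]_(m, n)) :=
  forall i j, measurable_fun [set: Y] (fun y => A y i j).

Lemma measurable_mx_cst m n (A : 'M[R]_(m, n)) : measurable_mx (fun=> A).
Proof. by move=> i j; exact: measurable_cst. Qed.

Lemma measurable_mxD m n (A B : Y -> 'M[R]_(m, n)) :
  measurable_mx A -> measurable_mx B -> measurable_mx (fun y => A y + B y).
Proof.
move=> mA mB i j; under eq_fun do rewrite mxE.
by apply: measurable_funD; [exact: mA|exact: mB].
Qed.

Lemma measurable_mxZ m n (a : Y -> R) (A : Y -> 'M[R]_(m, n)) :
  measurable_fun setT a -> measurable_mx A ->
  measurable_mx (fun y => a y *: A y).
Proof.
move=> ma mA i j; under eq_fun do rewrite mxE.
by apply: measurable_funM => //; exact: mA.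
Qed.

Lemma measurable_mxB m n (A B : Y -> 'M[R]_(m, n)) :
  measurable_mx A -> measurable_mx B -> measurable_mx (fun y => A y - B y).
Proof.
move=> mA mB i j; under eq_fun do rewrite !mxE.
by apply: measurable_funB; [exact: mA|exact: mB].
Qed.

Lemma measurable_mulmx m n p (A : Y -> 'M[R]_(m, n)) (B : Y -> 'M[R]_(n, p)) :
  measurable_mx A -> measurable_mx B -> measurable_mx (fun y => A y *m B y).
Proof.
move=> mA mB i j; under eq_fun do rewrite mxE.
apply: measurable_sum => k.
by apply: measurable_funM; [exact: mA|exact: mB].
Qed.

Lemma measurable_trmx m n (A : Y -> 'M[R]_(m, n)) :
  measurable_mx A -> measurable_mx (fun y => (A y)^T).
Proof. by move=> mA i j; under eq_fun do rewrite mxE; exact: mA. Qed.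

Lemma measurable_dotp n (u v : Y -> 'cV[R]_n) :
  measurable_mx u -> measurable_mx v ->
  measurable_fun setT (fun y => dotp (u y) (v y)).
Proof.
by move=> mu mv; apply: (measurable_mulmx (measurable_trmx mu) mv).
Qed.

Lemma measurable_quad n (A : Y -> 'M[R]_n) (u : Y -> 'cV[R]_n) :
  measurable_mx A -> measurable_mx u ->
  measurable_fun setT (fun y => quad (A y) (u y)).
Proof.
move=> mA mu; under eq_fun do rewrite quadE.
by apply: measurable_dotp => //; exact: measurable_mulmx.
Qed.

Lemma measurable_det n (A : Y -> 'M[R]_n) :
  measurable_mx A -> measurable_fun setT (fun y => \det (A y)).
Proof.
move=> mA; apply: measurable_sum => s.
by apply: measurable_funM => //; apply: measurable_prod => i _; exact: mA.
Qed.

(** Cramer's formula: the entries of the adjugate are determinants, and the inverse of the positive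
    determinant is written as [expR] of minus its [ln]. *)
Lemma measurable_invmx n (A : Y -> 'M[R]_n) :
  measurable_mx A -> (forall y, A y \in unitmx /\ 0 < \det (A y)) ->
  measurable_mx (fun y => invmx (A y)).
Proof.
move=> mA dA.
rewrite (_ : (fun y => _) = (fun y => expR (- ln (\det (A y))) *: \adj (A y))).
  apply: measurable_mxZ.
    apply: measurableT_comp; first exact: measurable_expR.
    apply: measurable_funN; apply: measurableT_comp; first exact: measurable_ln.
    exact: measurable_det.
  move=> i j; under eq_fun do rewrite mxE /cofactor.
  apply: measurable_funM => //; apply: measurable_det => k l.
  by under eq_fun do rewrite !mxE; exact: mA.
apply/funext => y; have [uA d0] := dA y.
by rewrite /invmx uA expRN lnK.
Qed.

Lemma measurable_vec n (x : Y -> n.-tuple R) :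
  measurable_fun setT x -> measurable_mx (fun y => vec (x y)).
Proof.
move=> /measurable_fun_tnthP mx i j.
by under eq_fun do rewrite mxE; exact: mx.
Qed.

(* Coordinate i of the minimizer is at most a iff, for every k, some rational
   point of the ball with coordinate i below a + 1/k minimizes the form over the
   rational points up to 1/k: by coercivity, near-minimizers are close to the
   minimizer. *)
Lemma measurable_gen_proj n (A : Y -> 'M[R]_n) (u : Y -> 'cV[R]_n) c :
  0 < c -> (forall y, coercive c (A y)) -> measurable_mx A -> measurable_mx u ->
  measurable_mx (fun y => gen_proj (A y) (u y)).
Proof.
move=> c0 cA mA mu i j; rewrite (ord1 j).
apply: (measurability _ (RGenOInfty.measurableE R)) => //.
move=> _ [_ [a ->] <-]; rewrite setTI.
pose e (k : nat) : R := k.+1%:R^-1.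
pose good k n m := [set y | quad (A y) (u y - rational_pt n) <=
                            quad (A y) (u y - rational_pt m) + e k].
pose near k n : set Y := if rational_pt n i 0 < a + e k then \bigcap_m good k n m else set0.
rewrite (_ : _ @^-1` _ = ~` (\bigcap_k \bigcup_n near k n)).
  apply: measurableC; apply: bigcapT_measurable => k; apply: bigcupT_measurable => m.
  rewrite /near; case: ifP => // _; apply: bigcapT_measurable => l.
  rewrite /good -[X in measurable X]setTI; apply: measurable_fun_le => //.
    by apply: measurable_quad => //; apply: measurable_mxB => //.
  apply: measurable_funD => //; apply: measurable_quad => //.
  by apply: measurable_mxB => //.
apply/seteqP; split=> [y /= ay H|y /= H].
- have ek k : 0 < e k by rewrite invr_gt0.
  have [bp minp] := gen_projP (A y) (u y); set p := gen_proj _ _ in ay bp minp.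
  rewrite in_itv /= andbT in ay.
  set b := p i 0 - a; have b0 : 0 < b by rewrite subr_gt0.
  (* A rational point that is optimal up to 2 e k is at squared distance at most 2 e k / c < b^2 / 8
     from p; but its i-th coordinate, being below a + e k, is at least b / 2 away from that of p. *)
  pose m := Num.min (b / 2) (c * b ^+ 2 / 16).
  have m0 : 0 < m by rewrite lt_min !divr_gt0// mulr_gt0// exprn_gt0.
  pose k := Num.truncn m^-1.
  have ekm : e k < m.
    by rewrite /e invf_plt ?posrE// truncnS_gt.
  have [l _] := H k I; rewrite /near; case: ifP => // la gl.
  have [r [_ rp]] := rational_pt_quad (A y) (u y) i bp (ek k).
  have glr : quad (A y) (u y - rational_pt l) <= quad (A y) (u y - p) + 2 * e k.
    apply: (le_trans (gl r I)); lra.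
  have P := gen_proj_pythagoras (u y) (cA y).1 (rational_pt_ball4 l).
  rewrite -/p in P.
  have Q : c * (p i 0 - rational_pt l i 0) ^+ 2 <= 2 * e k.
    apply: (@le_trans _ _ (c * dotp (p - rational_pt l) (p - rational_pt l))).
      rewrite ler_pM2l// dotpE (bigD1 i)//= !mxE -expr2 lerDl.
      by apply: sumr_ge0 => s _; rewrite -expr2 sqr_ge0.
    by apply: (le_trans ((cA y).2 _)); move: P glr; clear; lra.
  have mb : m <= b / 2 by rewrite ge_min lexx.
  have mc : m <= c * b ^+ 2 / 16 by rewrite ge_min lexx orbT.
  have pl : b / 2 <= p i 0 - rational_pt l i 0.
    by move: la ekm mb; rewrite /b; clear; lra.
  have : (b / 2) ^+ 2 <= (p i 0 - rational_pt l i 0) ^+ 2.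
    by rewrite ler_pXn2r// nnegrE; move: pl b0; clear; lra.
  rewrite -(ler_pM2l c0) => H2.
  have : c * b ^+ 2 = 4 * (c * (b / 2) ^+ 2) by field.
  have : 0 < c * b ^+ 2 by rewrite mulr_gt0// exprn_gt0.
  by move: H2 Q ekm mc; clear; lra.
- rewrite in_itv /= andbT ltNge; apply/negP => pa; apply: H => k _.
  have [bp minp] := gen_projP (A y) (u y); set p := gen_proj _ _ in pa bp minp.
  have ek : 0 < e k by rewrite invr_gt0.
  have [l [l1 l2]] := rational_pt_quad (A y) (u y) i bp ek.
  exists l => //; rewrite /near ifT.
    move=> m _ /=; apply: (le_trans (ltW l2)); rewrite lerD2r.
    exact/minp/rational_pt_ball4.
  by move: l1; rewrite ltr_norml; lra.
Qed.

End measurability.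

Section measurable_forecaster.
Context {R : realType} {d N : nat} {dY : measure_display} {Y : measurableType dY}.
Variables (stat : 'M[R]_N.+1 -> 'cV[R]_N.+1).
Hypotheses (N0 : (0 < N)%N) (statP : stationary_rule stat).

Lemma measurable_round_dist (w : Y -> R) :
  measurable_fun setT w -> measurable_mx (fun y => round_dist (w y) : 'cV[R]_N.+1).
Proof.
move=> mw i j; under eq_fun do rewrite mxE.
have mc a : measurable_fun [set: Y] (fun=> a : R) by exact: measurable_cst.
have mle a : measurable_fun setT (fun y => a <= w y) by exact: measurable_fun_ler.
have mlt a : measurable_fun setT (fun y => w y < a) by exact: measurable_fun_ltr.
apply: measurable_fun_ifT => //; first exact: measurable_fun_eqr.
apply: measurable_fun_ifT; first exact: measurable_and.
  by apply: measurable_funM => //; exact: measurable_funB.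
apply: measurable_fun_ifT => //.
  by apply: measurable_and => //; exact: measurable_and.
by apply: measurable_funM => //; exact: measurable_funB.
Qed.

Definition measurable_state (st : Y -> state R d N) :=
  (forall i, measurable_mx (fun y => theta_of (st y) i)) /\
  (forall i, measurable_mx (fun y => gram (st y) i)).

Lemma measurable_forecast (st : Y -> state R d N) (x : Y -> d.-tuple R) :
  measurable_state st -> measurable_fun setT x ->
  measurable_mx (fun y => forecast stat (st y) (x y)).
Proof.
move=> [mt _] mx j k; rewrite (ord1 k).
pose M y : N.+1.-tuple (N.+1.-tuple R) :=
  [tuple [tuple transition (st y) (x y) i l | l < N.+1] | i < N.+1].
have ME y : mxt (M y) = transition (st y) (x y).
  by apply/matrixP => i l; rewrite mxE !tnth_mktuple.
rewrite (_ : (fun y => _) = (fun m => stat (mxt m) j 0) \o M); last first.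
  by apply/funext => y; rewrite /= ME.
apply: measurableT_comp; first exact: statP.2.
apply/measurable_fun_tnthP => i; apply/measurable_fun_tnthP => l.
rewrite (_ : _ \o _ = (fun y =>
  (round_dist (proj01 (dotp (theta_of (st y) l) (vec (x y)))) : 'cV[R]_N.+1) i 0)).
  apply: measurable_round_dist.
  apply: measurable_maxr; first exact: measurable_cst.
  apply: measurable_minr; first exact: measurable_cst.
  by apply: measurable_dotp => //; exact: measurable_vec.
by apply/funext => y /=; rewrite !tnth_mktuple mxE.
Qed.

Lemma measurable_bool_real dT (T : measurableType dT) (b : T -> bool) :
  measurable_fun setT b -> measurable_fun setT (fun y => (b y)%:R : R).
Proof.
move=> mb; rewrite (_ : (fun y => _) = (fun y => if b y then 1 else 0 : R)).
  by apply: measurable_fun_ifT.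
by apply/funext => y; case: (b y).
Qed.

Lemma measurable_step (st : Y -> state R d N) (z : Y -> d.-tuple R * bool) :
  (forall y, good_state (st y)) -> measurable_state st -> measurable_fun setT z ->
  measurable_state (fun y => step stat (st y) (z y)).
Proof.
move=> gst mst mz; have [mt mg] := mst.
have mz1 : measurable_fun setT (fun y => (z y).1) by exact: measurableT_comp.
have mz2 : measurable_fun setT (fun y => (z y).2) by exact: measurableT_comp.
pose g i y := grad (round_loss (forecast stat (st y) (z y).1 i 0) (z y).1 (z y).2)
  (theta_of (st y) i).
have mgr i : measurable_mx (g i).
  rewrite (_ : g i = (fun y => (2 * forecast stat (st y) (z y).1 i 0 *
     (dotp (theta_of (st y) i) (vec (z y).1) - (z y).2%:R)) *: vec (z y).1)).
    apply: measurable_mxZ; last exact: measurable_vec.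
    apply: measurable_funM.
      by apply: measurable_funM => //; exact: measurable_forecast.
    apply: measurable_funB; last exact: measurable_bool_real.
    by apply: measurable_dotp => //; exact: measurable_vec.
  by apply/funext => y; rewrite /g grad_round_loss.
have mA i : measurable_mx (fun y => gram (st y) i + g i y *m (g i y)^T).
  apply: measurable_mxD => //; apply: measurable_mulmx => //.
  exact: measurable_trmx.
have cA i y : coercive omega (gram (st y) i + g i y *m (g i y)^T).
  by have [_ + _] := gst y i; exact: coercive_rank1.
split=> i //=.
apply: (measurable_gen_proj (@omega_gt0 R)) => //.
apply: measurable_mxB => //; apply: measurable_mxZ => //.
apply: (measurable_mulmx (measurable_invmx (mA i) _) (mgr i)) => y.
split; first exact: coercive_unit (@omega_gt0 R) (cA i y).
have [_ h2 h3] := gst y i.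
exact: (det_coercive_rank1 _ (@omega_gt0 R) h2 h3).1.
Qed.

Lemma measurable_traj (theta1 : 'I_N.+1 -> 'cV[R]_d)
    (z : nat -> Y -> d.-tuple R * bool) t :
  (forall i, ball4 (theta1 i)) ->
  (forall s, (s < t)%N -> measurable_fun setT (z s)) ->
  measurable_state (fun y => traj stat theta1 (z ^~ y) t).
Proof.
move=> bt; elim: t => [|t IH] mz.
  by split=> i; exact: measurable_mx_cst.
apply: measurable_step.
- by move=> y; exact: good_state_traj.
- by apply: IH => s st; apply: mz; exact: ltnW.
- exact: mz.
Qed.

End measurable_forecaster.

(** * Azuma's inequality in Euclidean space *)

Section bounded_integrals.
Context {R : realType} {dX : measure_display} {X : measurableType dX}.
Variable Q : probability X R.
Implicit Types (f : X -> R) (A : set X).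

Lemma bounded_integrable A f (M : R) : measurable A -> measurable_fun A f ->
  (forall x, A x -> `|f x| <= M) -> Q.-integrable A (EFin \o f).
Proof.
move=> mA mf fM; apply: measurable_bounded_integrable => //.
  by apply: le_lt_trans (probability_le1 Q mA) _; rewrite ltry.
exists M; split; first exact: num_real.
by move=> N MN x Ax; apply: le_trans (fM _ Ax) (ltW MN).
Qed.

Lemma Rintegral_sum (I : Type) (r : seq I) (F : I -> X -> R) A : measurable A ->
  (forall i, Q.-integrable A (EFin \o F i)) ->
  Q.-integrable A (EFin \o (fun x => \sum_(i <- r) F i x)) /\
  \int[Q]_(x in A) (\sum_(i <- r) F i x) = \sum_(i <- r) \int[Q]_(x in A) F i x.
Proof.
move=> mA iF; elim: r => [|i r [IH1 IH2]].
  rewrite big_nil; under eq_Rintegral do rewrite big_nil.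
  split; last by rewrite Rintegral_cst// mul0r.
  rewrite (_ : _ \o _ = cst 0%E); first exact: integrable0.
  by apply/funext => x /=; rewrite big_nil.
split.
  rewrite (_ : _ \o _ = (EFin \o F i) \+ (EFin \o (fun x => \sum_(i <- r) F i x))).
    exact: integrableD.
  by apply/funext => x /=; rewrite big_cons.
rewrite big_cons -IH2 -RintegralD//.
by apply: eq_Rintegral => x _; rewrite big_cons.
Qed.

End bounded_integrals.

Section exponential_step.
Context {R : realType}.

Lemma sum_cauchy_schwarz (I : finType) (u v : I -> R) :
  (\sum_i u i * v i) ^+ 2 <= (\sum_i u i ^+ 2) * \sum_i v i ^+ 2.
Proof.
set D := \sum_i u i * v i; set U := \sum_i u i ^+ 2; set V := \sum_i v i ^+ 2.
have V0 : 0 <= V by apply: sumr_ge0 => i _; exact: sqr_ge0.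
have E : \sum_i (V * u i - D * v i) ^+ 2 = V * (U * V - D ^+ 2).
  transitivity (\sum_i (V ^+ 2 * u i ^+ 2 - 2 * V * D * (u i * v i) + D ^+ 2 * v i ^+ 2)).
    by apply: eq_bigr => i _; ring.
  by rewrite big_split /= sumrB -!mulr_sumr -/U -/D -/V; ring.
have : 0 <= V * (U * V - D ^+ 2).
  by rewrite -E; apply: sumr_ge0 => i _; exact: sqr_ge0.
have [v0|Vn] := eqVneq V 0.
  move=> _; rewrite v0 mulr0 /D big1 ?expr0n// => i _.
  have /eqP := v0; rewrite psumr_eq0 => [/allP vi|j _]; last exact: sqr_ge0.
  by have := vi i (mem_index_enum _); rewrite /= sqrf_eq0 => /eqP ->; rewrite mulr0.
have Vp : 0 < V by rewrite lt_def Vn.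
by rewrite pmulr_rge0// subr_ge0.
Qed.

(** Squaring 1 - y / 2 <= expR (- y / 2) gives (1 - y / 2)^2 expR y <= 1. What remains is
    polynomial, and its defect has the factor (5 - 2 y) (1 - y), nonnegative for y <= 1. *)
Lemma expR_le_quadratic (y : R) : y <= 1 -> expR y <= 1 + y + 2 * y ^+ 2.
Proof.
move=> y1; set a := 1 - y / 2.
have a0 : 0 < a by rewrite /a; lra.
have h : a <= expR (- (y / 2)).
  by apply: le_trans (expR_ge1Dx _); rewrite /a; lra.
have e0 : 0 < expR (y / 2) := expR_gt0 _.
have ha : a * expR (y / 2) <= 1.
  by move: h; rewrite expRN -(ler_pM2r e0) mulVf ?gt_eqF.
have : (a * expR (y / 2)) ^+ 2 <= 1.
  by rewrite expr_le1// mulr_ge0// ltW.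
rewrite exprMn -expRM_natl (_ : 2%:R * (y / 2) = y); last by field.
move=> H; rewrite -(ler_pM2l (exprn_gt0 2 a0)); apply: (le_trans H).
rewrite /a -subr_ge0.
have -> : (1 - y / 2) ^+ 2 * (1 + y + 2 * y ^+ 2) - 1 =
   y ^+ 2 * ((5 - 2 * y) * (1 - y)) / 4 by field.
by rewrite divr_ge0// mulr_ge0 ?sqr_ge0// mulr_ge0; lra.
Qed.

(** For centered y the linear term integrates to 0, so only the Gaussian factor survives. *)
Lemma expR_le_linear_gauss (y : R) : expR y <= y + expR (2 * y ^+ 2).
Proof.
have h := expR_ge1Dx (2 * y ^+ 2).
have [y1|y1] := leP y 1.
  by apply: (le_trans (expR_le_quadratic y1)); lra.
have : expR y <= expR (2 * y ^+ 2) by rewrite ler_expR; nra.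
lra.
Qed.

Context {dX : measure_display} {X : measurableType dX}.
Variable Q : probability X R.

(** In |S + Z|^2 = |S|^2 + 2 <S, Z> + |Z|^2 the last term is at most b. The cross term y = 2 l <S,
    Z> is centered with y^2 <= 4 l^2 b |S|^2, which turns the coefficient l of |S|^2 into l + 8 l^2
    b. Only norms appear, hence no dependence on the dimension. *)
Lemma exp_sqr_step (I : finType) (S : I -> R) (Z : X -> I -> R) (b l : R) :
  0 < b -> 0 < l ->
  (forall i, measurable_fun setT (Z ^~ i)) ->
  (forall x, \sum_i Z x i ^+ 2 <= b) ->
  (forall i, \int[Q]_x Z x i = 0) ->
  (\int[Q]_x (expR (l * \sum_i (S i + Z x i) ^+ 2))%:E <=
   (expR (l * b) * expR ((l + 8 * l ^+ 2 * b) * \sum_i S i ^+ 2))%:E)%E.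
Proof.
move=> b0 l0 mZ Zb iZ.
set s := \sum_i S i ^+ 2.
have s0 : 0 <= s by apply: sumr_ge0 => i _; exact: sqr_ge0.
pose y x := \sum_i (2 * l * S i) * Z x i.
have Zi x i : `|Z x i| <= Num.sqrt b.
  rewrite -sqrtr_sqr ler_wsqrtr//; apply: le_trans (Zb x).
  by rewrite (bigD1 i)//= lerDl; apply: sumr_ge0 => k _; exact: sqr_ge0.
have intZ i : Q.-integrable setT (EFin \o (Z ^~ i)).
  by apply: (bounded_integrable Q measurableT (mZ i)) => x _; exact: Zi.
have int_term i : Q.-integrable setT (EFin \o (fun x => (2 * l * S i) * Z x i)).
  rewrite (_ : _ \o _ = (fun x => (2 * l * S i)%:E * (Z x i)%:E)%E)//.
  exact: (integrableZl measurableT _ (intZ i)).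
have [inty sumy] := Rintegral_sum (index_enum I) measurableT int_term.
have y0 : \int[Q]_x y x = 0.
  rewrite /y sumy big1// => i _.
  by rewrite RintegralZl// iZ mulr0.
have ysqr x : y x ^+ 2 <= 4 * l ^+ 2 * (s * b).
  rewrite /y; under eq_bigr do rewrite -mulrA; rewrite -mulr_sumr exprMn.
  have -> : (2 * l) ^+ 2 = 4 * l ^+ 2 by ring.
  apply: ler_wpM2l; first by rewrite mulr_ge0// sqr_ge0.
  apply: (le_trans (sum_cauchy_schwarz _ _)).
  by rewrite ler_wpM2l.
have my : measurable_fun setT y.
  by apply: measurable_sum => i; apply: measurable_funM.
have msq : measurable_fun setT (fun x => \sum_i (S i + Z x i) ^+ 2).
  by apply: measurable_sum => i; apply: measurable_funX; apply: measurable_funD.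
pose c := expR (l * (s + b)); pose E := expR (8 * l ^+ 2 * b * s).
have intc : Q.-integrable setT (EFin \o (fun=> E)).
  by apply: (bounded_integrable Q measurableT (M := `|E|)).
have intyE : Q.-integrable setT (EFin \o (fun x => y x + E)).
  rewrite (_ : _ \o _ = (EFin \o y) \+ (EFin \o (fun=> E)))//.
  exact: integrableD.
have le1 x : expR (l * \sum_i (S i + Z x i) ^+ 2) <= c * (y x + E).
  have -> : \sum_i (S i + Z x i) ^+ 2 =
      s + 2 * (\sum_i S i * Z x i) + \sum_i Z x i ^+ 2.
    rewrite mulr_sumr -!big_split /=; apply: eq_bigr => i _; ring.
  have yE : y x = 2 * l * \sum_i S i * Z x i.
    by rewrite mulr_sumr; apply: eq_bigr => i _; rewrite mulrA.
  apply: (@le_trans _ _ (c * expR (y x))).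
    rewrite /c -expRD ler_expR yE; have := Zb x.
    rewrite -(ler_pM2l l0); lra.
  rewrite ler_pM2l ?expR_gt0//; apply: (le_trans (expR_le_linear_gauss _)).
  by rewrite lerD2l ler_expR; have := ysqr x; lra.
apply: (@le_trans _ _ (\int[Q]_x (c * (y x + E))%:E)%E).
  apply: ge0_le_integral => //.
  - apply/measurable_EFinP; apply: measurableT_comp; first exact: measurable_expR.
    exact: measurable_funM.
  - apply/measurable_EFinP; apply: measurable_funM => //; exact: measurable_funD.
  - by move=> x _; rewrite lee_fin; exact: le1.
have intcyE : Q.-integrable setT (EFin \o (fun x => c * (y x + E))).
  rewrite (_ : _ \o _ = (fun x => c%:E * (y x + E)%:E)%E)//.
  exact: (integrableZl measurableT _ intyE).
rewrite -[leLHS]fineK; last exact: (integrable_fin_num measurableT intcyE).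
rewrite lee_fin -/(Rintegral _ _ _) RintegralZl// RintegralD// y0 Rintegral_cst//.
rewrite [fine _](congr1 fine (probability_setT Q)) /= mulr1 add0r /c /E -!expRD.
by rewrite ler_expR; lra.
Qed.

End exponential_step.

(** * Independence of the past and the next sample *)

Section independent_past.
Context {R : realType} {dO : measure_display} {Omega : measurableType dO}.
Variable P : probability Omega R.
Context {dX : measure_display} {X : measurableType dX}.
Variables (T : nat) (W : 'I_T -> Omega -> X) (Q : probability X R).
Hypothesis iidW : iid P W Q.

(** Rectangles in the first t samples, with full factors from index t on: a pi-system, so measures
    agreeing on it agree on the past. *)
Definition cylinder (t : nat) : set (set Omega) :=
  [set B | exists A : 'I_T -> set X, [/\ forall i, measurable (A i),
     forall i : 'I_T, (t <= i)%N -> A i = setT &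
     B = \bigcap_(i in [set` [set: 'I_T]%SET]) (W i @^-1` A i)]].

(* Omega with the sigma-algebra of W_0, ..., W_(t-1). Making the past a measurable
   type of its own lets it form a product space with the next sample. *)
Definition past t := g_sigma_algebraType (cylinder t).

Let mW i : measurable_fun setT (W i). Proof. by case: iidW. Qed.

Lemma measurable_cylinder t B : cylinder t B -> measurable B.
Proof.
move=> [A [mA _ ->]]; apply: fin_bigcap_measurable => // i _.
by rewrite -[X in measurable X]setTI; apply: mW.
Qed.

Lemma cylinder_setI t : setI_closed (cylinder t).
Proof.
move=> _ _ [A [mA At ->]] [B [mB Bt ->]]; exists (fun i => A i `&` B i); split.
- by move=> i; exact: measurableI.
- by move=> i ti; rewrite At// Bt// setTI.
- by rewrite -bigcapI; apply: eq_bigcapr => i _; rewrite preimage_setI.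
Qed.

Lemma cylinder_setT t : cylinder t setT.
Proof.
exists (fun=> setT); split => //.
by apply/seteqP; split.
Qed.

Lemma cylinder_le s t : (s <= t)%N -> cylinder s `<=` cylinder t.
Proof.
move=> st _ [A [mA As ->]]; exists A; split => // i ti.
by apply: As; exact: leq_trans ti.
Qed.

Lemma measurable_past_id t : measurable_fun setT (id : Omega -> past t).
Proof.
move=> _ B mB; rewrite setTI preimage_id.
suff : <<s cylinder t >> `<=` measurable by apply.
apply: smallest_sub; first exact: sigma_algebra_measurable.
exact: measurable_cylinder.
Qed.

Lemma measurable_past_le s t : (s <= t)%N ->
  measurable_fun setT (id : past t -> past s).
Proof.
move=> st _ B mB; rewrite setTI preimage_id.
suff : <<s cylinder s >> `<=` <<s cylinder t >> by apply.
apply: smallest_sub; first exact: smallest_sigma_algebra.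
by move=> A cA; apply: sub_sigma_algebra; exact: (cylinder_le st).
Qed.

Lemma measurable_past_W t (i : 'I_T) : (i < t)%N ->
  measurable_fun setT (W i : past t -> X).
Proof.
move=> it _ B mB; rewrite setTI; apply: sub_sigma_algebra.
exists (fun j => if j == i then B else setT); split.
- by move=> j; case: ifP.
- by move=> j tj; case: eqP => // ji; move: it; rewrite -ji ltnNge tj.
- apply/seteqP; split=> [w /= wB j _|w /= H]; first by rewrite /=; case: eqP => [->|].
  by have := H i; rewrite /= eqxx; apply; rewrite inE.
Qed.

Let past_mfun t : {mfun Omega >-> past t} :=
  HB.pack (id : Omega -> past t) (isMeasurableFun.Build _ _ _ _ _ (@measurable_past_id t)).

Let Ppast t : probability (past t) R := distribution P (past_mfun t).

(** For fixed B both sides are finite measures in A, so it is enough to compare them on cylinders.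
    There the t-th factor is the whole space and can be replaced by B. *)
Lemma past_independent (t : 'I_T) (A : set (past t)) (B : set X) :
  measurable A -> measurable B ->
  P (A `&` W t @^-1` B) = (P A * Q B)%E.
Proof.
move=> mA mB.
have [_ lawW indW] := iidW.
have mWB : measurable (W t @^-1` B) by rewrite -[X in measurable X]setTI; exact: mW.
have QB : Q B \is a fin_num by exact: fin_num_measure.
have q0 : 0 <= fine (Q B) by exact: fine_ge0.
pose m1 := mrestr P mWB.
pose m2 := mscale (NngNum q0) P.
suff : m1 A = m2 A by rewrite /m1 /m2 /mrestr /mscale /= fineK// muleC.
apply: (g_sigma_algebra_measure_unique (cylinder t) (@measurable_cylinder t) (fun=> setT)) => //.
- by move=> _; exact: cylinder_setT.
- by rewrite bigcup_const.
- exact: cylinder_setI.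
- move=> _ [C [mC Ct ->]].
  set K := \bigcap_(i in _) _.
  change (P (K `&` W t @^-1` B) = (fine (Q B))%:E * P K)%E; rewrite fineK// /K.
  pose C' i := if i == t then B else C i.
  have mC' i : measurable (C' i) by rewrite /C'; case: ifP.
  have -> : \bigcap_(i in [set` [set: 'I_T]%SET]) W i @^-1` C i `&` W t @^-1` B =
      \bigcap_(i in [set` [set: 'I_T]%SET]) W i @^-1` C' i.
    apply/seteqP; split=> [w [HC wB] i iT /=|w H /=].
      by rewrite /C'; case: eqP => [->//|_]; exact: HC.
    split=> [i iT /=|]; last by have := H t; rewrite /C' /= eqxx; apply; rewrite inE.
    have := H i iT; rewrite /C' /=; case: eqP => // -> _.
    by rewrite Ct.
  rewrite (indW _ _ mC') (indW _ _ mC).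
  rewrite (bigD1 t) ?inE//= [in RHS](bigD1 t) ?inE//=.
  rewrite /C' eqxx Ct// preimage_setT probability_setT mul1e lawW//.
  congr (_ * _)%E; apply: eq_bigr => i /andP[_ it].
  by rewrite (negbTE it).
- move=> _; rewrite /m1 /mrestr; apply: le_lt_trans (probability_le1 _ _) _.
    exact: measurableI.
  by rewrite ltry.
Qed.

(** Freezing the past: the joint law of the past and [W t] is a product measure, so Tonelli
    integrates the next sample first, with the past held fixed. *)
Lemma integral_past (t : 'I_T) (f : past t * X -> \bar R) :
  measurable_fun setT f -> (forall a, 0 <= f a)%E ->
  (\int[P]_w f (w, W t w) = \int[P]_w \int[Q]_x f ((w : past t), x))%E.
Proof.
move=> mf f0.
pose phi (w : Omega) : past t * X := (w, W t w).
have mphi : measurable_fun setT phi.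
  by apply: measurable_fun_pair; [exact: measurable_past_id|exact: mW].
transitivity (\int[pushforward P phi]_a f a)%E.
  by rewrite (ge0_integral_pushforward mphi)//.
transitivity (\int[(Ppast t \x Q)%E]_a f a)%E.
  apply: eq_measure_integral => A mA _.
  apply/esym; apply: (@product_measure_unique _ _ _ _ R (Ppast t) Q (pushforward P phi)) => //.
  by move=> B C mB mC; exact: (past_independent mB mC).
rewrite fubini_tonelli1//.
rewrite /fubini_F /Ppast /distribution (ge0_integral_pushforward (@measurable_past_id t))//.
- exact: measurable_fun_fubini_tonelli_F.
- by move=> w _; exact: integral_ge0.
Qed.

End independent_past.

Section vector_azuma.
Context {R : realType} {dO : measure_display} {Omega : measurableType dO}.
Variable P : probability Omega R.
Context {dX : measure_display} {X : measurableType dX}.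
Variables (T : nat) (W : 'I_T -> Omega -> X) (Q : probability X R).
Hypothesis iidW : iid P W Q.
Variables (I : finType) (V : 'I_T -> Omega -> X -> I -> R) (b : R).
Hypothesis T0 : (0 < T)%N.
Hypothesis b0 : 0 < b.
Hypothesis mV : forall (t : 'I_T) i,
  measurable_fun setT (fun a : past W t * X => V t a.1 a.2 i).
Hypothesis Vb : forall t w x, \sum_i V t w x i ^+ 2 <= b.
Hypothesis V0 : forall t w i, \int[Q]_x V t w x i = 0.

(** By [mV], [V t w] depends on w only through W_0, ..., W_(t-1); with [V0], the summands are
    martingale differences. *)
Definition mart_sum (n : nat) (w : Omega) (i : I) : R :=
  \sum_(t < T | (t < n)%N) V t w (W t w) i.

Let Tp : 0 < T%:R :> R. Proof. by rewrite ltr0n. Qed.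

Lemma measurable_mart_sum n i :
  measurable_fun setT (fun w : past W n => mart_sum n w i).
Proof.
rewrite /mart_sum; under eq_fun do rewrite big_mkcond.
apply: measurable_sum => t; case: (ltnP t n) => // tn.
pose phi (w : past W n) : past W t * X := ((w : past W t), W t w).
apply: (@measurableT_comp _ _ _ _ _ _ (fun a : past W t * X => V t a.1 a.2 i) _ phi).
  exact: mV.
apply: measurable_fun_pair; last exact: measurable_past_W.
by apply: measurable_past_le; exact: ltnW.
Qed.

Lemma measurable_mart_sumT n i : measurable_fun setT (fun w => mart_sum n w i).
Proof.
have mA := @measurable_mart_sum n i.
have mB := @measurable_past_id _ _ _ _ _ _ _ _ _ iidW n.
exact (measurableT_comp mA mB).
Qed.

Let l (n : nat) : R := (8 * b * (T%:R + n%:R))^-1.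

Let l_gt0 n : 0 < l n.
Proof. by rewrite invr_gt0 !mulr_gt0// ltr_wpDr. Qed.

(* The rates are chosen so that 1/a + 1/a^2 <= 1/(a - 1) absorbs the quadratic
   term produced by one step. *)
Let l_step n : l n.+1 + 8 * l n.+1 ^+ 2 * b <= l n.
Proof.
set a : R := T%:R + n%:R; have a0 : 0 < a by rewrite ltr_wpDr.
have lE : l n.+1 = (8 * b * (a + 1))^-1 by rewrite /l /a -addrA natr1.
rewrite lE /l -/a -subr_ge0.
have -> : (8 * b * a)^-1 - ((8 * b * (a + 1))^-1 + 8 * (8 * b * (a + 1))^-1 ^+ 2 * b)
  = (8 * b * a * (a + 1) ^+ 2)^-1.
  field; rewrite !gt_eqF//; lra.
by apply/ltW; rewrite invr_gt0; apply: mulr_gt0; [rewrite !mulr_gt0|rewrite exprn_gt0// addr_gt0].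
Qed.

(** One step costs the factor expR (l b) <= expR (1 / (8 T)), while the decrease from [l n] to
    [l n.+1] absorbs the growth of the coefficient. After T steps the total cost is only expR (1 /
    8). *)
Lemma mart_sum_exp_moment n : (n <= T)%N ->
  (\int[P]_w (expR (l n * \sum_i mart_sum n w i ^+ 2))%:E <=
   (expR (n%:R / (8 * T%:R)))%:E)%E.
Proof.
elim: n => [_|n IH nT].
  rewrite mul0r expR0.
  rewrite (eq_integral (fun=> 1%E)) => [|w _]; last first.
    rewrite big1 ?mulr0 ?expR0// => i _.
    by rewrite /mart_sum big_pred0 ?expr0n.
  apply: (@le_trans _ _ (1 * P setT)%E); first by rewrite -integral_cst.
  by rewrite probability_setT mul1e.
pose t : 'I_T := Ordinal nT.
pose f (a : past W t * X) : \bar R :=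
  (expR (l n.+1 * \sum_i (mart_sum n a.1 i + V t a.1 a.2 i) ^+ 2))%:E.
have SE w i : mart_sum n.+1 w i = mart_sum n w i + V t w (W t w) i.
  rewrite /mart_sum (bigD1 t) ?ltnSn//= addrC; congr (_ + _).
  by apply: eq_bigl => s; rewrite ltnS -val_eqE /= ltn_neqAle andbC.
have mf : measurable_fun setT f.
  apply/measurable_EFinP; apply: measurableT_comp; first exact: measurable_expR.
  apply: measurable_funM => //; apply: measurable_sum => i.
  apply: measurable_funX; apply: measurable_funD => //.
  exact: (measurableT_comp (@measurable_mart_sum n i)).
rewrite (eq_integral (fun w => f (w, W t w))) => [|w _]; last first.
  by rewrite /f /=; under eq_bigr do rewrite SE.
rewrite (integral_past iidW mf) => [|a]; last by rewrite lee_fin expR_ge0.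
have mS : measurable_fun setT (fun w => \sum_i mart_sum n w i ^+ 2).
  by apply: measurable_sum => i; apply: measurable_funX; exact: measurable_mart_sumT.
have mE c : measurable_fun setT (fun w => expR (c * \sum_i mart_sum n w i ^+ 2)).
  by apply: measurableT_comp; [exact: measurable_expR|exact: measurable_funM].
apply: (@le_trans _ _ (\int[P]_w ((expR (l n.+1 * b))%:E *
    (expR (l n * \sum_i mart_sum n w i ^+ 2))%:E)%E)%E).
  apply: ge0_le_integral => //.
  - by move=> w _; apply: integral_ge0 => x _; rewrite lee_fin expR_ge0.
  - apply: (measurableT_comp (measurable_fun_fubini_tonelli_F _ mf _)).
      by move=> a; rewrite lee_fin expR_ge0.
    exact: (measurable_past_id iidW).
  - by apply/measurable_EFinP; exact: measurable_funM.
  - move=> w _; rewrite -EFinM.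
    apply: (le_trans (exp_sqr_step (mart_sum n w) b0 (l_gt0 _) _ _ _)) => //.
      by move=> i; exact (measurable_fun_pair2 (w : past W t) (@mV t i)).
      by move=> i; exact: V0.
    rewrite lee_fin ler_pM2l ?expR_gt0// ler_expR ler_wpM2r ?l_step//.
    by apply: sumr_ge0 => i _; exact: sqr_ge0.
rewrite ge0_integralZl//; last by apply/measurable_EFinP; exact: mE.
apply: (@le_trans _ _ ((expR (l n.+1 * b))%:E * (expR (n%:R / (8 * T%:R)))%:E)%E).
  by apply: lee_wpmul2l; [rewrite lee_fin expR_ge0|exact/IH/ltnW].
rewrite -EFinM lee_fin -expRD ler_expR.
have -> : n.+1%:R / (8 * T%:R) = n%:R / (8 * T%:R) + (8 * T%:R)^-1 :> R.
  by rewrite -[n.+1%:R]natr1 mulrDl mul1r.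
rewrite [leLHS]addrC lerD2l.
have n0 : 0 <= n.+1%:R :> R by [].
have -> : l n.+1 * b = (8 * (T%:R + n.+1%:R))^-1.
  by rewrite /l; field; rewrite !gt_eqF// ltr_wpDr.
by rewrite lef_pV2 ?posrE ?mulr_gt0 ?ltr_wpDr// ler_pM2l// lerDl.
Qed.

(** Markov's inequality for the exponential moment at time T, where the rate is 1 / (16 b T): off E
    the exponential is at least expR 1 / delta, while its mean is at most expR (1 / 8) <= expR 1. *)
Lemma vector_azuma (delta : R) : 0 < delta < 1 ->
  let E := [set w | \sum_i mart_sum T w i ^+ 2 <=
                    16 * b * T%:R * (1 + ln delta^-1)] in
  measurable E /\ ((1 - delta)%:E <= P E)%E.
Proof.
move=> /andP[d0 d1] E.
have mS : measurable_fun setT (fun w => \sum_i mart_sum T w i ^+ 2).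
  by apply: measurable_sum => i; apply: measurable_funX; exact: measurable_mart_sumT.
have mE : measurable E.
  by rewrite -[E]setTI; apply: measurable_fun_le.
split=> //.
have mCE : measurable (~` E) by exact: measurableC.
have PE : P E = (1 - P (~` E))%E.
  by rewrite -[in LHS](setCK E) probability_setC.
suff H : (P (~` E) <= delta%:E)%E.
  by rewrite PE EFinB leeB.
pose F w := expR (l T * \sum_i mart_sum T w i ^+ 2).
have mF : measurable_fun setT F.
  by apply: measurableT_comp; [exact: measurable_expR|exact: measurable_funM].
have lT : l T = (16 * b * T%:R)^-1.
  by rewrite /l; congr (_^-1); ring.
have c0 : 0 < expR 1 / delta by rewrite divr_gt0// expR_gt0.
have F_ge w : (~` E) w -> expR 1 / delta <= F w.
  move=> /negP; rewrite -ltNge => /ltW h.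
  have -> : expR 1 / delta = expR (1 + ln delta^-1).
    by rewrite expRD lnK// posrE invr_gt0.
  by rewrite /F ler_expR lT mulrC ler_pdivlMr ?mulr_gt0// mulrC.
have : ((expR 1 / delta)%:E * P (~` E) <= (expR 1)%:E)%E.
  rewrite -integral_cst//.
  apply: (@le_trans _ _ (\int[P]_(w in ~` E) (F w)%:E)%E).
    apply: ge0_le_integral => //.
    - by move=> w _ /=; rewrite lee_fin ltW.
    - by apply/measurable_EFinP; exact: measurable_funTS.
  apply: (@le_trans _ _ (\int[P]_w (F w)%:E)%E).
    apply: ge0_subset_integral => //; first exact/measurable_EFinP.
    by move=> w _; rewrite lee_fin expR_ge0.
  apply: (le_trans (mart_sum_exp_moment (leqnn T))).
  rewrite lee_fin ler_expR ler_pdivrMr ?mulr_gt0// mul1r.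
  by have T1 : 0 < T%:R :> R := Tp; lra.
have fP : P (~` E) \is a fin_num by exact: fin_num_measure.
rewrite -(fineK fP) -EFinM !lee_fin => h.
rewrite -(ler_pM2l c0) (le_trans h)// divfK// gt_eqF//.
Qed.

End vector_azuma.

(** * From multicalibration to omniprediction *)

Section convex_losses.
Context {R : realType}.
Implicit Types (g : R -> R) (l : R -> bool -> R).

Lemma I01P (p : R) : I01 p <-> 0 <= p <= 1.
Proof. by rewrite /I01 /= in_itv. Qed.

Lemma convex_three_points g (q a p : R) :
  convex_function (I01 : set (convex_lmodType R^o)) g -> 0 <= q -> q < a -> a < p -> p <= 1 ->
  g a * (p - q) <= (p - a) * g q + (a - q) * g p.
Proof.
move=> cg q0 qa ap p1; have pq : 0 < p - q by lra.
have t01 : 0 <= (p - a) / (p - q) <= 1.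
  apply/andP; split; first by apply: divr_ge0; lra.
  rewrite ler_pdivrMr// mul1r; lra.
pose t : {i01 R} := Itv01 (proj1 (andP t01)) (proj2 (andP t01)).
have := cg t q p; rewrite !inE => /(_ _ _).
have Iq : I01 q by apply/I01P; lra.
have Ip : I01 p by apply/I01P; lra.
move=> /(_ Iq Ip); rewrite !convRE /= /unstable.onem.
move=> H; have {H} : g ((p - a) / (p - q) * q + (1 - (p - a) / (p - q)) * p) <=
  (p - a) / (p - q) * g q + (1 - (p - a) / (p - q)) * g p := H.
have -> : (p - a) / (p - q) * q + (1 - (p - a) / (p - q)) * p = a.
  by field; rewrite gt_eqF.
rewrite -(ler_pM2r pq).
have -> : ((p - a) / (p - q) * g q + (1 - (p - a) / (p - q)) * g p) * (p - q) =
  (p - a) * g q + (a - q) * g p by field; rewrite gt_eqF.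
by [].
Qed.

(** At an interior point the slope is the supremum of the left difference quotients, which convexity
    places below every right one. At the end points the Lipschitz bound supplies the slopes -1 and
    1. *)
Lemma convex_tangent g (a : R) :
  convex_function (I01 : set (convex_lmodType R^o)) g ->
  (forall p q, I01 p -> I01 q -> `|g p - g q| <= `|p - q|) -> I01 a ->
  exists s, `|s| <= 1 /\ forall p, I01 p -> g a + s * (p - a) <= g p.
Proof.
move=> cg lg Ia; have /I01P/andP[a0 a1] := Ia.
have [a00|ap] := eqVneq a 0.
  exists (-1); split; first by rewrite normrN1.
  move=> p Ip; have /I01P/andP[p0 p1] := Ip.
  have := lg _ _ Ia Ip; rewrite a00 sub0r normrN (ger0_norm p0) ler_norml; lra.
have [a10|an] := eqVneq a 1.
  exists 1; split; first by rewrite normr1.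
  move=> p Ip; have /I01P/andP[p0 p1] := Ip.
  have := lg _ _ Ia Ip; rewrite a10 (@ger0_norm _ (1 - p)) ?subr_ge0// ler_norml; lra.
have {a0 ap} a0 : 0 < a by rewrite lt_def ap.
have {a1 an} a1 : a < 1 by rewrite lt_neqAle an.
pose E := [set x | exists q, [/\ 0 <= q, q < a & x = (g a - g q) / (a - q)]].
have E1 x : E x -> `|x| <= 1.
  move=> [q [q0 qa ->]]; have aq : 0 < a - q by lra.
  have Iq : I01 q by apply/I01P; lra.
  rewrite normrM normfV (gtr0_norm aq) ler_pdivrMr// mul1r.
  by apply: (le_trans (lg _ _ Ia Iq)); rewrite gtr0_norm.
have E0 : E !=set0 by exists ((g a - g 0) / (a - 0)); exists 0; split.
have ubE : has_ubound E.
  by exists 1 => x /E1; rewrite ler_norml => /andP[].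
have right p : a < p -> p <= 1 -> ubound E ((g p - g a) / (p - a)).
  move=> ap p1 x [q [q0 qa ->]].
  have H := convex_three_points cg q0 qa ap p1.
  by rewrite ler_pdivrMr ?subr_gt0// mulrAC ler_pdivlMr ?subr_gt0//; lra.
exists (sup E); split.
  have [x Ex] := E0; have /(_ _ Ex) xs := ub_le_sup ubE.
  have := E1 _ Ex; rewrite !ler_norml => /andP[x1 _]; apply/andP; split; first lra.
  by apply: ge_sup => // y /E1; rewrite ler_norml => /andP[].
move=> p Ip; have /I01P/andP[p0 p1] := Ip.
have [pa|ap|->] := ltgtP p a.
- have Ep : E ((g a - g p) / (a - p)) by exists p; split.
  have := ub_le_sup ubE Ep; rewrite ler_pdivrMr ?subr_gt0//; lra.
- have := ge_sup E0 (right _ ap p1).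
  by rewrite ler_pdivlMr ?subr_gt0//; lra.
- by rewrite subrr mulr0 addr0.
Qed.

Lemma lossP l y : L_cvx l ->
  [/\ forall p, I01 p -> `|l p y| <= 1,
      forall p q, I01 p -> I01 q -> `|l p y - l q y| <= `|p - q| &
      forall a, I01 a -> exists s, `|s| <= 1 /\
        forall p, I01 p -> l a y + s * (p - a) <= l p y].
Proof.
move=> /(_ y)[b c lip]; have lip' p q : I01 p -> I01 q -> `|l p y - l q y| <= `|p - q|.
  by move=> Ip Iq; have := lip (p, q) (conj Ip Iq); rewrite /= mul1r.
split=> //; first by move=> p Ip; rewrite ler_norml; exact: b.
by move=> a Ia; exact: (convex_tangent (g := l ^~ y)).
Qed.

Lemma bernoulli_expectation (q : R) (h : bool -> R) : 0 <= q <= 1 ->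
  ('E_(bernoulli_prob q)[h] = (q * h true + (1 - q) * h false)%:E)%E.
Proof.
move=> q01; rewrite unlock integralE !integral_bernoulli_prob//.
rewrite !funeposE !funenegE -!EFinN -!EFin_max -!EFinM -!EFinD /unstable.onem.
congr (_%:E).
have E (x : R) : Num.max x 0 - Num.max (- x) 0 = x.
  have [x0|x0] := leP 0 x.
    by rewrite ?(max_l x0) max_r ?oppr_le0// subr0.
  by rewrite ?(max_r (ltW x0)) max_l ?oppr_ge0 ?(ltW x0)// sub0r opprK.
by rewrite -[in RHS](E (h true)) -[in RHS](E (h false)); ring.
Qed.

Lemma best_responseP k l q a : best_response L_cvx k -> L_cvx l -> I01 q -> I01 a ->
  I01 (k l q) /\
  q * l (k l q) true + (1 - q) * l (k l q) false <=
  q * l a true + (1 - q) * l a false.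
Proof.
move=> kP Ll Iq Ia; have [Ik /(_ a Ia) kmin] := kP l q Ll Iq; split => //.
by have /I01P Iq' := Iq; move: kmin; rewrite !bernoulli_expectation.
Qed.

End convex_losses.

(** * Omniprediction gap of one level set *)

Section omniprediction_gap.
Context {R : realType} {d N T : nat}.
Variables (D : probability (d.-tuple R * bool)%type R).
Variable v : 'I_T -> d.-tuple R -> 'I_N.+1.
Hypotheses (d0 : (0 < d)%N) (N0 : (0 < N)%N) (T0 : (0 < T)%N).
Hypothesis mv : forall t j, measurable [set x | v t x = j].
Notation sample := (d.-tuple R * bool)%type.

Definition sample_space : set sample := contexts `*` [set: bool].

Lemma measurable_contexts : measurable (contexts : set (d.-tuple R)).
Proof.
rewrite (_ : contexts = [set x | dotp (vec x) (vec x) <= 1] `&`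
                        [set x | tnth x (Ordinal d0) == 2^-1]).
  apply: measurableI.
    rewrite -[X in measurable X]setTI; apply: measurable_fun_le => //.
    by apply: measurable_dotp; apply: measurable_vec.
  have : measurable_fun setT (fun x : d.-tuple R => tnth x (Ordinal d0) == 2^-1).
    by apply: measurable_fun_eqr => //; exact: measurable_tnth.
  by move=> /(_ measurableT [set true]); rewrite setTI; apply.
apply/seteqP; split=> x /=; rewrite /contexts /= norm2_le// expr1n.
  by move=> [? H]; split=> //; apply/eqP; exact: H.
move=> [? /eqP H]; split=> // i i0; rewrite -H; congr tnth.
exact/val_inj.
Qed.

Lemma measurable_sample_space : measurable sample_space.
Proof. by apply: measurableX; [exact: measurable_contexts|]. Qed.

Let mK := measurable_sample_space.

(** A class of integrands closed under sums and products, so that integrability follows from the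
    shape of an expression. *)
Definition tame (h : sample -> R) :=
  measurable_fun sample_space h /\ exists M, forall z, sample_space z -> `|h z| <= M.

Lemma tame_cst c : tame (fun=> c).
Proof. by split; [exact: measurable_cst|exists `|c|]. Qed.

Lemma tameD f g : tame f -> tame g -> tame (fun z => f z + g z).
Proof.
move=> [mf [M fM]] [mg [M' gM]]; split; first exact: measurable_funD.
by exists (M + M') => z Kz; apply: le_trans (ler_normD _ _) (lerD (fM _ Kz) (gM _ Kz)).
Qed.

Lemma tameM f g : tame f -> tame g -> tame (fun z => f z * g z).
Proof.
move=> [mf [M fM]] [mg [M' gM]]; split; first exact: measurable_funM.
by exists (M * M') => z Kz; rewrite normrM ler_pM// ?fM// gM.
Qed.

Lemma tame_sum (I : Type) (r : seq I) (F : I -> sample -> R) :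
  (forall i, tame (F i)) -> tame (fun z => \sum_(i <- r) F i z).
Proof.
move=> tF; elim: r => [|i r IH].
  by under eq_fun do rewrite big_nil; exact: tame_cst.
by under eq_fun do rewrite big_cons; exact: tameD.
Qed.

Lemma tame_label : tame (fun z => z.2%:R).
Proof.
split; last by exists 1 => z _; case: z.2; rewrite /= ?normr1 ?normr0.
by apply: measurable_funTS; apply: measurable_bool_real.
Qed.

Lemma sample_space_coord z (i : 'I_d) : sample_space z -> `|tnth z.1 i| <= 1.
Proof.
move=> [[n1 _] _]; rewrite norm2_le// expr1n in n1.
rewrite -(@ler_pXn2r _ 2)// ?nnegrE// expr1n real_normK ?num_real//.
apply: le_trans n1; rewrite dotpE (bigD1 i)//= !mxE -expr2 lerDl.
by apply: sumr_ge0 => k _; rewrite -expr2 sqr_ge0.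
Qed.

Lemma tame_coord i : tame (fun z => tnth z.1 i).
Proof.
split; last by exists 1 => z; exact: sample_space_coord.
apply: measurable_funTS; apply: (measurableT_comp (measurable_tnth i)).
exact: measurable_fst.
Qed.

Lemma tame_predict t j : tame (fun z => (v t z.1 == j)%:R).
Proof.
split; last by exists 1 => z _; case: eqP; rewrite /= ?normr1 ?normr0.
apply: measurable_funTS; apply: measurable_bool_real.
apply: (measurable_fun_bool true); rewrite setTI.
have -> : (fun z : sample => v t z.1 == j) @^-1` [set true] =
   fst @^-1` [set x | v t x = j].
  by apply/seteqP; split=> z /= /eqP.
by rewrite -[X in measurable X]setTI; apply: measurable_fst.
Qed.

Lemma tame_integrable h : tame h -> D.-integrable sample_space (EFin \o h).
Proof. by move=> [mh [M hM]]; exact: (bounded_integrable D mK mh hM). Qed.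

(* Integral of h against the (unnormalized) law of the samples that are sent to
   the j-th grid point, cumulated over the T predictors. *)
Definition level_mass (j : 'I_N.+1) (h : sample -> R) : R :=
  \sum_(t < T) \int[D]_(z in sample_space) ((v t z.1 == j)%:R * h z).

Lemma level_massD j f g : tame f -> tame g ->
  level_mass j (fun z => f z + g z) = level_mass j f + level_mass j g.
Proof.
move=> tf tg; rewrite /level_mass -big_split; apply: eq_bigr => t _ /=.
rewrite -RintegralD//; last 2 first.
- by apply: tame_integrable; apply: tameM => //; exact: tame_predict.
- by apply: tame_integrable; apply: tameM => //; exact: tame_predict.
by apply: eq_Rintegral => z _; rewrite mulrDr.
Qed.

Lemma level_massZ j c f : tame f ->
  level_mass j (fun z => c * f z) = c * level_mass j f.
Proof.
move=> tf; rewrite /level_mass mulr_sumr; apply: eq_bigr => t _ /=.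
rewrite -RintegralZl//; last first.
  by apply: tame_integrable; apply: tameM => //; exact: tame_predict.
by apply: eq_Rintegral => z _; rewrite mulrCA.
Qed.

Lemma le_level_mass j f g : tame f -> tame g ->
  (forall z, sample_space z -> f z <= g z) -> level_mass j f <= level_mass j g.
Proof.
move=> tf tg fg; apply: ler_sum => t _; apply: le_Rintegral => //.
- by apply: tame_integrable; apply: tameM => //; exact: tame_predict.
- by apply: tame_integrable; apply: tameM => //; exact: tame_predict.
by move=> z Kz; rewrite ler_wpM2l// fg.
Qed.

Lemma eq_level_mass j f g :
  (forall z, sample_space z -> f z = g z) -> level_mass j f = level_mass j g.
Proof.
move=> fg; apply: eq_bigr => t _; apply: eq_Rintegral => z.
by rewrite inE => Kz; rewrite fg.
Qed.

Lemma level_mass_sum j (I : Type) (r : seq I) (F : I -> sample -> R) :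
  (forall i, tame (F i)) ->
  level_mass j (fun z => \sum_(i <- r) F i z) = \sum_(i <- r) level_mass j (F i).
Proof.
move=> tF; elim: r => [|i r IH].
  rewrite big_nil -[RHS](mul0r (level_mass j (fun=> 0))) -level_massZ; last exact: tame_cst.
  by apply: eq_level_mass => z _; rewrite big_nil mul0r.
rewrite big_cons -IH -level_massD//; last exact: tame_sum.
by apply: eq_level_mass => z _; rewrite big_cons.
Qed.

(** The vector [M_j], summed over the T predictors rather than averaged, hence on the same scale as
    [V_j]. *)
Definition moment (j : 'I_N.+1) : 'cV[R]_d :=
  \col_i level_mass j (fun z => tnth z.1 i * (z.2%:R - grid_pt N j)).

Let tame_resid j : tame (fun z => z.2%:R - grid_pt N j).
Proof. by apply: tameD; [exact: tame_label|exact: tame_cst]. Qed.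

Let moment_dotp j theta :
  level_mass j (fun z => dotp theta (vec z.1) * (z.2%:R - grid_pt N j)) =
  dotp theta (moment j).
Proof.
transitivity (level_mass j (fun z => \sum_i theta i 0 * (tnth z.1 i * (z.2%:R - grid_pt N j)))).
  apply: eq_level_mass => z _; rewrite dotpE mulr_suml.
  by apply: eq_bigr => i _; rewrite mxE mulrA.
rewrite level_mass_sum => [|i]; last first.
  apply: tameM; first exact: tame_cst.
  by apply: tameM; [exact: tame_coord|exact: tame_resid].
rewrite dotpE; apply: eq_bigr => i _; rewrite mxE level_massZ//.
by apply: tameM; [exact: tame_coord|exact: tame_resid].
Qed.

Let coord_norm2 (w : 'cV[R]_d) i : `|w i 0| <= norm2 w.
Proof.
rewrite -(@ler_pXn2r _ 2)// ?nnegrE// ?norm2_ge0// real_normK ?num_real// sqr_norm2.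
rewrite dotpE (bigD1 i)//= -expr2 lerDl.
by apply: sumr_ge0 => k _; rewrite -expr2 sqr_ge0.
Qed.

Let moment_bias j : `|level_mass j (fun z => z.2%:R - grid_pt N j)| <= 2 * norm2 (moment j).
Proof.
have -> : level_mass j (fun z => z.2%:R - grid_pt N j) = 2 * moment j (Ordinal d0) 0.
  rewrite mxE -level_massZ; last first.
    by apply: tameM; [exact: tame_coord|exact: tame_resid].
  apply: eq_level_mass => z [[_ z0] _]; rewrite z0// mulrA divff ?mul1r//.
by rewrite normrM ger0_norm// ler_pM2l// coord_norm2.
Qed.

Lemma tame_aff f : F_aff_res f ->
  tame (fun z => f z.1) /\ forall z, sample_space z -> I01 (f z.1).
Proof.
move=> [theta th1 ->]; split.
  have -> : (fun z : sample => (1 + dotp theta (vec z.1)) / 2) =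
    (fun z => (1 + \sum_i theta i 0 * tnth z.1 i) * 2^-1).
    apply/funext => z; rewrite dotpE; congr ((_ + _) / _).
    by apply: eq_bigr => i _; rewrite mxE.
  apply: tameM; last exact: tame_cst.
  apply: tameD; first exact: tame_cst.
  apply: tame_sum => i; apply: tameM; first exact: tame_cst.
  exact: tame_coord.
move=> z [[n1 _] _]; apply/I01P.
have h := ler_dotp theta (vec z.1).
have h2 := norm2_ge0 theta; have h3 := norm2_ge0 (vec z.1).
have : `|dotp theta (vec z.1)| <= 1 by apply: (le_trans h); nra.
rewrite ler_norml; lra.
Qed.

(** A loss is constrained on [0, 1] only; composing it with the projection gives a continuous
    function on the whole line. *)
Let loss_clip l y : L_cvx l -> measurable_fun setT (fun p : R => l (proj01 p) y).
Proof.
move=> Ll; have [_ lip _] := lossP y Ll.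
apply: continuous_measurable_fun => p.
apply/(@cvgrPdist_le _ R^o) => e e0; near=> q.
have I1 := proj01_itv p; have I2 := proj01_itv q.
apply: (le_trans (lip _ _ _ _)); [exact/I01P|exact/I01P|].
apply: (@le_trans _ _ `|p - q|).
  rewrite /proj01; have [p1|p1] := leP 1 p; have [q1|q1] := leP 1 q;
  rewrite ?(max_r (ler01)) ?subrr ?normr0//;
  have [p0|p0] := leP 0 p; have [q0|q0] := leP 0 q;
  rewrite ?subrr ?normr0// ?ler_norml; have := ler_norm (p - q); have := ler_norm (q - p);
  rewrite (distrC q p); lra.
near: q; exact: (@cvgr_dist_le _ _ _ _ _ id p).
Unshelve. all: by end_near. Qed.

Lemma tame_loss l f : L_cvx l -> F_aff_res f ->
  tame (fun z => l (f z.1) z.2).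
Proof.
move=> Ll Ff; have [[mf _] If] := tame_aff Ff; split; last first.
  exists 1 => z Kz; have [H _ _] := lossP z.2 Ll.
  exact/H/If.
apply: (@eq_measurable_fun _ _ _ _ _ (fun z : sample =>
   z.2%:R * l (proj01 (f z.1)) true + (1 - z.2%:R) * l (proj01 (f z.1)) false)).
  move=> z; rewrite inE => /If/I01P/andP[f0 f1].
  have -> : proj01 (f z.1) = f z.1 by rewrite /proj01 min_r// max_r.
  by case: z.2; rewrite /=; ring.
have [my _] := tame_label.
apply: measurable_funD; apply: measurable_funM => //.
- exact: (measurableT_comp (loss_clip true Ll) mf).
- exact: measurable_funB.
- exact: (measurableT_comp (loss_clip false Ll) mf).
Qed.

Lemma tame_loss_label l p : L_cvx l -> I01 p -> tame (fun z => l p z.2).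
Proof.
move=> Ll Ip; have -> : (fun z : sample => l p z.2) =
    (fun z => z.2%:R * (l p true - l p false) + l p false).
  by apply/funext => z; case: z.2; rewrite /=; ring.
apply: tameD; last exact: tame_cst.
by apply: tameM; [exact: tame_label|exact: tame_cst].
Qed.

(* Linearizing l at the mean a of f on the level set bounds the gap by a
   combination of 1, y, f and f y whose non-negligible part is the excess risk
   of k against the constant a. *)
Lemma level_gap k l f j : best_response L_cvx k -> L_cvx l -> F_aff_res f ->
  level_mass j (fun z => l (k l (grid_pt N j)) z.2 - l (f z.1) z.2) <=
  15 * norm2 (moment j).
Proof.
move=> kP Ll Ff.
have [tf If] := tame_aff Ff; have ty := tame_label.
have /I01P Iz := grid_pt_itv (R := R) N0 j.
set zj := grid_pt N j in Iz *; set M := norm2 _.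
have /I01P/andP[z0 z1] := Iz.
pose n := level_mass j (fun=> 1).
pose F := level_mass j (fun z => f z.1).
pose b := level_mass j (fun z => z.2%:R - zj).
pose G := level_mass j (fun z => f z.1 * (z.2%:R - zj)).
have n0 : 0 <= n.
  apply: sumr_ge0 => t _; apply: Rintegral_ge0 => z _.
  by rewrite mulr1.
have F0 : 0 <= F.
  apply: sumr_ge0 => t _; apply: Rintegral_ge0 => z Kz.
  by rewrite mulr_ge0//; have /I01P/andP[] := If z Kz.
have Fn : F <= n.
  apply: le_level_mass => //; first exact: tame_cst.
  by move=> z Kz; have /I01P/andP[] := If z Kz.
(* The mean of the competitor on the level set. On a null level set it is 0, and F = n a still holds
   because 0 <= F <= n. *)
pose a := F / n.
have Fa : F = n * a.
  have [nE|nE] := eqVneq n 0; first by rewrite nE mul0r; lra.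
  by rewrite /a mulrC divfK.
have Ia : I01 a.
  apply/I01P; rewrite divr_ge0//=.
  have [nE|nE] := eqVneq n 0; first by rewrite /a nE invr0 mulr0.
  by rewrite ler_pdivrMr ?mul1r// lt_def nE.
have [Ik kmin] := best_responseP kP Ll Iz Ia.
set c := k l zj in Ik kmin *.
have [b1 _ /(_ a Ia)[s1 [s1n t1]]] := lossP true Ll.
have [b2 _ /(_ a Ia)[s2 [s2n t2]]] := lossP false Ll.
pose c0 := l c false - l a false + s2 * a.
pose c1 := l c true - l a true + s1 * a - c0.
pose c3 := s2 - s1.
have tfy : tame (fun z => f z.1 * (z.2%:R - zj)).
  by apply: tameM => //; exact: tame_resid.
(* The linearized gap, with the label y split as z_j + (y - z_j): the terms in y - z_j are those
   controlled by [moment]. *)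
pose h (z : sample) := (c0 + c1 * zj) * 1 + (c1 * (z.2%:R - zj) +
   ((- s2 + c3 * zj) * f z.1 + c3 * (f z.1 * (z.2%:R - zj)))).
have th : tame h.
  apply: tameD; first by apply: tameM; exact: tame_cst.
  apply: tameD; first by apply: tameM; [exact: tame_cst|exact: tame_resid].
  by apply: tameD; apply: tameM => //; exact: tame_cst.
apply: (@le_trans _ _ (level_mass j h)).
  apply: le_level_mass => //.
    apply: tameD; first exact: tame_loss_label.
    have -> : (fun z : sample => - l (f z.1) z.2) = (fun z => (-1) * l (f z.1) z.2).
      by apply/funext => z; rewrite mulN1r.
    by apply: tameM; [exact: tame_cst|exact: (tame_loss Ll Ff)].
  move=> z Kz; have Ifz := If z Kz; have := t1 _ Ifz; have := t2 _ Ifz.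
  rewrite /h /c1 /c3 /c0; case: z.2 => /= ? ?; lra.
have -> : level_mass j h = (c0 + c1 * zj) * n + (c1 * b + ((- s2 + c3 * zj) * F + c3 * G)).
  rewrite /h level_massD; last 2 first.
  - by apply: tameM; exact: tame_cst.
  - apply: tameD; first by apply: tameM; [exact: tame_cst|exact: tame_resid].
    by apply: tameD; apply: tameM => //; exact: tame_cst.
  rewrite level_massD; last 2 first.
  - by apply: tameM; [exact: tame_cst|exact: tame_resid].
  - by apply: tameD; apply: tameM => //; exact: tame_cst.
  rewrite level_massD; last 2 first.
  - by apply: tameM => //; exact: tame_cst.
  - by apply: tameM => //; exact: tame_cst.
  rewrite !level_massZ//; first exact: tame_resid.
  exact: tame_cst.
have bM : `|b| <= 2 * M := moment_bias j.
(* Since f = (1 + <theta, x>) / 2, this is half of the bias b, at most M, plus half of <theta,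
   moment>, at most M / 2. *)
have GM : `|G| <= 3 / 2 * M.
  have [theta th1 fE] := Ff.
  have tr := tame_resid j.
  have td : tame (fun z => dotp theta (vec z.1) * (z.2%:R - grid_pt N j)).
    apply: tameM => //.
    have -> : (fun z : sample => dotp theta (vec z.1)) = (fun z => 2 * f z.1 + (-1)).
      by apply/funext => z; rewrite fE; field.
    by apply: tameD; [apply: tameM => //|]; exact: tame_cst.
  have -> : G = 2^-1 * b + 2^-1 * dotp theta (moment j).
    rewrite -moment_dotp /b -!level_massZ// -level_massD//; last 2 first.
    - by apply: tameM => //; exact: tame_cst.
    - by apply: tameM => //; exact: tame_cst.
    by apply: eq_level_mass => z _; rewrite fE -/zj; field.
  have : `|dotp theta (moment j)| <= M.
    apply: (le_trans (ler_dotp _ _)); rewrite -[leRHS]mul1r.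
    by rewrite ler_wpM2r// norm2_ge0.
  move: bM; rewrite !ler_norml; lra.
have excess : n * (zj * l c true + (1 - zj) * l c false -
   (zj * l a true + (1 - zj) * l a false)) <= 0.
  by rewrite mulr_ge0_le0// subr_le0.
have c1M : `|c1| <= 6.
  have := b1 _ Ik; have := b1 _ Ia; have := b2 _ Ik; have := b2 _ Ia.
  have /I01P/andP[a0 a1] := Ia.
  have : `|s1 * a| <= 1 by rewrite normrM (ger0_norm a0); nra.
  have : `|s2 * a| <= 1 by rewrite normrM (ger0_norm a0); nra.
  rewrite /c1 /c0 !ler_norml; lra.
have c3M : `|c3| <= 2 by move: s1n s2n; rewrite /c3 !ler_norml; lra.
(* Because a is the mean of f, the slopes cancel in the part without residuals and leave n times the
   excess risk of c over a, which is nonpositive. The rest is at most 6 * 2 M + 2 * (3 / 2) M = 15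
   M. *)
have -> : (c0 + c1 * zj) * n + (c1 * b + ((- s2 + c3 * zj) * F + c3 * G)) =
  n * (zj * l c true + (1 - zj) * l c false -
   (zj * l a true + (1 - zj) * l a false)) + (c1 * b + c3 * G).
  by rewrite Fa /c3 /c1 /c0; ring.
have h1 : c1 * b <= 12 * M.
  apply: (le_trans (ler_norm _)); rewrite normrM.
  have := normr_ge0 c1; have := normr_ge0 b; nra.
have h2 : c3 * G <= 3 * M.
  apply: (le_trans (ler_norm _)); rewrite normrM.
  have := normr_ge0 c3; have := normr_ge0 G; nra.
lra.
Qed.

End omniprediction_gap.

(** * Online-to-batch reduction *)

Section real_fubini.
Context {R : realType} {d1 d2 : measure_display}.
Context {X1 : measurableType d1} {X2 : measurableType d2}.
Variables (Q1 : probability X1 R) (Q2 : probability X2 R).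

Lemma measurable_Rintegral (h : X1 * X2 -> R) : measurable_fun setT h ->
  measurable_fun setT (fun x => \int[Q2]_y h (x, y)).
Proof.
move=> mh; rewrite /Rintegral.
apply: measurableT_comp => //.
have mE : measurable_fun setT (EFin \o h) by exact/measurable_EFinP.
rewrite (_ : (fun x => _) = (fun x => \int[Q2]_y (EFin \o h)^\+ (x, y) -
    \int[Q2]_y (EFin \o h)^\- (x, y))%E).
  apply: emeasurable_funB.
    exact (measurable_fun_fubini_tonelli_F _ (measurable_funepos mE)
      (fun a => funepos_ge0 (EFin \o h) a)).
  exact (measurable_fun_fubini_tonelli_F _ (measurable_funeneg mE)
    (fun a => funeneg_ge0 (EFin \o h) a)).
apply/funext => x; rewrite integralE.
by congr (_ - _)%E; apply: eq_integral => y _; rewrite !(funeposE, funenegE).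
Qed.

Variables (h : X1 * X2 -> R) (M : R).
Hypotheses (mh : measurable_fun setT h) (hM : forall a, `|h a| <= M).

Let inth : (Q1 \x Q2)%E.-integrable setT (EFin \o h).
Proof. exact: (bounded_integrable (Q1 \x Q2)%E measurableT mh (fun a _ => hM a)). Qed.

Let int2 x : Q2.-integrable setT (EFin \o (fun y => h (x, y))).
Proof.
apply: (bounded_integrable Q2 measurableT (M := M)) => [|y _]; last exact: hM.
exact: measurable_fun_pair2.
Qed.

Let int1 y : Q1.-integrable setT (EFin \o (fun x => h (x, y))).
Proof.
apply: (bounded_integrable Q1 measurableT (M := M)) => [|x _]; last exact: hM.
exact: measurable_fun_pair1.
Qed.

Lemma Rfubini12 : \int[(Q1 \x Q2)%E]_a h a = \int[Q1]_x \int[Q2]_y h (x, y).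
Proof.
rewrite /Rintegral -(integral12_prod_meas1 inth); congr fine.
apply: eq_integral => x _; rewrite /fubini_F fineK//.
exact: (integrable_fin_num measurableT (int2 x)).
Qed.

Lemma Rfubini21 : \int[(Q1 \x Q2)%E]_a h a = \int[Q2]_y \int[Q1]_x h (x, y).
Proof.
rewrite /Rintegral -(integral21_prod_meas1 inth); congr fine.
apply: eq_integral => y _; rewrite /fubini_G fineK//.
exact: (integrable_fin_num measurableT (int1 y)).
Qed.

End real_fubini.

Section second_moment.
Context {R : realType} {dX : measure_display} {X : measurableType dX}.
Variable Q : probability X R.

Lemma Rintegral_cst1 (c : R) : \int[Q]_x c = c.
Proof. by rewrite Rintegral_cst// [fine _](congr1 fine (probability_setT Q)) mulr1. Qed.

(** Jensen's inequality for the square, from the nonnegative integral of (h - c)^2 with c the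
    mean. *)
Lemma sqr_Rintegral_le (h : X -> R) (M : R) : measurable_fun setT h ->
  (forall x, `|h x| <= M) -> (\int[Q]_x h x) ^+ 2 <= \int[Q]_x (h x ^+ 2).
Proof.
move=> mh hM; set c := \int[Q]_x h x.
have ih : Q.-integrable setT (EFin \o h).
  exact: (bounded_integrable Q measurableT mh (fun x _ => hM x)).
have ih2 : Q.-integrable setT (EFin \o (fun x => h x ^+ 2)).
  apply: (bounded_integrable Q measurableT (M := M ^+ 2)) => [|x _].
    exact: measurable_funX.
  by rewrite normrX ler_pXn2r// nnegrE// (le_trans _ (hM x)).
have ilin : Q.-integrable setT (EFin \o (fun x => 2 * c * h x)).
  rewrite (_ : _ \o _ = (fun x => (2 * c)%:E * (h x)%:E)%E)//.
  exact: (integrableZl measurableT _ ih).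
have ic : Q.-integrable setT (EFin \o (fun=> c ^+ 2)).
  by apply: (bounded_integrable Q measurableT (M := `|c ^+ 2|)).
have ihl : Q.-integrable setT (EFin \o (fun x => h x ^+ 2 - 2 * c * h x)).
  rewrite (_ : _ \o _ = ((EFin \o (fun x => (h x ^+ 2)%R)) \-
    (EFin \o (fun x => (2 * c * h x)%R)))%E)//.
  exact: integrableB.
have : 0 <= \int[Q]_x (h x ^+ 2 - 2 * c * h x + c ^+ 2).
  apply: Rintegral_ge0 => x _.
  rewrite (_ : _ + _ = (h x - c) ^+ 2); [exact: sqr_ge0|ring].
rewrite RintegralD// RintegralB// RintegralZl// Rintegral_cst1 -/c; lra.
Qed.

End second_moment.

Section error_bound.
Context {R : realType} {d N T : nat}.
Variables (D : probability (d.-tuple R * bool)%type R).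
Variable v : 'I_T -> d.-tuple R -> 'I_N.+1.
Hypotheses (d0 : (0 < d)%N) (N0 : (0 < N)%N) (T0 : (0 < T)%N).
Hypothesis mv : forall t j, measurable [set x | v t x = j].
Hypothesis DK : D sample_space = 1%E.
Notation sample := (d.-tuple R * bool)%type.

Lemma sum_at_level (F : 'I_N.+1 -> R) i : \sum_j (i == j)%:R * F j = F i.
Proof.
rewrite (bigD1 i)//= eqxx mul1r big1 ?addr0// => j ji.
by rewrite eq_sym (negbTE ji) mul0r.
Qed.

(** The integrand is split according to the predicted level, and each level is bounded uniformly in
    its loss and competitor, so the supremum is free. The trivial bound 2 settles the cases T < d
    and epsilon >= 2. *)
Lemma DSOmni_le k : best_response L_cvx k ->
  (DSOmni L_cvx F_aff_res k D v <= (15 / T%:R * \sum_j norm2 (moment D v j))%:E)%E /\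
  (DSOmni L_cvx F_aff_res k D v <= 2%:E)%E.
Proof.
move=> kP; rewrite /DSOmni.
have Tp : 0 < T%:R :> R by rewrite ltr0n.
have mK : measurable (sample_space : set sample) := measurable_sample_space d0.
have key l f : (forall j, L_cvx (l j)) -> (forall j, F_aff_res (f j)) ->
  exists e : R, [/\ ((T%:R^-1)%:E * \sum_(t < T)
    \int[D]_(z in contexts `*` [set: bool])
      let w := v t z.1 in (l w (k (l w) (grid_pt N w)) z.2 - l w (f w z.1) z.2)%:E)%E = e%:E,
    e <= 15 / T%:R * \sum_j norm2 (moment D v j) & e <= 2].
  move=> Ll Ff.
  pose h j (z : sample) := l j (k (l j) (grid_pt N j)) z.2 - l j (f j z.1) z.2.
  have Ik j : I01 (k (l j) (grid_pt N j)).
    have Iz : I01 (grid_pt N j : R) by apply/I01P; exact: grid_pt_itv.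
    exact: (best_responseP kP (Ll j) Iz Iz).1.
  have th j : tame (h j).
    apply: tameD; first exact: tame_loss_label.
    have -> : (fun z : sample => - l j (f j z.1) z.2) = (fun z => (-1) * l j (f j z.1) z.2).
      by apply/funext => z; rewrite mulN1r.
    by apply: tameM; [exact: tame_cst|exact: (tame_loss (Ll j) (Ff j))].
  pose gap t (z : sample) := \sum_j (v t z.1 == j)%:R * h j z.
  have tg t : tame (gap t).
    by apply: tame_sum => j; apply: tameM => //; exact: tame_predict.
  have intE t : (\int[D]_(z in contexts `*` [set: bool])
      let w := v t z.1 in (l w (k (l w) (grid_pt N w)) z.2 - l w (f w z.1) z.2)%:E)%E
      = (\int[D]_(z in sample_space) gap t z)%:E.
    rewrite fineK; last exact: (integrable_fin_num mK (tame_integrable D d0 (tg t))).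
    by apply: eq_integral => z _; rewrite /gap (sum_at_level (fun j => h j z)).
  exists (T%:R^-1 * \sum_(t < T) \int[D]_(z in sample_space) gap t z); split.
  - by rewrite EFinM -sumEFin; congr (_ * _)%E; apply: eq_bigr => t _; rewrite intE.
  - rewrite [15 / _]mulrC -mulrA ler_pM2l ?invr_gt0//.
    have -> : \sum_(t < T) \int[D]_(z in sample_space) gap t z = \sum_j level_mass D v j (h j).
      rewrite /level_mass exchange_big; apply: eq_bigr => t _ /=.
      have [|_ ->//] := @Rintegral_sum _ _ _ D _ (index_enum 'I_N.+1)
         (fun j z => (v t z.1 == j)%:R * h j z) sample_space mK.
      move=> j; apply: tame_integrable => //; apply: tameM => //.
      exact: tame_predict.
    rewrite mulr_sumr; apply: ler_sum => j _.
    exact: (level_gap D d0 N0 mv j kP (Ll j) (Ff j)).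
  - rewrite mulrC ler_pdivrMr//.
    apply: (@le_trans _ _ (\sum_(t < T) 2)); last by rewrite sumr_const card_ord -[leLHS]mulr_natr.
    apply: ler_sum => t _.
    apply: (@le_trans _ _ (\int[D]_(z in sample_space) 2)).
      apply: le_Rintegral => //; first exact: tame_integrable.
        by apply: tame_integrable => //; exact: tame_cst.
      move=> z Kz; rewrite /gap (sum_at_level (fun j => h j z)) /h.
      have [H1 _ _] := lossP z.2 (Ll (v t z.1)).
      have := H1 _ (Ik (v t z.1)).
      have := H1 _ ((tame_aff (Ff (v t z.1))).2 z Kz).
      rewrite !ler_norml; lra.
    rewrite Rintegral_cst// [fine _](_ : _ = 1) ?mulr1//.
    exact: (congr1 fine DK).
split; apply: ge_ereal_sup => _ [l [f [Ll Ff ->]]];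
  by have [e [-> e1 e2]] := key l f Ll Ff; rewrite lee_fin.
Qed.

End error_bound.

(** * Deviation between the learned predictors and the online run *)

Section sampling.
Context {R : realType} {d N T : nat}.
Variables (D : probability (d.-tuple R * bool)%type R).
Variables (stat : 'M[R]_N.+1 -> 'cV[R]_N.+1) (theta1 : 'I_N.+1 -> 'cV[R]_d).
Variables (dS : measure_display) (S : measurableType dS) (mu : probability S R).
Variable draw : S -> d.-tuple R -> 'cV[R]_N.+1 -> 'I_N.+1.
Hypotheses (d0 : (0 < d)%N) (N0 : (0 < N)%N) (T0 : (0 < T)%N).
Hypotheses (theta1B : forall i, ball4 (theta1 i)) (statP : stationary_rule stat).
Hypothesis drawP : sampling_rule mu draw.
Hypothesis DK : D sample_space = 1%E.
Variables (dO : measure_display) (Omega : measurableType dO) (P : probability Omega R).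
Variables (Z : 'I_T -> Omega -> d.-tuple R * bool) (U : 'I_T -> Omega -> S).
Notation sample := (d.-tuple R * bool)%type.
Let W t w : sample * S := (Z t w, U t w).
Hypothesis iidW : iid P W (D \x mu)%E.
Variable z0 : sample.
Hypothesis Kz0 : sample_space z0.

Let mK : measurable (sample_space : set sample) := measurable_sample_space d0.

(** Extended beyond T by [z0], itself in [sample_space], because the trajectory is driven by an
    infinite sequence of admissible contexts. *)
Definition past_sample (w : Omega) (s : nat) : sample :=
  nth z0 [seq Z i w | i <- enum 'I_T] s.

Definition run (t : nat) (w : Omega) := traj stat theta1 (past_sample w) t.

Lemma past_sample_ord w (t : 'I_T) : past_sample w t = Z t w.
Proof.
by rewrite /past_sample (nth_map t) ?size_enum_ord// nth_ord_enum.
Qed.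

Lemma learnedE w t :
  learned stat draw theta1 Z U w t = predictor stat draw (run t w) (U t w).
Proof.
rewrite /learned (state_before_traj _ _ z0)// size_map size_enum_ord.
exact: ltnW.
Qed.

Lemma measurable_state_comp d1 d2 (Y1 : measurableType d1) (Y2 : measurableType d2)
    (st : Y2 -> state R d N) (phi : Y1 -> Y2) :
  measurable_state st -> measurable_fun setT phi ->
  measurable_state (fun y => st (phi y)).
Proof.
move=> [mt mg] mphi; split=> i a b.
  exact: (measurableT_comp (mt i a b) mphi).
exact: (measurableT_comp (mg i a b) mphi).
Qed.

Lemma measurable_run (t : nat) : (t <= T)%N ->
  measurable_state (fun w : past W t => run t w).
Proof.
move=> tT.
have H s : (s < t)%N -> measurable_fun setT (fun w : past W t => past_sample w s).
  move=> st; have sT := leq_trans st tT.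
  rewrite (_ : (fun w => _) = (fun w : past W t => (W (Ordinal sT) w).1)).
    have mW := @measurable_past_W _ _ _ _ _ W t (Ordinal sT) st.
    exact (measurableT_comp measurable_fst mW).
  by apply/funext => w; exact: (past_sample_ord w (Ordinal sT)).
exact (@measurable_traj R d N _ (past W t) stat statP theta1
  (fun s w => past_sample w s) t theta1B H).
Qed.

(** Indexed by pairs so that the N + 1 vectors form one vector of dimension (N + 1) d and a single
    concentration bound covers them all. The indicator keeps the entries bounded off
    [sample_space]. *)
Definition resid (i : 'I_N.+1 * 'I_d) (z : sample) : R :=
  \1_sample_space z * (tnth z.1 i.2 * (z.2%:R - grid_pt N i.1)).

Lemma measurable_resid i : measurable_fun setT (resid i).
Proof.
apply: measurable_funM; first exact: measurable_indic.
apply: measurable_funM.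
  exact: (measurableT_comp (measurable_tnth i.2) measurable_fst).
by apply: measurable_funB => //; apply: measurable_bool_real.
Qed.

Lemma label_resid_le1 (y : bool) (j : 'I_N.+1) : `|y%:R - grid_pt N j| <= 1 :> R.
Proof. by have := @grid_pt_itv R _ N0 j; rewrite ler_norml; case: y => /=; lra. Qed.

Lemma sum_sqr_resid j z : \sum_k resid (j, k) z ^+ 2 <= 1.
Proof.
rewrite /resid indicE; have [/set_mem Kz|_] := boolP (z \in sample_space); last first.
  by rewrite big1 ?ler01// => k _; rewrite mul0r expr0n.
have [[n1 _] _] := Kz; rewrite norm2_le// expr1n dotpE in n1.
apply: (@le_trans _ _ (\sum_k vec z.1 k 0 * vec z.1 k 0)); last exact: n1.
apply: ler_sum => k _; rewrite mul1r exprMn !mxE -expr2 ler_piMr ?sqr_ge0//.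
rewrite -real_normK ?num_real// expr_le1//; exact: label_resid_le1.
Qed.

Lemma resid_le1 i z : `|resid i z| <= 1.
Proof.
rewrite -(@expr_le1 _ 2)// real_normK ?num_real//.
case: i => j k; apply: le_trans (sum_sqr_resid j z).
by rewrite (bigD1 k)//= lerDl; apply: sumr_ge0 => l _; exact: sqr_ge0.
Qed.

Definition drawn (t : nat) (w : Omega) (s : S) (j : 'I_N.+1) (z : sample) : R :=
  (predictor stat draw (run t w) s z.1 == j)%:R.

Lemma drawn_itv t w s j z : 0 <= drawn t w s j z <= 1.
Proof. by rewrite /drawn; case: eqP; rewrite /= ?lexx ?ler01. Qed.

Lemma measurable_drawn_gen dY (Y : measurableType dY) (st : Y -> state R d N)
    (s : Y -> S) (x : Y -> d.-tuple R) j :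
  measurable_state st -> measurable_fun setT s -> measurable_fun setT x ->
  measurable [set y | predictor stat draw (st y) (s y) (x y) = j].
Proof.
move=> mst ms mx.
pose tp y : N.+1.-tuple R := [tuple forecast stat (st y) (x y) i 0 | i < N.+1].
have tpE y : vec (tp y) = forecast stat (st y) (x y).
  by apply/matrixP => i l; rewrite mxE tnth_mktuple (ord1 l).
have mtp : measurable_fun setT tp.
  apply/measurable_fun_tnthP => i.
  rewrite (_ : _ \o _ = (fun y => forecast stat (st y) (x y) i 0)).
    exact: measurable_forecast.
  by apply/funext => y /=; rewrite tnth_mktuple.
pose phi y : S * d.-tuple R * N.+1.-tuple R := (s y, x y, tp y).
have mphi : measurable_fun setT phi.
  by apply: measurable_fun_pair => //; exact: measurable_fun_pair.
rewrite (_ : [set y | _] = phi @^-1`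
  [set a : S * d.-tuple R * N.+1.-tuple R | draw a.1.1 a.1.2 (vec a.2) = j]).
  rewrite -[X in measurable X]setTI; apply: mphi => //.
  exact: drawP.2.
by apply/seteqP; split=> y; rewrite /= tpE.
Qed.

Lemma measurable_drawn dY (Y : measurableType dY) (st : Y -> state R d N)
    (s : Y -> S) (x : Y -> d.-tuple R) j :
  measurable_state st -> measurable_fun setT s -> measurable_fun setT x ->
  measurable_fun setT (fun y => (predictor stat draw (st y) (s y) (x y) == j)%:R : R).
Proof.
move=> mst ms mx; apply: measurable_bool_real.
apply: (measurable_fun_bool true); rewrite setTI.
rewrite (_ : _ @^-1` _ = [set y | predictor stat draw (st y) (s y) (x y) = j]).
  exact: measurable_drawn_gen.
by apply/seteqP; split=> y /= /eqP.
Qed.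

Lemma measurable_state_cst dY (Y : measurableType dY) (st : state R d N) :
  measurable_state (fun _ : Y => st).
Proof. by split=> i; exact: measurable_mx_cst. Qed.

(** Population term of the predictor drawn with the new seed, minus the term of the online run at
    the new sample: one martingale accounts for both sources of randomness. *)
Definition increment (t : 'I_T) (w : Omega) (a : sample * S)
    (i : 'I_N.+1 * 'I_d) : R :=
  \int[D]_z (drawn t w a.2 i.1 z * resid i z) -
  forecast stat (run t w) a.1.1 i.1 0 * resid i a.1.

Lemma measurable_increment (t : 'I_T) i :
  measurable_fun setT (fun a : past W t * (sample * S) => increment t a.1 a.2 i).
Proof.
have mrun := measurable_run (ltnW (ltn_ord t)).
apply: measurable_funB.
  pose h (b : (past W t * S) * sample) : R :=
    drawn t b.1.1 b.1.2 i.1 b.2 * resid i b.2.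
  have mh : measurable_fun setT h.
    apply: measurable_funM; last exact: (measurableT_comp (measurable_resid i) measurable_snd).
    apply: (@measurable_drawn _ _ (fun b : (past W t * S) * sample => run t b.1.1)
      (fun b => b.1.2) (fun b => b.2.1)).
    - apply: (measurable_state_comp mrun).
      exact: (measurableT_comp measurable_fst measurable_fst).
    - exact: (measurableT_comp measurable_snd measurable_fst).
    - exact: (measurableT_comp measurable_fst measurable_snd).
  have mH := measurable_Rintegral D mh.
  pose phi (a : past W t * (sample * S)) : past W t * S := (a.1, a.2.2).
  have mphi : measurable_fun setT phi.
    apply: measurable_fun_pair; first exact: measurable_fst.
    exact: (measurableT_comp measurable_snd measurable_snd).
  exact (measurableT_comp mH mphi).
apply: measurable_funM.
  apply: (@measurable_forecast R d N _ _ stat statP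
    (fun a : past W t * (sample * S) => run t a.1) (fun a => a.2.1.1)).
  - by apply: (measurable_state_comp mrun); exact: measurable_fst.
  - apply: (measurableT_comp measurable_fst).
    exact: (measurableT_comp measurable_fst measurable_snd).
apply: (measurableT_comp (measurable_resid i)).
exact: (measurableT_comp measurable_fst measurable_snd).
Qed.

Let measurable_drawn_fixed t w j :
  measurable_fun setT (fun b : S * sample => drawn t w b.1 j b.2).
Proof.
apply: (@measurable_drawn _ _ (fun b : S * sample => run t w) fst (fun b => b.2.1)).
- exact: measurable_state_cst.
- exact: measurable_fst.
- exact: (measurableT_comp measurable_fst measurable_snd).
Qed.

Let measurable_drawn_sample t w s j : measurable_fun setT (drawn t w s j).
Proof.
exact: (measurable_fun_pair2 s (@measurable_drawn_fixed t w j)).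
Qed.

Let measurable_forecast_sample t w j :
  measurable_fun setT (fun z : sample => forecast stat (run t w) z.1 j 0).
Proof.
have H := @measurable_forecast R d N _ sample stat statP (fun=> run t w) fst
  (measurable_state_cst _ _) measurable_fst.
exact (H j 0).
Qed.

Let drawn_mean t w j z : \int[mu]_s drawn t w s j z = forecast stat (run t w) z.1 j 0.
Proof.
have pp := forecast_prob N0 statP (run t w) z.1.
have := drawP.1 z.1 _ pp j => muE.
pose A := [set s | draw s z.1 (forecast stat (run t w) z.1) = j].
have mA : measurable A.
  apply: (@measurable_drawn_gen _ S (fun=> run t w) id (fun=> z.1) j).
  - exact: measurable_state_cst.
  - exact: measurable_id.
  - exact: measurable_cst.
rewrite /Rintegral (eq_integral (fun s => (\1_A s)%:E)).
  by rewrite integral_indic// setIT; exact: (congr1 fine muE).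
move=> s _; rewrite indicE /drawn /predictor; congr (_%:R%:E).
by congr nat_of_bool; apply/idP/idP => [/eqP h|]; [exact/mem_set|move=> /set_mem ->].
Qed.

Let drawn_resid_le1 t w s i z : `|drawn t w s i.1 z * resid i z| <= 1.
Proof.
have /andP[h0 h1] := drawn_itv t w s i.1 z; have h2 := resid_le1 i z.
by rewrite normrM (ger0_norm h0) mulr_ile1.
Qed.

Let forecast_resid_le1 t w i z : `|forecast stat (run t w) z.1 i.1 0 * resid i z| <= 1.
Proof.
have h0 := forecast_ge0 N0 statP (run t w) z.1 i.1.
have h1 := forecast_le1 N0 statP (run t w) z.1 i.1.
rewrite normrM (ger0_norm h0); have := resid_le1 i z.
by have := normr_ge0 (resid i z); nra.
Qed.

(** Averaging the seed turns the drawn indicator into the forecast, by [drawn_mean]; after Fubini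
    both terms are the integral of the forecast times [resid] under D. *)
Lemma increment_mean (t : 'I_T) w i : \int[(D \x mu)%E]_a increment t w a i = 0.
Proof.
pose F s := \int[D]_z (drawn t w s i.1 z * resid i z).
pose B z := forecast stat (run t w) z.1 i.1 0 * resid i z.
pose h (b : S * sample) := drawn t w b.1 i.1 b.2 * resid i b.2.
have mh : measurable_fun setT h.
  apply: measurable_funM; first exact: measurable_drawn_fixed.
  exact: (measurableT_comp (measurable_resid i) measurable_snd).
have hM b : `|h b| <= 1 by exact: drawn_resid_le1.
have mF : measurable_fun setT F := measurable_Rintegral D mh.
have FM s : `|F s| <= 1.
  rewrite -(@expr_le1 _ 2)// real_normK ?num_real//.
  apply: le_trans (sqr_Rintegral_le D (M := 1) _ _) _.
  - exact: (measurable_fun_pair2 s mh).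
  - by move=> z; exact: drawn_resid_le1.
  rewrite -[leRHS](Rintegral_cst1 D 1); apply: le_Rintegral => //.
  - apply: (bounded_integrable D measurableT (M := 1)) => [|z _].
      by apply: measurable_funX; exact: (measurable_fun_pair2 s mh).
    by rewrite normrX expr_le1// drawn_resid_le1.
  - by apply: (bounded_integrable D measurableT (M := 1)) => // z _; rewrite normr1.
  - move=> z _; have := drawn_resid_le1 t w s i z.
    by rewrite ler_norml => /andP[? ?]; nra.
have mB : measurable_fun setT B.
  by apply: measurable_funM; [exact: measurable_forecast_sample|exact: measurable_resid].
have BM z : `|B z| <= 1 by exact: forecast_resid_le1.
have mF2 : measurable_fun setT (fun a : sample * S => F a.2).
  exact: (measurableT_comp mF measurable_snd).
have mB1 : measurable_fun setT (fun a : sample * S => B a.1).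
  exact: (measurableT_comp mB measurable_fst).
rewrite (_ : \int[_]_a _ = \int[(D \x mu)%E]_a (F a.2 - B a.1))//.
rewrite RintegralB//; last 2 first.
- exact: (bounded_integrable (D \x mu)%E measurableT mF2 (fun a _ => FM a.2)).
- exact: (bounded_integrable (D \x mu)%E measurableT mB1 (fun a _ => BM a.1)).
rewrite (Rfubini21 D mu mF2 (fun a => FM a.2)) /=.
under eq_Rintegral do rewrite Rintegral_cst1.
rewrite (Rfubini12 D mu mB1 (fun a => BM a.1)) /=.
under [X in _ - X]eq_Rintegral do rewrite Rintegral_cst1.
rewrite /F -(Rfubini12 mu D mh hM) (Rfubini21 mu D mh hM) /h /=.
apply/eqP; rewrite subr_eq0; apply/eqP; apply: eq_Rintegral => z _.
rewrite RintegralZr//; first by rewrite drawn_mean.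
apply: (bounded_integrable mu measurableT (M := 1)) => [|s _].
  exact: (measurable_fun_pair1 z (@measurable_drawn_fixed t w i.1)).
by have /andP[h0 h1] := drawn_itv t w s i.1 z; rewrite ger0_norm.
Qed.

(** Summing over the grid costs nothing: exactly one level is drawn, and the forecast is a
    probability vector. Both terms thus have squared norm at most 1, and their difference at most 2
    + 2. *)
Lemma increment_bound (t : 'I_T) w a : \sum_i increment t w a i ^+ 2 <= 4.
Proof.
pose A i := \int[D]_z (drawn t w a.2 i.1 z * resid i z).
pose B i := forecast stat (run t w) a.1.1 i.1 0 * resid i a.1.
have mAi i : measurable_fun setT (fun z => drawn t w a.2 i.1 z * resid i z).
  by apply: measurable_funM; [exact: measurable_drawn_sample|exact: measurable_resid].
have sumA : \sum_i A i ^+ 2 <= 1.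
  pose q i z := (drawn t w a.2 i.1 z * resid i z) ^+ 2.
  have iq i : D.-integrable setT (EFin \o q i).
    apply: (bounded_integrable D measurableT (M := 1)) => [|z _].
      exact: measurable_funX.
    by rewrite normrX expr_le1// drawn_resid_le1.
  apply: (@le_trans _ _ (\sum_i \int[D]_z q i z)).
    apply: ler_sum => i _; apply: (sqr_Rintegral_le D (mAi i)) => z.
    exact: drawn_resid_le1.
  have [isum <-] := Rintegral_sum (index_enum ('I_N.+1 * 'I_d)%type) measurableT iq.
  rewrite -[leRHS](Rintegral_cst1 D 1); apply: le_Rintegral => //.
    by apply: (bounded_integrable D measurableT (M := 1)) => // z _; rewrite normr1.
  move=> z _; rewrite /q -(pair_bigA _ (fun j k => (drawn t w a.2 j z * resid (j, k) z) ^+ 2)) /=.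
  apply: (@le_trans _ _ (\sum_j drawn t w a.2 j z * 1)).
    apply: ler_sum => j _; under eq_bigr do rewrite exprMn; rewrite -mulr_sumr.
    have -> : drawn t w a.2 j z ^+ 2 = drawn t w a.2 j z.
      by rewrite /drawn; case: eqP; rewrite ?expr1n ?expr0n.
    by rewrite ler_wpM2l ?sum_sqr_resid//; have /andP[] := drawn_itv t w a.2 j z.
  by rewrite /drawn (sum_at_level (fun=> 1)).
have sumB : \sum_i B i ^+ 2 <= 1.
  rewrite /B -(pair_bigA _ (fun j k =>
    (forecast stat (run t w) a.1.1 j 0 * resid (j, k) a.1) ^+ 2)) /=.
  have [p0 p1] := forecast_prob N0 statP (run t w) a.1.1.
  rewrite -[leRHS]p1; apply: ler_sum => j _.
  under eq_bigr do rewrite exprMn; rewrite -mulr_sumr.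
  have pj0 := p0 j; have pj1 := forecast_le1 N0 statP (run t w) a.1.1 j.
  have := sum_sqr_resid j a.1.
  have : 0 <= \sum_k resid (j, k) a.1 ^+ 2 by apply: sumr_ge0 => k _; exact: sqr_ge0.
  set u := \sum_k _ => u0 u1; nra.
apply: (@le_trans _ _ (\sum_i (2 * A i ^+ 2 + 2 * B i ^+ 2))).
  apply: ler_sum => i _; rewrite /increment -/(A i) -/(B i).
  rewrite -subr_ge0 (_ : _ - _ = (A i + B i) ^+ 2); [exact: sqr_ge0|ring].
rewrite big_split /= -!mulr_sumr; lra.
Qed.

Lemma learned_error_whp (k : (R -> bool -> R) -> R -> R) (delta : R) :
  best_response L_cvx k -> 0 < delta < 1 ->
  whp P delta [set w |
    (DSOmni L_cvx F_aff_res k D (learned stat draw theta1 Z U w) <=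
     (15 / T%:R * (Num.sqrt (T%:R * ((N%:R + 1) * (5760 * d%:R * ln (expR 1 + T%:R / d%:R)) +
                    T%:R / (4 * N%:R ^+ 2))) +
       Num.sqrt ((N%:R + 1) * (16 * 4 * T%:R * (1 + ln delta^-1)))))%:E)%E /\
    (DSOmni L_cvx F_aff_res k D (learned stat draw theta1 Z U w) <= 2%:E)%E].
Proof.
move=> kP d01.
have Tp : 0 < T%:R :> R by rewrite ltr0n.
have [mE PE] := @vector_azuma R dO Omega P _ _ T W (D \x mu)%E iidW _ increment 4
  T0 (ltr0n _ 4) measurable_increment increment_bound increment_mean delta d01.
set E := [set w | _] in mE PE.
pose K' : set (sample * S) := sample_space `*` setT.
have mK' : measurable K' by exact: measurableX.
(* The regret bound is pathwise but needs admissible contexts; almost surely all samples are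
   admissible. *)
pose Az := \bigcap_(t in [set` [set: 'I_T]%SET]) (W t @^-1` K').
have [mW lawW indW] := iidW.
have mAz : measurable Az.
  apply: fin_bigcap_measurable => // t _.
  by rewrite -[X in measurable X]setTI; apply: mW.
have PAz : P Az = 1%E.
  rewrite /Az (indW _ (fun=> K') (fun=> mK')) big1// => t _.
  rewrite lawW//; have -> : (D \x mu)%E K' = (D sample_space * mu setT)%E.
    by rewrite product_measure1E.
  by rewrite DK probability_setT mul1e.
exists (E `&` Az); last first.
  apply: (le_trans PE).
  have PD : P (E `\` Az) = 0%E.
    apply/eqP; rewrite eq_le measure_ge0 andbT.
    apply: (@le_trans _ _ (P (~` Az))).
      by apply: le_measure; rewrite ?inE; [exact: measurableD|exact: measurableC|move=> w []].
    by rewrite probability_setC// PAz subee.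
  apply: (@le_trans _ _ (P (E `\` Az) + P (E `&` Az))%E); last by rewrite PD add0e.
  by rewrite le_eqVlt; apply/orP; left; apply/eqP; exact: (measureDI P mE mAz).
split; first exact: measurableI.
move=> w [Ew Aw] /=.
have KZ t : sample_space (Z t w) by have := Aw t; rewrite /= inE => /(_ isT)[].
set v := learned stat draw theta1 Z U w.
have vE t x : v t x = predictor stat draw (run t w) (U t w) x.
  by rewrite /v learnedE.
have mv t j : measurable [set x | v t x = j].
  rewrite (_ : [set x | _] = [set x | predictor stat draw (run t w) (U t w) x = j]).
    apply: (@measurable_drawn_gen _ _ (fun=> run t w) (fun=> U t w) id).
    - exact: measurable_state_cst.
    - exact: measurable_cst.
    - exact: measurable_id.
  by apply/seteqP; split=> x /=; rewrite vE.
have [H1 H2] := DSOmni_le d0 N0 T0 mv DK kP.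
split => //; apply: (le_trans H1); rewrite lee_fin ler_pM2l ?divr_gt0//.
have zC s : contexts (past_sample w s).1.
  have [sT|Ts] := ltnP s T.
    by rewrite (past_sample_ord w (Ordinal sT)); case: (KZ (Ordinal sT)).
  have [cz0 _] := Kz0; rewrite /past_sample nth_default;
    [exact: cz0|by rewrite size_map size_enum_ord].
have swap := swap_multicalibration d0 N0 theta1B statP zC T0.
pose V j : 'cV[R]_d := \sum_(0 <= s < T) (forecast stat (run s w) (past_sample w s).1 j 0 *
  ((past_sample w s).2%:R - grid_pt N j)) *: vec (past_sample w s).1.
pose dev j : 'cV[R]_d := \col_i mart_sum W increment T w (j, i).
(* Each increment is population minus empirical, so their sum is the gap between [moment] and
   [V]. *)
have momE j : moment D v j = V j + dev j.
  apply/matrixP => i o; rewrite (ord1 o) !mxE /level_mass /mart_sum.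
  rewrite summxE big_mkord.
  rewrite [X in _ = _ + X](eq_bigl (fun=> true)) => [|t]; last by rewrite ltn_ord.
  rewrite -big_split; apply: eq_bigr => t _ /=.
  rewrite !mxE past_sample_ord /increment /=.
  have -> : resid (j, i) (Z t w) = tnth (Z t w).1 i * ((Z t w).2%:R - grid_pt N j).
    by rewrite /resid indicE mem_set ?mul1r//; exact: KZ.
  rewrite [X in X = _](_ : _ = \int[D]_z (drawn t w (U t w) j z * resid (j, i) z)).
    by ring.
  rewrite [LHS]Rintegral_mkcond; congr (Rintegral _ _ _); apply/funext => z.
  rewrite /drawn /resid patchE indicE vE; case: ifPn => _; rewrite ?mul1r//=.
  by rewrite mul0r mulr0.
apply: (@le_trans _ _ (\sum_j norm2 (V j) + \sum_j norm2 (dev j))).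
  by rewrite -big_split; apply: ler_sum => j _; rewrite momE norm2D.
apply: lerD; first exact: swap.
have dev0 : 0 <= \sum_j norm2 (dev j) by apply: sumr_ge0 => j _; exact: norm2_ge0.
rewrite -(ger0_norm dev0) -sqrtr_sqr ler_wsqrtr//.
(* Cauchy-Schwarz over the N + 1 levels, from the sum of squares to the sum of norms. *)
apply: (@le_trans _ _ ((N%:R + 1) * \sum_j norm2 (dev j) ^+ 2)).
  have := sum_cauchy_schwarz (fun _ : 'I_N.+1 => 1 : R) (fun j => norm2 (dev j)).
  under eq_bigr do rewrite mul1r.
  under [X in _ <= X * _ -> _]eq_bigr do rewrite expr1n.
  by rewrite sumr_const card_ord natr1.
rewrite ler_wpM2l ?addr_ge0//.
apply: le_trans Ew.
rewrite -(pair_bigA _ (fun j i => mart_sum W increment T w (j, i) ^+ 2)) /=.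
apply: ler_sum => j _; rewrite sqr_norm2 dotpE.
by apply: ler_sum => i _; rewrite !mxE expr2.
Qed.

End sampling.

(** * Rates *)

Section rates.
Context {R : realType}.
Implicit Types (x y d t n lam e delta rho : R).

Lemma cube_rootK x : 0 < x -> (x `^ 3^-1) ^+ 3 = x.
Proof.
move=> x0; rewrite -powR_mulrn ?powR_ge0// -powRrM mulVf ?powRr1 ?ltW//.
Qed.

Lemma powR_invl x y : 0 < x -> x^-1 `^ y = (x `^ y)^-1.
Proof.
move=> x0; have r0 : x `^ y != 0 by rewrite gt_eqF// powR_gt0.
apply: (mulIf r0); rewrite -powRM ?invr_ge0 ?(ltW x0)//.
by rewrite !mulVf ?powR1// gt_eqF.
Qed.

Lemma ln_expR1D x : 0 <= x -> 1 <= ln (expR 1 + x).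
Proof.
move=> x0; have e0 : 0 < expR 1 :> R := expR_gt0 1.
rewrite -[leLHS](expRK (1 : R)) ler_ln ?posrE// ?lerDl//.
by rewrite ltr_wpDr.
Qed.

Lemma ln_le_sub1 x : 0 < x -> ln x <= x - 1.
Proof.
move=> x0; have := @le_ln1Dx R (x - 1); rewrite subrKC; apply.
by rewrite ltrBrDl subrr.
Qed.

Lemma sqrtr_le_sqr x y : 0 <= y -> x <= y ^+ 2 -> Num.sqrt x <= y.
Proof.
by move=> y0 xy; rewrite -(ger0_norm y0) -sqrtr_sqr ler_wsqrtr.
Qed.

Lemma sqrtr1D_le x : 0 <= x -> Num.sqrt (1 + x) <= 1 + Num.sqrt x.
Proof.
move=> x0; apply: sqrtr_le_sqr; first by rewrite addr_ge0// sqrtr_ge0.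
rewrite sqrrD sqr_sqrtr// expr1n mul1r.
by have := sqrtr_ge0 x; lra.
Qed.

(** Rounding gives rho <= 2 n and n + 1 <= 3 rho, and both roots are compared with m = t / rho,
    where m^2 = t d rho. The constants come from 132^2 >= 17280 + 1, 14^2 >= 64 * 3 and 15 * (132 +
    14) = 2190. *)
Lemma online_rate d t n rho L lam : 1 <= d -> 0 < t -> 1 <= rho -> 1 <= L ->
  0 <= lam -> t = d * rho ^+ 3 -> 1 <= n -> `|n - rho| < 1 ->
  15 / t * (Num.sqrt (t * ((n + 1) * (5760 * d * L) + t / (4 * n ^+ 2))) +
            Num.sqrt ((n + 1) * (16 * 4 * t * (1 + lam)))) <=
  2190 * L * (rho^-1 + rho^-1 * Num.sqrt lam).
Proof.
move=> d1 t0 r1 L1 l0 tE n1; rewrite ltr_norml => /andP[n2 n3].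
have r0 : 0 < rho by lra.
have n4 : rho <= 2 * n by lra.
have n5 : n + 1 <= 3 * rho by lra.
have d0 : 0 < d by lra.
have L0 : 0 < L by lra.
have n0 : 0 <= n + 1 by lra.
have lam1 : 0 < 1 + lam by lra.
have dr0 : 0 < d * rho by exact: mulr_gt0.
set m := t / rho; have m0 : 0 < m by rewrite divr_gt0.
have mE : m ^+ 2 = t * d * rho by rewrite /m tE; field; rewrite gt_eqF.
have a1 : t / (4 * n ^+ 2) <= d * rho.
  rewrite ler_pdivrMr; last by rewrite mulr_gt0// exprn_gt0//; lra.
  rewrite tE (_ : d * rho ^+ 3 = d * rho * rho ^+ 2); last by ring.
  rewrite ler_wpM2l//; first by rewrite mulr_ge0; lra.
  rewrite (_ : 4 * n ^+ 2 = (2 * n) ^+ 2); last by ring.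
  by rewrite ler_pXn2r// nnegrE; lra.
have a2 : (n + 1) * (5760 * d * L) <= 17280 * (d * rho * L).
  have dL : 0 <= d * L by rewrite mulr_ge0; lra.
  have := ler_wpM2r dL n5; lra.
have a3 : d * rho <= d * rho * L by exact: ler_peMr (ltW dr0) L1.
have b1 : Num.sqrt (t * ((n + 1) * (5760 * d * L) + t / (4 * n ^+ 2))) <= m * (132 * L).
  apply: sqrtr_le_sqr; first exact: mulr_ge0 (ltW m0) (mulr_ge0 (ler0n _ 132) (ltW L0)).
  rewrite exprMn mE.
  have -> : t * d * rho * (132 * L) ^+ 2 = t * (17424 * ((d * rho * L) * L)) by ring.
  rewrite (ler_pM2l t0).
  have : d * rho * L <= d * rho * L * L.
    exact: ler_peMr (ltW (mulr_gt0 dr0 L0)) L1.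
  by move: a1 a2 a3 dr0; clear; lra.
have b2 : Num.sqrt ((n + 1) * (16 * 4 * t * (1 + lam))) <= m * (14 * (1 + Num.sqrt lam)).
  apply: (@le_trans _ _ (m * 14 * Num.sqrt (1 + lam))); last first.
    rewrite mulrA; apply: ler_wpM2l (sqrtr1D_le l0).
    exact: mulr_ge0 (ltW m0) (ler0n _ 14).
  apply: sqrtr_le_sqr.
    exact: mulr_ge0 (mulr_ge0 (ltW m0) (ler0n _ 14)) (sqrtr_ge0 _).
  rewrite (exprMn _ (m * 14)) (exprMn _ m) sqr_sqrtr; last exact: ltW.
  rewrite mE; set w := t * (1 + lam); have w0 : 0 < w by exact: mulr_gt0.
  have -> : (n + 1) * (16 * 4 * t * (1 + lam)) = 64 * ((n + 1) * w) by rewrite /w; ring.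
  have -> : t * d * rho * 14 ^+ 2 * (1 + lam) = 196 * (d * rho * w) by rewrite /w; ring.
  have : (n + 1) * w <= 3 * rho * w by rewrite (ler_pM2r w0).
  have : rho * w <= d * rho * w.
    by rewrite (ler_pM2r w0); exact: ler_peMl (ltW r0) d1.
  by have := mulr_gt0 r0 w0; clear; lra.
have s0 := sqrtr_ge0 lam; set s := Num.sqrt lam in b2 s0 *.
apply: (@le_trans _ _ (15 / t * (m * (132 * L) + m * (14 * (1 + s))))).
  by apply: ler_wpM2l (lerD b1 b2); exact: divr_ge0 (ler0n _ 15) (ltW t0).
have -> : 15 / t * (m * (132 * L) + m * (14 * (1 + s))) =
  rho^-1 * (15 * (132 * L + 14 * (1 + s))) by rewrite /m; field; rewrite !gt_eqF.
have -> : 2190 * L * (rho^-1 + rho^-1 * s) = rho^-1 * (2190 * (L * (1 + s))) by ring.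
apply: ler_wpM2l; first by rewrite invr_ge0 ltW.
have s1 : 0 <= 1 + s := addr_ge0 ler01 s0.
have : 1 + s <= L * (1 + s) by exact: ler_peMl s1 L1.
by have := mulr_ge0 (ltW L0) s0; move: L1; clear; lra.
Qed.

(** With y = s x, ln (e + s x) <= ln s + ln (e + x) <= (s - 1) + ln (e + x) <= s ln (e + x). The
    last step uses ln (e + x) >= 1, which the shift by e ensures. *)
Lemma ln_over_id_le x y : 0 < x -> x <= y ->
  ln (expR 1 + y) / y <= ln (expR 1 + x) / x.
Proof.
move=> x0 xy; have y0 : 0 < y by lra.
have e0 : 0 < expR 1 :> R := expR_gt0 1.
have ex1 := ln_expR1D (ltW x0).
set s := y / x; have s1 : 1 <= s by rewrite ler_pdivlMr// mul1r.
have yE : y = s * x by rewrite /s divfK// gt_eqF.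
have h : ln (expR 1 + y) <= ln s + ln (expR 1 + x).
  rewrite -lnM ?posrE//; [|lra|lra].
  rewrite ler_ln ?posrE//; [|lra|rewrite mulr_gt0//; lra].
  by rewrite mulrDr -yE lerD2r ler_peMl// ltW.
have hs : ln s <= s - 1.
  exact: ln_le_sub1 (lt_le_trans ltr01 s1).
rewrite ler_pdivrMr// mulrAC ler_pdivlMr// {2}yE mulrA.
rewrite ler_pM2r//.
have : s - 1 <= (s - 1) * ln (expR 1 + x) by rewrite ler_peMr; lra.
lra.
Qed.

(** Inverts the rate. As ln (e + rho) / rho decreases, rho may be replaced by the threshold rho0 =
    q^2 Lam^2 / e. There the logarithm of e + rho^3 is at most 3 * 5 q Lam and 1 + sqrt lam is at
    most 4 Lam, so the bound becomes e * 60 C / q, which explains q = 60 C. *)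
Lemma sample_complexity_rate (C q e delta rho lam : R) :
  1 <= C -> q = 60 * C -> 0 < e -> e < 2 -> 0 < delta < 1 ->
  lam = ln delta^-1 -> 0 < rho ->
  let Lam := ln (expR 1 + (e * delta)^-1) in
  (q ^+ 2 * Lam ^+ 2 / e) ^+ 3 <= rho ^+ 3 ->
  C * ln (expR 1 + rho ^+ 3) * (rho^-1 + rho^-1 * Num.sqrt lam) <= e.
Proof.
move=> C1 qE e0 e2 /andP[d0 d1] lE r0 /=.
have E0 : 0 < expR 1 :> R := expR_gt0 1.
have E1 : 1 <= expR 1 :> R by have := expR_ge1Dx (1 : R); lra.
have ed0 : 0 < e * delta by rewrite mulr_gt0.
set F := expR 1 + (e * delta)^-1; set Lam := ln F.
have i0 : 0 < (e * delta)^-1 by rewrite invr_gt0.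
have F1 : 1 <= F by rewrite /F; lra.
have F0 : 0 < F by lra.
have Lam1 : 1 <= Lam by apply: ln_expR1D; exact: ltW.
have LamF : Lam <= F.
  by have := ln_le_sub1 F0; rewrite -/Lam; lra.
have eF : e^-1 <= F.
  apply: (@le_trans _ _ (e * delta)^-1); last by rewrite /F; lra.
  by rewrite lef_pV2 ?posrE// ler_piMr ?ltW.
set rho0 := q ^+ 2 * Lam ^+ 2 / e => H.
have q1 : 1 <= q by rewrite qE; lra.
have rho00 : 0 < rho0 by rewrite divr_gt0// mulr_gt0// exprn_gt0//; lra.
have rr : rho0 <= rho.
  by rewrite -(@ler_pXn2r _ 3)// nnegrE ltW.
have lam_le : lam <= 2 * Lam.
  have l2 : ln 2 <= 1 :> R.
    have := @le_ln1Dx R 1; apply; lra.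
  suff : lam <= ln 2 + Lam by lra.
  rewrite lE -lnM ?posrE//.
  rewrite ler_ln ?posrE ?invr_gt0 ?mulr_gt0//.
  have -> : delta^-1 = e * (e * delta)^-1 by field; rewrite !gt_eqF.
  apply: (@le_trans _ _ (2 * (e * delta)^-1)); first by rewrite ler_pM2r// ltW.
  by rewrite ler_pM2l//; rewrite /F; lra.
have lam0 : 0 <= lam.
  by rewrite lE ln_ge0// invf_ge1// ltW.
have sl : 1 + Num.sqrt lam <= 4 * Lam.
  have : Num.sqrt lam <= 1 + lam.
    by apply: sqrtr_le_sqr; [lra|have := sqr_ge0 lam; lra].
  lra.
have L3 : ln (expR 1 + rho ^+ 3) <= 3 * ln (expR 1 + rho).
  rewrite -[3 * _]/(3%:R * _) mulr_natl -lnXn; last by lra.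
  rewrite ler_ln ?posrE; [|by rewrite addr_gt0// exprn_gt0|by rewrite exprn_gt0; lra].
  have : (expR 1 : R) <= expR 1 ^+ 3 by rewrite ler_eXnr.
  have : 0 <= (expR 1 : R) ^+ 2 * rho by rewrite mulr_ge0 ?sqr_ge0// ltW.
  have : 0 <= (expR 1 : R) * rho ^+ 2 by rewrite mulr_ge0 ?sqr_ge0// ltW.
  have -> : (expR 1 + rho) ^+ 3 = expR 1 ^+ 3 + 3 * (expR 1 ^+ 2 * rho) +
     3 * (expR 1 * rho ^+ 2) + rho ^+ 3 by ring.
  lra.
have L4 : ln (expR 1 + rho0) <= 5 * q * Lam.
  have : expR 1 + rho0 <= (1 + q) ^+ 2 * F ^+ 3.
    have f1 : F <= F ^+ 3 by rewrite ler_eXnr.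
    have f2 : rho0 <= q ^+ 2 * F ^+ 3.
      rewrite /rho0 (_ : F ^+ 3 = F ^+ 2 * F); last by ring.
      rewrite -mulrA ler_wpM2l ?sqr_ge0//.
      apply: ler_pM => //; [exact: sqr_ge0|by rewrite invr_ge0 ltW|].
      by rewrite ler_pXn2r// nnegrE; lra.
    have f3 : 0 <= F ^+ 3 by rewrite exprn_ge0// ltW.
    have f4 : expR 1 <= F by rewrite /F; lra.
    have -> : (1 + q) ^+ 2 * F ^+ 3 = F ^+ 3 + 2 * (q * F ^+ 3) + q ^+ 2 * F ^+ 3 by ring.
    have : 0 <= q * F ^+ 3 by rewrite mulr_ge0//; lra.
    lra.
  move=> h; apply: (@le_trans _ _ (ln ((1 + q) ^+ 2 * F ^+ 3))).
    rewrite ler_ln ?posrE//; first lra.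
    by rewrite mulr_gt0// exprn_gt0//; lra.
  rewrite lnM ?posrE ?exprn_gt0//; last by lra.
  rewrite !lnXn//; last by lra.
  rewrite -/Lam (mulrS _ 2) !mulr2n.
  have : ln (1 + q) <= q by apply: le_ln1Dx; lra.
  have : q <= q * Lam by rewrite ler_peMr; lra.
  have : Lam <= q * Lam by rewrite ler_peMl; lra.
  lra.
have mono := ln_over_id_le rho00 rr.
have s0 := sqrtr_ge0 lam; set s := Num.sqrt lam in sl s0 *.
have -> : C * ln (expR 1 + rho ^+ 3) * (rho^-1 + rho^-1 * s) =
   C * (ln (expR 1 + rho ^+ 3) / rho) * (1 + s) by ring.
have A : ln (expR 1 + rho ^+ 3) / rho <= 3 * (5 * q * Lam / rho0).
  apply: (@le_trans _ _ (3 * (ln (expR 1 + rho) / rho))).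
    by rewrite mulrA ler_pM2r ?invr_gt0.
  rewrite ler_pM2l//; apply: (le_trans mono).
  by rewrite ler_pM2r ?invr_gt0.
apply: (@le_trans _ _ (C * (3 * (5 * q * Lam / rho0)) * (4 * Lam))).
  apply: ler_pM => //; [|lra|].
    apply: mulr_ge0; first lra.
    rewrite divr_ge0 ?(ltW r0)// ln_ge0//.
    by have := exprn_gt0 3 r0; move: E1; clear; lra.
  by rewrite ler_wpM2l//; lra.
have -> : C * (3 * (5 * q * Lam / rho0)) * (4 * Lam) = e * (60 * C / q).
  rewrite /rho0; field; rewrite !gt_eqF//; lra.
by rewrite -qE divff ?mulr1// gt_eqF//; lra.
Qed.

End rates.

Lemma whpW (R : realType) dO (Omega : measurableType dO) (P : probability Omega R)
    (delta : R) (E F : set Omega) : E `<=` F -> whp P delta E -> whp P delta F.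
Proof. by move=> EF [E0 [mE0 E0E] PE0]; exists E0 => //; split => // w /E0E /EF. Qed.

Theorem theorem4 (R : realType) :
  exists (C C' : R) (c c' : nat), [/\ 0 < C, 0 < C' &
  forall (d T N : nat),
    (0 < d)%N -> (0 < T)%N ->
    (* N is (T / d)^(1/3) rounded to a positive integer *)
    (0 < N)%N -> `|N%:R - (T%:R / d%:R) `^ 3^-1| < 1 :> R ->
  forall (D : probability (d.-tuple R * bool)%type R),
    D (contexts `*` [set: bool]) = 1%E ->
  (* the forecaster: initial vectors, stationary vectors, sampling *)
  forall (theta1 : 'I_N.+1 -> 'cV[R]_d)
         (stat : 'M[R]_N.+1 -> 'cV[R]_N.+1)
         (dS : measure_display) (S : measurableType dS) (mu : probability S R)
         (draw : S -> d.-tuple R -> 'cV[R]_N.+1 -> 'I_N.+1),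
    (forall i, ball4 (theta1 i)) ->
    stationary_rule stat ->
    sampling_rule mu draw ->
  (* i.i.d. samples, and fresh seeds independent of them *)
  forall (dO : measure_display) (Omega : measurableType dO)
         (P : probability Omega R)
         (Z : 'I_T -> Omega -> d.-tuple R * bool) (U : 'I_T -> Omega -> S),
    iid P (fun t w => (Z t w, U t w)) (D \x mu)%E ->
  forall k : (R -> bool -> R) -> R -> R,
    best_response L_cvx k ->
  let error w :=
    DSOmni L_cvx F_aff_res k D (learned stat draw theta1 Z U w) in
  (forall delta : R, 0 < delta < 1 ->
     whp P delta [set w | (error w <=
       (C * ln (expR 1 + T%:R / d%:R) ^+ c *
         ((d%:R / T%:R) `^ 3^-1 +
          (d%:R / T%:R) `^ 3^-1 * Num.sqrt (ln delta^-1)))%:E)%E]) /\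
  (forall epsilon delta : R, 0 < epsilon -> 0 < delta < 1 ->
     C' * d%:R * epsilon ^- 3 * ln (expR 1 + (epsilon * delta)^-1) ^+ c' <=
       T%:R ->
     whp P delta [set w | (error w <= epsilon%:E)%E])].
Proof.
pose C : R := 2190; pose q : R := 60 * C.
have C0 : 0 < C by rewrite ltr0n.
have q0 : 0 < q by rewrite mulr_gt0// ltr0n.
(* The cube of q^2 Lam^2 / epsilon gives the constant q^6, the power 6 of the logarithm and the
   factor epsilon^-3. *)
exists C, (q ^+ 6), 1%N, 6%N; split => //; first exact: exprn_gt0.
move=> d T N d0 T0 N0 hN D DK theta1 stat dS S mu draw theta1B statP drawP.
move=> dO Omega P Z U iidW k kP error.
have dp : 0 < d%:R :> R by rewrite ltr0n.
have Tp : 0 < T%:R :> R by rewrite ltr0n.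
have d1 : 1 <= d%:R :> R by rewrite ler1n.
have N1 : 1 <= N%:R :> R by rewrite ler1n.
have n0 : 0 < T%:R / d%:R :> R by rewrite divr_gt0.
set rho := (T%:R / d%:R) `^ 3^-1 in hN.
have rho0 : 0 < rho by rewrite powR_gt0.
have rho3 : rho ^+ 3 = T%:R / d%:R by exact: cube_rootK.
have rE : (d%:R / T%:R) `^ 3^-1 = rho^-1 by rewrite -powR_invl// invf_div.
have L1 : 1 <= ln (expR 1 + T%:R / d%:R : R) by apply: ln_expR1D; exact: ltW.
have [z0 Kz0] : exists z, (sample_space : set (d.-tuple R * bool)) z.
  apply/set0P; apply/eqP => K0.
  by move: DK; rewrite -/sample_space K0 measure0 => /eqP; rewrite eqe eq_sym oner_eq0.
have main delta : 0 < delta < 1 -> whp P delta [set w |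
   (error w <= (C * ln (expR 1 + T%:R / d%:R) *
     (rho^-1 + rho^-1 * Num.sqrt (ln delta^-1)))%:E)%E /\ (error w <= 2%:E)%E].
  move=> d01; have /andP[de0 de1] := d01.
  have lam0 : 0 <= ln delta^-1 by rewrite ln_ge0// invf_ge1// ltW.
  have s0 := sqrtr_ge0 (ln delta^-1).
  apply: whpW (learned_error_whp d0 N0 T0 theta1B statP drawP DK iidW Kz0 kP d01).
  move=> w [H1 H2]; split=> //; have [r1|r1] := leP 1 rho.
    apply: (le_trans H1); rewrite lee_fin; apply: online_rate => //.
    by rewrite rho3 mulrC divfK// gt_eqF.
  (* For T < d the claimed bound exceeds 2, and the trivial bound on the error suffices. *)
  apply: (le_trans H2); rewrite lee_fin.
  have : 1 <= rho^-1 by rewrite invf_ge1// ltW.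
  have : 0 <= rho^-1 * Num.sqrt (ln delta^-1) by rewrite mulr_ge0// invr_ge0 ltW.
  set a := rho^-1; set b := a * _; set L := ln _ in L1 * => b0 a1.
  have : 1 <= L * (a + b) by apply: mulr_ege1 => //; move: a1 b0; clear; lra.
  by rewrite -mulrA /C; clear; lra.
split=> [delta d01|e delta e0 d01 HT].
  by apply: whpW (main delta d01) => w [H1 _] /=; rewrite expr1 rE.
apply: whpW (main delta d01) => w [H1 H2] /=.
have [e2|e2] := leP 2 e; first by apply: (le_trans H2); rewrite lee_fin.
apply: (le_trans H1); rewrite lee_fin -rho3.
apply: (@sample_complexity_rate R C q e delta) => //; first by rewrite ler1n.
rewrite rho3 ler_pdivlMr//; apply: le_trans HT.
rewrite le_eqVlt; apply/orP; left; apply/eqP; field; exact: lt0r_neq0.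
Qed.
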